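(* There exists $(\omega_1,\dots,\omega_k)\in\mathcal{P}_k(\Omega)$ attaining $$\inf_{(\omega_1,\dots,\omega_k)\in\mathcal{P}_k(\Omega)}F(\lambda_1(\omega_1),\dots,\lambda_1(\omega_k)).$$
   Context: Let $N\ge2$, $k\ge 2$, and let $\Omega\subset\mathbb{R}^N$ be a bounded domain. For sets $A,B$, $\mathrm{dist}(A,B)=\inf\{|x-y|:x\in A,\ y\in B\}$. Let $$\mathcal{P}_k(\Omega)=\{(\omega_1,\dots,\omega_k):\ \omega_i\subset\Omega\text{ open and non-empty for every }i,\ \mathrm{dist}(\omega_i,\omega_j)\ge1\ \forall i\ne j\},$$ and assume $\mathcal{P}_k(\Omega)\neq\emptyset$. $\lambda_1(\omega)$ denotes the first eigenvalue of $-\Delta$ in $\omega$ with homogeneous Dirichlet boundary conditions. The cost function $F\in\mathcal{C}^1((\mathbb{R}^+)^k,\mathbb{R})$ ($\mathbb{R}^+$ the positive reals) satisfies: (i) $\partial_iF(x)>0$ for all $x\in(\mathbb{R}^+)^k$ and $i=1,\dots,k$; (ii) for every $i$ and all $(\bar x_1,\dots,\bar x_{i-1},\bar x_{i+1},\dots,\bar x_k)\in(\mathbb{R}^+)^{k-1}$, $\lim_{x_i\to+\infty}F(\bar x_1,\dots,\bar x_{i-1},x_i,\bar x_{i+1},\dots,\bar x_k)=+\infty$. *)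

(* Defs.v *)
From HB Require Import structures.
From mathcomp Require Import all_boot all_order all_algebra.
From mathcomp Require Import all_classical all_reals all_analysis.

Set Implicit Arguments.
Unset Strict Implicit.
Unset Printing Implicit Defensive.

Import Order.TTheory GRing.Theory Num.Theory.
Import numFieldNormedType.Exports.

Local Open Scope classical_set_scope.
Local Open Scope ring_scope.

(* 'rV[R]_n carries the sigma-algebra generated by its coordinates (as the
   library does for n.-tuple), which is its Borel sigma-algebra. *)
Section measurable_rV.
Context {R : realType} (n : nat).

Let coors : 'I_n -> 'rV[R]_n -> R := fun i x => x ord0 i.

Let rV_set0 : g_sigma_preimage coors set0.
Proof. exact: sigma_algebra0. Qed.

Let rV_setC A : g_sigma_preimage coors A -> g_sigma_preimage coors (~` A).
Proof. exact: sigma_algebraC. Qed.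

Let rV_bigcup (F : _^nat) : (forall i, g_sigma_preimage coors (F i)) ->
  g_sigma_preimage coors (\bigcup_i (F i)).
Proof. exact: sigma_algebra_bigcup. Qed.

HB.instance Definition _ :=
  @isMeasurable.Build (measure_tuple_display default_measure_display) 'rV[R]_n
    (g_sigma_preimage coors) rV_set0 rV_setC rV_bigcup.

End measurable_rV.

Section measurable_fun_rV.
Context {R : realType}.

Lemma measurable_coord n (i : 'I_n) :
  measurable_fun [set: 'rV[R]_n] (fun x : 'rV[R]_n => x ord0 i).
Proof.
move=> _ Y mY; rewrite setTI; apply: sub_sigma_algebra => /=.
rewrite -bigcup_seq/=; exists i => /=; first by rewrite mem_index_enum.
by exists Y => //; rewrite setTI.
Qed.

Lemma measurable_fun_rV d (T : measurableType d) n (f : T -> 'rV[R]_n) :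
  (forall i, measurable_fun [set: T] (fun x => f x ord0 i)) ->
  measurable_fun [set: T] f.
Proof.
move=> mf _ Y mY; rewrite setTI.
pose C := [set Z : set 'rV[R]_n | measurable (f @^-1` Z)].
suff : (@measurable _ 'rV[R]_n) `<=` C by apply.
apply: smallest_sub.
  split=> [|A CA|A CA]; rewrite /C/=.
  - by rewrite preimage_set0.
  - by rewrite setTD preimage_setC; exact: measurableC.
  - by rewrite preimage_bigcup; exact: bigcupT_measurable.
move=> Z; rewrite -bigcup_seq => -[i _ [A mA <-]]; rewrite /C/= setTI.
by rewrite -[X in measurable X]setTI; exact: mf.
Qed.

End measurable_fun_rV.

Section lebesgue_rV.
Context {R : realType}.

Definition rV_cons n (p : measurableTypeR R * 'rV[R]_n) : 'rV[R]_n.+1 :=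
  row_mx (p.1)%:M p.2.

Definition rV_uncons n (v : 'rV[R]_n.+1) : measurableTypeR R * 'rV[R]_n :=
  (v ord0 ord0, \row_i v ord0 (lift ord0 i)).

Lemma rV_cons0 n (p : measurableTypeR R * 'rV[R]_n) :
  rV_cons p ord0 ord0 = p.1.
Proof.
rewrite /rV_cons (_ : ord0 = lshift n (ord0 : 'I_1)); last exact/val_inj.
by rewrite (row_mxEl (p.1)%:M p.2) mxE eqxx mulr1n.
Qed.

Lemma rV_consS n (p : measurableTypeR R * 'rV[R]_n) (i : 'I_n) :
  rV_cons p ord0 (lift ord0 i) = p.2 ord0 i.
Proof.
rewrite /rV_cons (_ : lift ord0 i = rshift 1 i); last exact/val_inj.
by rewrite (row_mxEr (p.1)%:M p.2).
Qed.

Lemma rV_consK n : cancel (@rV_cons n) (@rV_uncons n).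
Proof.
move=> [x y]; rewrite /rV_uncons rV_cons0; congr pair.
by apply/rowP => i; rewrite mxE rV_consS.
Qed.

Lemma measurable_rV_cons n : measurable_fun setT (@rV_cons n).
Proof.
apply: measurable_fun_rV => i; case: (unliftP ord0 i) => [j|] ->.
  under eq_fun do rewrite rV_consS.
  apply: (measurableT_comp (measurable_coord j)); exact: measurable_snd.
under eq_fun do rewrite rV_cons0.
exact: measurable_fst.
Qed.

HB.instance Definition _ n :=
  isMeasurableFun.Build _ _ _ _ (@rV_cons n) (@measurable_rV_cons n).

Lemma measurable_rV_uncons n : measurable_fun setT (@rV_uncons n).
Proof.
apply: measurable_fun_pair; first exact: measurable_coord.
apply: measurable_fun_rV => i; under eq_fun do rewrite mxE.
exact: measurable_coord.
Qed.

Section lebesgue_rVS.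
Local Open Scope ereal_scope.
Context n (mu : {sigma_finite_measure set 'rV[R]_n -> \bar R}).

Definition lebesgue_rVS : set 'rV[R]_n.+1 -> \bar R :=
  pushforward (lebesgue_measure \x mu) (@rV_cons n).

Let lebesgue_rVS0 : lebesgue_rVS set0 = 0.
Proof. exact: measure0. Qed.

Let lebesgue_rVS_ge0 A : 0 <= lebesgue_rVS A.
Proof. exact: measure_ge0. Qed.

Let lebesgue_rVS_sigma_additive : semi_sigma_additive lebesgue_rVS.
Proof. exact: measure_semi_sigma_additive. Qed.

HB.instance Definition _ := isMeasure.Build _ _ _ lebesgue_rVS
  lebesgue_rVS0 lebesgue_rVS_ge0 lebesgue_rVS_sigma_additive.

Let lebesgue_rVS_sigma_finite : sigma_finite setT lebesgue_rVS.
Proof.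
have /sigma_finiteP[F [FT ndF Foo]] := sigma_finiteT (@lebesgue_measure R).
have /sigma_finiteP[G [GT ndG Goo]] := sigma_finiteT mu.
exists (fun i => @rV_uncons n @^-1` (F i `*` G i)).
  rewrite -preimage_bigcup (_ : \bigcup_i _ = setT) ?preimage_setT//.
  apply/seteqP; split=> // -[x y] _.
  have [k _ Fkx] : (\bigcup_i F i) x by rewrite -FT.
  have [l _ Gly] : (\bigcup_i G i) y by rewrite -GT.
  exists (maxn k l) => //; split => /=.
    by move: x Fkx; exact/subsetPset/ndF/leq_maxl.
  by move: y Gly; exact/subsetPset/ndG/leq_maxr.
move=> i; have [mF Fi] := Foo i; have [mG Gi] := Goo i; split.
  rewrite -[X in measurable X]setTI; apply: measurable_rV_uncons => //.
  exact: measurableX.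
rewrite /lebesgue_rVS /pushforward -comp_preimage.
rewrite (_ : _ \o _ = id) ?preimage_id; last exact/funext/rV_consK.
by rewrite product_measure1E// lte_mul_pinfty// ge0_fin_numE.
Qed.

HB.instance Definition _ := Measure_isSigmaFinite.Build _ _ _ lebesgue_rVS
  lebesgue_rVS_sigma_finite.

End lebesgue_rVS.

Fixpoint lebesgue_rV n : {sigma_finite_measure set 'rV[R]_n -> \bar R} :=
  match n with
  | 0%N => \d_(0 : 'rV[R]_0)
  | m.+1 => lebesgue_rVS (lebesgue_rV m)
  end.

Lemma lebesgue_rV_box n (A : 'I_n -> set R) : (forall i, measurable (A i)) ->
  (lebesgue_rV n [set x : 'rV[R]_n | forall i, A i (x ord0 i)] =
   \prod_(i < n) lebesgue_measure (A i))%E.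
Proof.
elim: n A => [|n IH] A mA.
  by rewrite big_ord0 /= diracE mem_set// => -[].
rewrite big_ord_recl -(IH (fun i => A (lift ord0 i)))//=.
rewrite /lebesgue_rVS /pushforward.
rewrite (_ : _ @^-1` _ = A ord0 `*`
    [set y : 'rV[R]_n | forall i, A (lift ord0 i) (y ord0 i)]).
  rewrite product_measure1E//=.
    exact: mA.
  rewrite (_ : [set _ | _] = \bigcap_(i in [set: 'I_n])
      ((fun x : 'rV[R]_n => x ord0 i) @^-1` A (lift ord0 i))).
    apply: fin_bigcap_measurable => // i _.
    by rewrite -[X in measurable X]setTI; exact: measurable_coord.
  by apply/seteqP; split=> y /= Ay i; [move=> _|]; exact: Ay.
apply/seteqP; split=> [p Ap|p [/= p1 p2] i].
  split=> [|i]; first by have /= := Ap ord0; rewrite rV_cons0.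
  by have /= := Ap (lift ord0 i); rewrite rV_consS.
by case: (unliftP ord0 i) => [j|] ->; rewrite ?rV_consS ?rV_cons0//; exact: p2.
Qed.

End lebesgue_rV.

Section partial_derivatives.
Context {R : realType} (n : nat).
Implicit Types (f : 'rV[R]_n -> R) (i : 'I_n).

Definition partial i f : 'rV[R]_n -> R := 'D_(delta_mx ord0 i) f.

Definition C1_on (U : set 'rV[R]_n) f := forall i x, U x ->
  derivable f x (delta_mx ord0 i) /\ {for x, continuous (partial i f)}.

Definition smooth f := forall s : seq 'I_n, let g := foldr partial f s in
  continuous g /\ forall i x, derivable g x (delta_mx ord0 i).

End partial_derivatives.

Section dirichlet.
Context {R : realType} (n : nat) (omega : set 'rV[R]_n).
Implicit Types (u phi : 'rV[R]_n -> R) (g : 'I_n -> 'rV[R]_n -> R).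

Local Notation mu := (lebesgue_rV n).

Definition test_function phi :=
  [/\ smooth phi, compact (closure [set x | phi x != 0]) &
      closure [set x | phi x != 0] `<=` omega].

Definition L2 u := measurable_fun omega u /\
  (\int[mu]_(x in omega) ((u x) ^+ 2)%:E < +oo)%E.

Definition weak_gradient u g := forall i phi, test_function phi ->
  \int[mu]_(x in omega) (u x * partial i phi x) =
  - \int[mu]_(x in omega) (g i x * phi x).

(* Elements of H^1(omega) are handled together with their weak gradient. *)
Definition H1 u g := [/\ L2 u, forall i, L2 (g i) & weak_gradient u g].

(* H^1_0(omega) is the closure of the test functions in H^1(omega). *)
Definition H10 u g := H1 u g /\
  exists phi : nat -> 'rV[R]_n -> R,
    [/\ forall m, test_function (phi m),
        (\int[mu]_(x in omega) ((u x - phi m x) ^+ 2)%:E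
          @[m --> \oo] --> 0)%E &
        forall i, (\int[mu]_(x in omega) ((g i x - partial i (phi m) x) ^+ 2)%:E
          @[m --> \oo] --> 0)%E].

(* lambda is an eigenvalue of the Dirichlet Laplacian: - Delta u = lambda u
   weakly in omega for some nonzero u in H^1_0(omega). *)
Definition dirichlet_eigenvalue (lambda : R) := exists u g,
  [/\ H10 u g, ~ {ae mu, forall x, omega x -> u x = 0} &
      forall phi, test_function phi ->
        \sum_(i < n) \int[mu]_(x in omega) (g i x * partial i phi x) =
        lambda * \int[mu]_(x in omega) (u x * phi x)].

(* The spectrum is discrete and bounded below, so this infimum is the smallest
   eigenvalue when omega is bounded, open and non-empty. *)
Definition lambda1 : R := inf [set lambda | dirichlet_eigenvalue lambda].

End dirichlet.

Section partitions.
Context {R : realType} (n : nat).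

(* The library norm on 'rV[R]_n is the sup norm. *)
Definition euclidean_norm (x : 'rV[R]_n) : R :=
  Num.sqrt (\sum_(i < n) x ord0 i ^+ 2).

Definition set_dist (A B : set 'rV[R]_n) : R :=
  inf [set euclidean_norm (x - y) | x in A & y in B].

Definition separated_partitions k (Omega : set 'rV[R]_n) :
    set ('I_k -> set 'rV[R]_n) :=
  [set w | (forall i, [/\ w i `<=` Omega, open (w i) & w i !=set0]) /\
           (forall i j, i != j -> 1 <= set_dist (w i) (w j))].

End partitions.
Arguments separated_partitions {R n} k Omega.

Section cost.
Context {R : realType} (k : nat).

Definition positive_orthant : set 'rV[R]_k := [set x | forall i, 0 < x ord0 i].

Definition set_coord (x : 'rV[R]_k) (i : 'I_k) (t : R) : 'rV[R]_k :=
  \row_j (if j == i then t else x ord0 j).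

Definition cost n (F : 'rV[R]_k -> R) (w : 'I_k -> set 'rV[R]_n) : R :=
  F (\row_i lambda1 (w i)).

End cost.
Arguments positive_orthant {R} k.

(* Main.v *)
(** Test functions suffice throughout: the first eigenvalue of a bounded open
    set is the infimum of the Dirichlet energy of its L^2-normalized test
    functions.

    Along a minimizing sequence of partitions w^n, coercivity of F and the
    Poincare inequality bound the eigenvalues of the w^n_i, so by Rellich one
    may assume that they converge to some c_i and that normalized almost
    minimizers supported in w^n_i converge in L^2 to some u_i.  The essential
    supports A_i of the u_i are at mutual distance at least 1.  Enlarge (A_i)
    to a maximal family (B_i) with this property, let C_i be the union of the
    B_j with j <> i, and let v_i be the set of the points of Omega at distance
    more than 1 from C_i.  Maximality gives v_i <= B_i, hence the v_i are at
    mutual distance at least 1 as well.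

    Now u_i vanishes on the 1-neighbourhood of C_i, and the point is to
    approximate it by test functions supported in v_i.  The boundary of a
    1-neighbourhood of an arbitrary set satisfies a uniform interior cone
    condition: near each of its points some coordinate direction leads into the
    neighbourhood.  Hence a strip of width d around it has measure O(d) in
    bounded regions, and the L^2 norm of a function on the strip is, up to its
    norm inside the neighbourhood, at most O(d) times that of its gradient on a
    slightly wider strip.  So cutting off in the strip costs arbitrarily little
    energy and the first eigenvalue of v_i is at most c_i.  Since F is
    increasing and separately continuous, v is a minimizer. *)

From HB Require Import structures.
Require Import Defs.
From mathcomp Require Import all_boot all_order all_algebra.
From mathcomp Require Import ring lra.
From mathcomp Require Import all_classical all_reals all_analysis.
From mathcomp Require Import measurable_realfun.

Set Implicit Arguments.
Unset Strict Implicit.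
Unset Printing Implicit Defensive.

Import Order.TTheory GRing.Theory Num.Theory.
Import numFieldNormedType.Exports.

Local Open Scope classical_set_scope.
Local Open Scope ring_scope.

(** * Square-integrable functions *)

(** Two obstacles shape the proof. Nothing is known about the regularity of [Omega] or of the limits
    u_i, so no traces are taken: u_i is approximated by test functions of [Omega], which already
    vanish near its boundary, and only the boundary of the 1-neighbourhood of C_i has to be cut. The
    gradient of a cutoff on a strip of width d is of order 1/d; the Hardy inequality supplies a
    factor d^2 against its square, and what remains is the gradient of the approximants on the
    strip. This is small uniformly along the sequence once gradients converge strongly, while a
    minimizing sequence only bounds them; hence the detour through almost minimizers near u_i.
    Parameters are fixed in the order: reference index, strip width, final index.

    The family is enlarged because sets v_i built from the A_i would avoid A_j but could come close
    to v_j. Maximality puts v_i inside B_i, which v_j avoids by construction.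

    For F, monotonicity and continuity along coordinate lines suffice: a point slightly below the
    limit eigenvalues costs almost as much and ends up below the eigenvalues of the minimizing
    sequence. *)

Section square_integrable.
Context d (T : measurableType d) (R : realType) (mu : {measure set T -> \bar R}).
Variables (D : set T) (mD : measurable D).
Implicit Types (f g h : T -> R).

(** Has the shape of [L2] over an arbitrary measure, so that [L2 omega u] is convertible to
    [sqint (lebesgue_rV n) omega u]. *)
Definition sqint f := measurable_fun D f /\
  (\int[mu]_(x in D) ((f x) ^+ 2)%:E < +oo)%E.

(** A real-valued integral, hence 0 by convention when the extended integral is infinite; it behaves
    as an inner product only under [sqint]. *)
Definition ip f g := \int[mu]_(x in D) (f x * g x).

Local Notation sqn f := (ip f f).

Lemma sqint_integrable_sqr f : sqint f ->
  mu.-integrable D (EFin \o (fun x => f x ^+ 2)).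
Proof.
move=> [mf foo]; apply/integrableP; split.
  by apply/measurable_EFinP; apply: measurable_funX.
rewrite (eq_integral (fun x => ((f x) ^+ 2)%:E))// => x _ /=.
by rewrite ger0_norm// sqr_ge0.
Qed.

Lemma sqint_prod_integrable f g : sqint f -> sqint g ->
  mu.-integrable D (EFin \o (fun x => f x * g x)).
Proof.
move=> sf sg; have := integrableD mD (sqint_integrable_sqr sf) (sqint_integrable_sqr sg).
apply: le_integrable => //.
  by apply/measurable_EFinP; apply: measurable_funM; [case: sf|case: sg].
move=> x _ /=; rewrite lee_fin [leRHS]ger0_norm ?addr_ge0 ?sqr_ge0//.
by rewrite ler_norml; have := sqr_ge0 (f x + g x); have := sqr_ge0 (f x - g x);
  have := sqr_ge0 (f x); have := sqr_ge0 (g x); nra.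
Qed.

Lemma sqint0 : sqint 0.
Proof.
split; first exact: measurable_cst.
by rewrite (eq_integral (cst 0%E)) ?integral0// => x _; rewrite expr0n.
Qed.

Lemma sqintZ k f : sqint f -> sqint (k *: f).
Proof.
move=> sf; have [mf foo] := sf; split; first exact: measurable_funM.
rewrite (eq_integral (fun x => ((k ^+ 2)%:E * (f x ^+ 2)%:E)%E)); last first.
  by move=> x _; rewrite fctE -EFinM exprMn.
rewrite integralZl//; last exact: sqint_integrable_sqr.
have /integral_fune_lt_pinfty := integrableZl mD (k ^+ 2) (sqint_integrable_sqr sf).
move=> /(_ mD); rewrite integralZl//.
exact: sqint_integrable_sqr.
Qed.

Lemma sqintD f g : sqint f -> sqint g -> sqint (f + g).
Proof.
move=> sf sg; split; first by apply: measurable_funD; [case: sf|case: sg].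
have := sqint_prod_integrable sf sg => /(integrableZl mD 2).
move=> /(integrableD mD (integrableD mD (sqint_integrable_sqr sf) (sqint_integrable_sqr sg))).
move=> /(integral_fune_lt_pinfty mD); congr (_ < _)%E.
by apply: eq_integral => x _ /=; rewrite -?EFinM -!EFinD; congr EFin; rewrite fctE; ring.
Qed.

Lemma sqintN f : sqint f -> sqint (- f).
Proof. by rewrite -scaleN1r; exact: sqintZ. Qed.

Lemma sqintB f g : sqint f -> sqint g -> sqint (f - g).
Proof. by move=> sf sg; apply: sqintD => //; exact: sqintN. Qed.

Lemma ipC f g : ip f g = ip g f.
Proof. by apply: eq_Rintegral => x _; rewrite mulrC. Qed.

Lemma ipDl f g h : sqint f -> sqint g -> sqint h -> ip (f + g) h = ip f h + ip g h.
Proof.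
move=> sf sg sh; rewrite -RintegralD//; try exact: sqint_prod_integrable.
by apply: eq_Rintegral => x _; rewrite -mulrDl.
Qed.

Lemma ipZl k f g : sqint f -> sqint g -> ip (k *: f) g = k * ip f g.
Proof.
move=> sf sg; rewrite -RintegralZl//; last exact: sqint_prod_integrable.
by apply: eq_Rintegral => x _; rewrite mulrA.
Qed.

Lemma ipNl f g : sqint f -> sqint g -> ip (- f) g = - ip f g.
Proof. by move=> sf sg; rewrite -scaleN1r ipZl// mulN1r. Qed.

Lemma ipBl f g h : sqint f -> sqint g -> sqint h -> ip (f - g) h = ip f h - ip g h.
Proof. by move=> sf sg sh; rewrite ipDl ?ipNl//; exact: sqintN. Qed.

Lemma ipDr f g h : sqint f -> sqint g -> sqint h -> ip h (f + g) = ip h f + ip h g.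
Proof. by move=> sf sg sh; rewrite ipC ipDl// !(ipC h). Qed.

Lemma ipZr k f g : sqint f -> sqint g -> ip f (k *: g) = k * ip f g.
Proof. by move=> sf sg; rewrite ipC ipZl// ipC. Qed.

Lemma ipBr f g h : sqint f -> sqint g -> sqint h -> ip h (f - g) = ip h f - ip h g.
Proof. by move=> sf sg sh; rewrite ipC ipBl// !(ipC h). Qed.

Lemma sqn_ge0 f : 0 <= sqn f.
Proof. by apply: Rintegral_ge0 => x _; rewrite -expr2 sqr_ge0. Qed.

Lemma sqnE f : sqint f -> (\int[mu]_(x in D) ((f x) ^+ 2)%:E = (sqn f)%:E)%E.
Proof.
move=> sf; rewrite /ip /Rintegral fineK; first by apply: eq_integral.
exact: integrable_fin_num (sqint_prod_integrable sf sf).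
Qed.

Lemma sqnD f g : sqint f -> sqint g -> sqn (f + g) = sqn f + 2 * ip f g + sqn g.
Proof.
move=> sf sg; have sfg := sqintD sf sg.
rewrite ipDl// !ipDr// (ipC g f); ring.
Qed.

Lemma sqnZ k f : sqint f -> sqn (k *: f) = k ^+ 2 * sqn f.
Proof. by move=> sf; rewrite ipZl ?ipZr ?mulrA//; exact: sqintZ. Qed.

Lemma sqnN f : sqint f -> sqn (- f) = sqn f.
Proof. by move=> sf; rewrite -scaleN1r sqnZ// sqrrN expr1n mul1r. Qed.

Lemma sqnB f g : sqint f -> sqint g -> sqn (f - g) = sqn f - 2 * ip f g + sqn g.
Proof.
move=> sf sg; rewrite sqnD ?sqnN//; last exact: sqintN.
by rewrite ipC ipNl// ipC mulrN.
Qed.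

Lemma sqn_subC f g : sqn (f - g) = sqn (g - f).
Proof. by apply: eq_Rintegral => x _; rewrite !fctE; ring. Qed.

(** The quadratic polynomial t |-> [sqn (f + t *: g)] is nonnegative, so its discriminant is not
    positive. *)
Lemma cauchy_schwarz f g : sqint f -> sqint g -> ip f g ^+ 2 <= sqn f * sqn g.
Proof.
move=> sf sg.
have H t : 0 <= sqn f + 2 * t * ip f g + t ^+ 2 * sqn g.
  have := sqn_ge0 (f + t *: g); rewrite sqnD//; last exact: sqintZ.
  by rewrite ipZr// sqnZ// mulrA.
have := sqn_ge0 f; have := sqn_ge0 g.
set a := sqn f in H *; set b := ip f g in H *; set c := sqn g in H *.
rewrite le_eqVlt => /predU1P[c0|c0] a0.
  (* In the degenerate case [c = 0] the polynomial is affine; at this t it would equal -1 unless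
     [b = 0]. *)
  rewrite -c0 mulr0; have := H (- (a + 1) / (2 * b)).
  have [->|b0] := eqVneq b 0; first by rewrite expr0n.
  rewrite -c0 mulr0 addr0 (_ : 2 * _ * b = - (a + 1)); first by move=> ?; exfalso; lra.
  by field.
have := H (- b / c).
rewrite (_ : _ + _ = (a * c - b ^+ 2) / c); last by field; rewrite gt_eqF.
by rewrite pmulr_lge0 ?invr_gt0// subr_ge0.
Qed.

(** Young's inequality, from 0 <= [sqn (s *: f - g)] divided by s. The free weight s keeps the
    constant in front of the main term close to 1 when a cutoff error g is added. *)
Lemma sqnD_le (s : R) f g : 0 < s -> sqint f -> sqint g ->
  sqn (f + g) <= (1 + s) * sqn f + (1 + s^-1) * sqn g.
Proof.
move=> s0 sf sg; rewrite sqnD//.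
have := sqn_ge0 (s *: f - g); rewrite sqnB//; last exact: sqintZ.
rewrite sqnZ// ipZl// => h.
have : 0 <= s^-1 * (s ^+ 2 * sqn f - 2 * (s * ip f g) + sqn g).
  by rewrite mulr_ge0// invr_ge0 ltW.
have -> : s^-1 * (s ^+ 2 * sqn f - 2 * (s * ip f g) + sqn g) =
  s * sqn f - 2 * ip f g + s^-1 * sqn g by field; rewrite gt_eqF.
by rewrite !mulrDl !mul1r; lra.
Qed.

Lemma sqnD_le2 f g : sqint f -> sqint g -> sqn (f + g) <= 2 * sqn f + 2 * sqn g.
Proof. by move=> sf sg; have := sqnD_le ltr01 sf sg; rewrite invr1. Qed.

Lemma sqnB_le2 f g : sqint f -> sqint g -> sqn (f - g) <= 2 * sqn f + 2 * sqn g.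
Proof. by move=> sf sg; rewrite -(sqnN sg); apply: sqnD_le2 => //; exact: sqintN. Qed.

Lemma sqint_le f g : measurable_fun D f -> sqint g ->
  (forall x, D x -> `|f x| <= `|g x|) -> sqint f.
Proof.
move=> mf [mg goo] fg; split=> //; apply: le_lt_trans goo.
apply: ge0_le_integral => //.
- by move=> x _; rewrite lee_fin sqr_ge0.
- by apply/measurable_EFinP; exact: measurable_funX.
- by apply/measurable_EFinP; exact: measurable_funX.
- by move=> x Dx; rewrite lee_fin -[leLHS]real_normK ?num_real//
    -[leRHS]real_normK ?num_real// lerXn2r ?nnegrE//; exact: fg.
Qed.

Lemma sqn_le f g : measurable_fun D f -> sqint g ->
  (forall x, D x -> `|f x| <= `|g x|) -> sqn f <= sqn g.
Proof.
move=> mf sg fg; have sf := sqint_le mf sg fg.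
apply: le_Rintegral => //; try exact: sqint_prod_integrable.
by move=> x Dx; rewrite -!expr2 -[leLHS]real_normK ?num_real//
    -[leRHS]real_normK ?num_real// lerXn2r ?nnegrE//; exact: fg.
Qed.

Lemma cvg_ip (f_ g_ : nat -> T -> R) f g :
  (forall n, sqint (f_ n)) -> (forall n, sqint (g_ n)) -> sqint f -> sqint g ->
  sqn (f_ n - f) @[n --> \oo] --> 0 -> sqn (g_ n - g) @[n --> \oo] --> 0 ->
  ip (f_ n) (g_ n) @[n --> \oo] --> ip f g.
Proof.
move=> sf_ sg_ sf sg cf cg.
(* The error splits into increments in both slots, in the first and in the second; Cauchy-Schwarz
   bounds each of the three. *)
have E n : `|ip f g - ip (f_ n) (g_ n)| <=
    Num.sqrt (sqn (f_ n - f) * sqn (g_ n - g)) + Num.sqrt (sqn (f_ n - f) * sqn g)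
    + Num.sqrt (sqn f * sqn (g_ n - g)).
  rewrite (_ : ip f g - _ = - (ip (f_ n - f) (g_ n - g) + ip (f_ n - f) g + ip f (g_ n - g))); last first.
    have sfn := sqintB (sf_ n) sf.
    rewrite [ip (_ - _) (_ - _)]ipBr// !ipBr// !ipBl//; ring.
  rewrite normrN.
  apply: (le_trans (ler_normD _ _)); apply: lerD; last first.
    by rewrite -sqrtr_sqr ler_wsqrtr// cauchy_schwarz//; exact: sqintB.
  apply: (le_trans (ler_normD _ _)); apply: lerD; rewrite -sqrtr_sqr ler_wsqrtr// cauchy_schwarz//; exact: sqintB.
pose r n := Num.sqrt (sqn (f_ n - f) * sqn (g_ n - g)) +
  Num.sqrt (sqn (f_ n - f) * sqn g) + Num.sqrt (sqn f * sqn (g_ n - g)).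
have cr : r n @[n --> \oo] --> 0.
  have -> : 0 = Num.sqrt (0 * 0) + Num.sqrt (0 * sqn g) + Num.sqrt (sqn f * 0).
    by rewrite !mul0r mulr0 sqrtr0 !addr0.
  apply: cvgD; first apply: cvgD.
  - by apply: continuous_cvg; [exact: sqrt_continuous|exact: cvgM].
  - by apply: continuous_cvg; [exact: sqrt_continuous|apply: cvgM => //; exact: cvg_cst].
  - by apply: continuous_cvg; [exact: sqrt_continuous|apply: cvgM => //; exact: cvg_cst].
apply/cvgrPdist_le => e e0; near=> n; apply: le_trans (E n) _.
rewrite -[leLHS]ger0_norm ?addr_ge0 ?sqrtr_ge0// -normrN -sub0r.
by near: n; move/cvgrPdist_le : cr; exact.
Unshelve. all: by end_near. Qed.

End square_integrable.

Lemma cvgn_geometric_increments (R : realType) (g : nat -> R) (C : R) :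
  (forall k, `|g k.+1 - g k| <= C * 2^-1 ^+ k) -> cvgn g.
Proof.
move=> H; pose u := telescope g.
have C0 : 0 <= C by have := H 0%N; rewrite expr0 mulr1; exact: le_trans.
have cu : cvgn (series u).
  apply: normed_cvg; apply: (@series_le_cvg R _ (geometric C 2^-1)) => //.
  - by move=> n; exact: normr_ge0.
  - by move=> n; rewrite /= mulr_ge0// exprn_ge0.
  - by apply: is_cvg_geometric_series; rewrite ger0_norm ?invf_lt1 ?ltr1n.
rewrite (_ : g = (fun n => g 0%N + series u n)); last first.
  by apply/funext => n; rewrite -eq_sum_telescope.
by apply: is_cvgD => //; exact: is_cvg_cst.
Qed.

Lemma subsequence_of_bounds (P : nat -> nat -> Prop) :
  (forall k, exists N, forall n, (N <= n)%N -> P k n) ->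
  exists s : nat -> nat, {homo s : m n / (m <= n)%N} /\
    forall k, P k (s k) /\ (k <= s k)%N.
Proof.
move=> /choice[N HN].
(* Adding up the thresholds makes [s] monotone while keeping [s k] above both [N k] and k. *)
pose s k := (\sum_(i < k.+1) (N i + i))%N.
exists s; split.
  move=> m n mn; rewrite /s (big_ord_widen n.+1 (fun i => N i + i)%N)// big_mkcond/=.
  by apply: leq_sum => i _; case: ifP.
move=> k; split; last by rewrite /s big_ord_recr/= addnA leq_addl.
by apply: HN; rewrite /s big_ord_recr/= addnCA leq_addr.
Qed.

(** * Completeness of L^2 *)

Section completeness.
Context d (T : measurableType d) (R : realType) (mu : {measure set T -> \bar R}).
Variables (D : set T) (mD : measurable D).

Local Notation sqn f := (ip mu D f f).
Local Notation sqint := (sqint mu D).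

(** Weighted by 4^k, the squared increments have integrals at most 2^-k, so their sum S is
    integrable and almost everywhere finite. Where it is finite, the k-th increment is at most sqrt
    S times 2^-k, which is summable. *)
Lemma ae_cvg_geometric (g : nat -> T -> R) :
  (forall k, sqint (g k)) -> (forall k, sqn (g k.+1 - g k) <= 8^-1 ^+ k) ->
  {ae mu, forall x, D x -> cvgn (g ^~ x)}.
Proof.
move=> sg hg.
pose h k x := ((4 ^+ k) * ((g k.+1 - g k) x) ^+ 2)%:E.
have sd k : sqint (g k.+1 - g k) by exact: sqintB.
have mh k : measurable_fun D (h k).
  apply/measurable_EFinP; apply: measurable_funM => //; apply: measurable_funX.
  by case: (sd k).
have h0 k x : D x -> (0 <= h k x)%E by move=> _; rewrite lee_fin mulr_ge0 ?sqr_ge0 ?exprn_ge0.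
have Ih k : (\int[mu]_(x in D) h k x <= (2^-1 ^+ k)%:E)%E.
  rewrite (eq_integral (fun x => (4 ^+ k)%:E * (((g k.+1 - g k) x) ^+ 2)%:E)%E)//.
  rewrite integralZl//; last by exact: sqint_integrable_sqr.
  rewrite sqnE// -EFinM lee_fin.
  apply: (@le_trans _ _ (4 ^+ k * 8^-1 ^+ k)); first by rewrite ler_wpM2l ?exprn_ge0.
  by rewrite -exprMn (_ : 4 * 8^-1 = 2^-1 :> R)//; field.
have iS : mu.-integrable D (fun x => \sum_(k <oo) h k x)%E.
  apply/integrableP; split.
    by apply: ge0_emeasurable_sum => // k x Dx _; exact: h0.
  rewrite (eq_integral (fun x => \sum_(k <oo) h k x)%E); last first.
    move=> x xD; rewrite gee0_abs//; apply: nneseries_ge0 => k _ _; apply: h0.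
    by rewrite inE in xD.
  rewrite integral_nneseries//.
  apply: (@le_lt_trans _ _ (\sum_(k <oo) (2^-1 ^+ k)%:E)%E).
    by apply: lee_nneseries => // k _ _; apply: integral_ge0 => x; exact: h0.
  rewrite (_ : (fun n => _) = EFin \o (series (geometric 1 2^-1))); last first.
    by apply/funext => n /=; rewrite /series/= -sumEFin; apply: eq_bigr => i _; rewrite mul1r.
  rewrite EFin_lim ?ltry//.
  by apply: is_cvg_geometric_series; rewrite ger0_norm ?invf_lt1 ?ltr1n.
have := integrable_ae mD iS; apply: filterS => x fS Dx.
have {}fS := fS Dx.
apply: (@cvgn_geometric_increments _ _ (Num.sqrt (fine (\sum_(k <oo) h k x)%E))) => k.
have S0 : 0 <= fine (\sum_(k <oo) h k x)%E.
  by apply: fine_ge0; apply: nneseries_ge0 => i _ _; exact: h0.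
rewrite -(@ler_pXn2r _ 2)// ?nnegrE ?mulr_ge0 ?sqrtr_ge0 ?exprn_ge0 ?invr_ge0//.
rewrite exprMn sqr_sqrtr// real_normK ?num_real//.
have : (h k x <= \sum_(k <oo) h k x)%E.
  apply: (@le_trans _ _ (\sum_(0 <= i < k.+1) h i x)%E); last first.
    by apply: nneseries_lim_ge => i _ _; exact: h0.
  rewrite big_nat_recr//= leeDr//; apply: sume_ge0 => i _; exact: h0.
rewrite -(fineK fS) lee_fin => hk.
rewrite -exprM mulnC exprM exprVn -ler_pdivrMr ?exprn_gt0 ?invr_gt0//.
by rewrite exprVn invrK mulrC -natrX.
Qed.

Lemma sqint_complete (f_ : nat -> T -> R) : (forall n, sqint (f_ n)) ->
  (forall e, 0 < e -> exists N, forall m n, (N <= m)%N -> (N <= n)%N ->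
    sqn (f_ m - f_ n) <= e) ->
  exists f, sqint f /\ sqn (f_ n - f) @[n --> \oo] --> 0.
Proof.
move=> sf cf.
have [s [sm sP]] : exists s : nat -> nat, {homo s : m n / (m <= n)%N} /\
    forall k, (forall n, (s k <= n)%N -> sqn (f_ n - f_ (s k)) <= 8^-1 ^+ k) /\ (k <= s k)%N.
  apply: (@subsequence_of_bounds (fun k m => forall n, (m <= n)%N -> sqn (f_ n - f_ m) <= 8^-1 ^+ k)).
  move=> k; have [|N HN] := cf (8^-1 ^+ k); first by rewrite exprn_gt0 ?invr_gt0.
  by exists N => m Nm n mn; apply: HN => //; exact: leq_trans mn.
pose g k := f_ (s k).
have sg k : sqint (g k) by exact: sf.
have aeg : {ae mu, forall x, D x -> cvgn (g ^~ x)}.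
  apply: ae_cvg_geometric => // k; apply: (sP k).1; exact: sm.
(* The upper limit is defined and measurable everywhere, and agrees with the limit where the
   subsequence converges. *)
pose f x := fine (limn_esup (fun k => (g k x)%:E)).
have mf : measurable_fun D f.
  apply: measurableT_comp => //; apply: measurable_fun_limn_esup => k.
  by apply/measurable_EFinP; case: (sg k).
have aef : {ae mu, forall x, D x -> g k x @[k --> \oo] --> f x}.
  move: aeg; apply: filterS => x + Dx => /(_ Dx) cx.
  suff -> : f x = limn (g ^~ x) by [].
  rewrite /f (_ : limn_esup _ = (limn (g ^~ x))%:E)//.
  have : (EFin \o (g ^~ x)) @ \oo --> (limn (g ^~ x))%:E by apply: cvg_EFin; [exact: nearW|exact: cx].
  by move=> /cvg_limn_einf_sup[_ <-].
(* Fatou's lemma transfers the Cauchy bound from the members of the subsequence to their pointwise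
   limit. *)
have key e n : 0 < e -> (forall m, (n <= m)%N -> sqn (f_ n - f_ m) <= e) ->
    (\int[mu]_(x in D) (((f_ n - f) x) ^+ 2)%:E <= e%:E)%E.
  move=> e0 He.
  have mfk k : measurable_fun D (fun x => (((f_ n - g k) x) ^+ 2)%:E).
    apply/measurable_EFinP; apply: measurable_funX.
    by have [] : sqint (f_ n - g k) by exact: sqintB.
  rewrite (ge0_ae_eq_integral (g := fun x => limn_einf (fun k => (((f_ n - g k) x) ^+ 2)%:E)))//.
  - apply: (le_trans (fatou mu mD mfk _)) => /=.
      by move=> k x _; rewrite lee_fin sqr_ge0.
    rewrite limn_einf_lim; apply: lime_le; first exact: is_cvg_einfs.
    apply: nearW => k.
    have [i ki ni] : exists2 i, (k <= i)%N & (n <= s i)%N.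
      exists (maxn k n); first exact: leq_maxl.
      by apply: leq_trans (sP _).2; exact: leq_maxr.
    apply: (@le_trans _ _ (\int[mu]_(x in D) (((f_ n - g i) x) ^+ 2)%:E)%E).
      by apply: ereal_inf_lbound; exists i.
    by rewrite sqnE ?lee_fin//; [exact: He|exact: sqintB].
  - by apply/measurable_EFinP; apply: measurable_funX; apply: measurable_funB => //; case: (sf n).
  - apply: (measurableT_comp (@oppe_measurable R setT)).
    by apply: measurable_fun_limn_esup => k; exact: (measurableT_comp (@oppe_measurable R setT)).
  - by move=> x _; rewrite lee_fin sqr_ge0.
  - move=> x _; rewrite limn_einf_lim; apply: lime_ge; first exact: is_cvg_einfs.
    apply: nearW => k; apply: le_ereal_inf_tmp => _ [i _ <-].
    by rewrite lee_fin sqr_ge0.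
  - move: aef; apply: filterS => x + Dx => /(_ Dx) cx.
    have : (fun k => (((f_ n - g k) x) ^+ 2)%:E) @ \oo --> (((f_ n - f) x) ^+ 2)%:E.
      apply: cvg_EFin; first exact: nearW.
      have cB : (fun k => f_ n x - g k x) @ \oo --> f_ n x - f x.
        by apply: cvgB => //; exact: cvg_cst.
      by rewrite expr2; under eq_fun do rewrite /= expr2; exact: cvgM.
    by move=> /cvg_limn_einf_sup[-> _].
have sfB n e : 0 < e -> (forall m, (n <= m)%N -> sqn (f_ n - f_ m) <= e) -> sqint (f_ n - f).
  move=> e0 He; split; first by apply: measurable_funB => //; case: (sf n).
  by apply: le_lt_trans (key _ _ e0 He) _; rewrite ltry.
have sqf : sqint f.
  have [N HN] := cf 1 ltr01.
  rewrite -[f](subKr (f_ N)); apply: sqintB => //; apply: (@sfB N 1) => // m Nm.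
  exact: HN.
exists f; split=> //.
apply/cvgrPdist_le => e e0; have [N HN] := cf e e0.
exists N => // n /= Nn; rewrite sub0r normrN ger0_norm ?sqn_ge0//.
rewrite -lee_fin -sqnE//; last exact: sqintB.
by apply: key => // m nm; apply: HN => //; exact: leq_trans nm.
Qed.

End completeness.

(** * Lebesgue measure on row vectors *)

Section lebesgue_rV_theory.
Context {R : realType}.

Lemma ball_rVP n (x y : 'rV[R]_n) (e : R) : 0 < e ->
  ball x e y <-> forall i, `|x ord0 i - y ord0 i| < e.
Proof.
move=> e0; split=> [|H].
  by move=> [_ H] i; exact: H.
by split=> // i j; rewrite (ord1 i); exact: H.
Qed.

Definition box n (A : 'I_n -> set R) : set 'rV[R]_n :=
  [set x | forall i, A i (x ord0 i)].

Definition cube n (a b : R) : set 'rV[R]_n := box (fun=> `[a, b]%classic).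
Arguments cube : clear implicits.

Lemma measurable_box n (A : 'I_n -> set R) :
  (forall i, measurable (A i)) -> measurable (box A).
Proof.
move=> mA; rewrite (_ : box A = \bigcap_(i in [set: 'I_n])
    ((fun x : 'rV[R]_n => x ord0 i) @^-1` A i)).
  apply: fin_bigcap_measurable => // i _.
  by rewrite -[X in measurable X]setTI; exact: measurable_coord.
by apply/seteqP; split=> y /= Ay i; [move=> _|]; exact: Ay.
Qed.

(** A base of the topology indexed by a countable type. It makes open sets measurable and later
    turns local vanishing into vanishing up to a negligible set. *)
Definition rational_box n (p : 'rV[rat]_n * nat) : set 'rV[R]_n :=
  box (fun i => ball (ratr (p.1 ord0 i) : R) p.2.+1%:R^-1).

Lemma rational_box_basis n (E : set 'rV[R]_n) x : open E -> E x ->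
  exists2 p, rational_box p x & rational_box p `<=` E.
Proof.
move=> oE Ex; have /nbhs_ballP[e /= e0 xe] : nbhs x E by exact: open_nbhs_nbhs.
have [k ke] : exists k : nat, k.+1%:R^-1 < e / 2.
  have e20 : 0 < e / 2 by rewrite divr_gt0.
  have [k _ /(_ k (leqnn _)) ?] := near_infty_natSinv_lt (PosNum e20).
  by exists k.
have k0 : 0 < k.+1%:R^-1 :> R by rewrite invr_gt0.
have /choice[q qP] : forall i : 'I_n, exists q : rat, ball (ratr q : R) k.+1%:R^-1 (x ord0 i).
  move=> i; have [q] := @rat_in_itvoo R (x ord0 i - k.+1%:R^-1) (x ord0 i) ltac:(by rewrite ltrBlDr ltrDl).
  rewrite in_itv/= => /andP[q1 q2]; exists q.
  by rewrite /ball/= ltr0_norm ?subr_lt0// opprB ltrBlDr addrC -ltrBlDr.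
exists (\row_i q i, k) => [i|y yB] /=; first by rewrite mxE; exact: qP.
apply: xe; apply/ball_rVP => // i.
have := yB i; rewrite /= mxE => yi; have := qP i => xi.
have := ball_triangle (ball_sym xi) yi; rewrite /ball/= => /lt_le_trans; apply.
by rewrite [leRHS]splitr lerD// ltW.
Qed.

Lemma measurable_rational_box n (q : 'rV[rat]_n * nat) : measurable (rational_box q).
Proof. by apply: measurable_box => i; exact: measurable_ball. Qed.

Lemma open_measurable_rV n (U : set 'rV[R]_n) : open U -> measurable U.
Proof.
move=> oU.
pose C p := if `[< rational_box p `<=` U >] then rational_box p else set0.
have -> : U = \bigcup_p C p.
  apply/seteqP; split=> [x Ux|x [p _]]; last first.
    by rewrite /C; case: asboolP => // BU; exact: BU.
  have [p px pU] := rational_box_basis oU Ux.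
  by exists p => //; rewrite /C; case: asboolP.
apply: countable_bigcupT_measurable; first exact: countableP.
move=> p; rewrite /C; case: asboolP => _; last exact: measurable0.
exact: measurable_rational_box.
Qed.

Lemma continuous_measurable_rV n (f : 'rV[R]_n -> R) :
  continuous f -> measurable_fun [set: 'rV[R]_n] f.
Proof.
move=> cf; apply: (measurability _ (RGenOInfty.measurableE R)) => _ [_ [a ->] <-].
rewrite setTI; apply: open_measurable_rV; apply: open_comp => // x _; exact: cf.
Qed.

Lemma rV_measurableE n :
  @measurable _ 'rV[R]_n =
  <<s [set box A | A in [set A : 'I_n -> set R | forall i, measurable (A i)]] >>.
Proof.
apply/seteqP; split.
  apply: smallest_sub; first exact: smallest_sigma_algebra.
  move=> Z; rewrite -bigcup_seq => -[i _ [A mA <-]]; apply: sub_sigma_algebra.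
  exists (fun j => if j == i then A else setT).
    by move=> j; case: ifP => // _; exact: measurableT.
  rewrite setTI; apply/seteqP; split=> x /=.
    by move=> /(_ i); rewrite eqxx.
  by move=> Ax j; case: eqP => // ->.
apply: smallest_sub; first exact: sigma_algebra_measurable.
by move=> _ [A mA <-]; exact: measurable_box.
Qed.

(** Boxes are stable under intersection and generate the sigma-algebra, and the integer cubes
    exhaust the space with finite measure. *)
Lemma rV_measure_unique n (m1 m2 : {measure set 'rV[R]_n -> \bar R}) :
  (forall A : 'I_n -> set R, (forall i, measurable (A i)) -> m1 (box A) = m2 (box A)) ->
  (forall k : nat, m1 (cube n (- k%:R)%R k%:R%R) < +oo)%E ->
  forall A, measurable A -> m1 A = m2 A.
Proof.
move=> m12 foo; apply: (measure_unique _ (fun k : nat => cube n (- k%:R) k%:R) (@rV_measurableE n)) => //.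
- move=> _ _ [A mA <-] [B mB <-]; exists (fun i => A i `&` B i).
    by move=> i; exact: measurableI.
  by apply/seteqP; split=> x /= H; [split=> i; case: (H i)|move=> i; split; [exact: H.1|exact: H.2]].
- by move=> i; exists (fun=> `[- i%:R, i%:R]%classic) => // j; exact: measurable_itv.
- apply/seteqP; split=> // x _.
  pose M := \big[Num.max/0]_i `|x ord0 i|.
  exists (Num.bound M) => // i /=.
  have := archi_boundP (bigmax_ge_id _ _ _ _ : 0 <= M) => Mb.
  rewrite in_itv/= -ler_norml; apply: le_trans (ltW Mb).
  exact: le_bigmax.
- by move=> _ [A mA <-]; exact: m12.
Qed.

Lemma lebesgue_box n (A : 'I_n -> set R) : (forall i, measurable (A i)) ->
  (lebesgue_rV n (box A) = \prod_(i < n) lebesgue_measure (A i))%E.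
Proof. exact: lebesgue_rV_box. Qed.

Lemma lebesgue_box_itv n (a b : R) : a <= b ->
  (lebesgue_rV n (cube n a b) = ((b - a) ^+ n)%:E)%E.
Proof.
move=> ab; rewrite lebesgue_box; last by move=> i; exact: measurable_itv.
rewrite (eq_bigr (fun=> (b - a)%:E)).
  by rewrite prodEFin prodr_const card_ord.
move=> i _; rewrite lebesgue_measure_itv/= lte_fin; case: ltP => // ba.
by have -> : b = a; [apply/le_anti; rewrite ba ab|rewrite subrr].
Qed.


Lemma lebesgue_measure_shift (a : R) (A : set R) : measurable A ->
  lebesgue_measure ((fun x => x + a) @^-1` A) = lebesgue_measure A.
Proof.
have ma : @measurable_fun _ _ (measurableTypeR R) (measurableTypeR R) setT (fun x => x + a).
  exact: (@measurable_funD _ _ R _ id (cst a)).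
pose f := HB.pack_for {mfun measurableTypeR R >-> measurableTypeR R} (fun x : R => x + a)
  (isMeasurableFun.Build _ _ _ _ _ ma).
move=> mA; apply/esym.
apply: (lebesgue_measure_unique (mu := pushforward lebesgue_measure f)) => //.
move=> _ [[b c] _ <-].
have E : (fun x => x + a) @^-1` `]b, c]%classic = `]b - a, c - a]%classic.
  by apply/seteqP; split=> x /=; rewrite !in_itv/= ltrBlDr lerBrDr.
transitivity (lebesgue_measure ((fun x : R => x + a) @^-1` `]b, c]%classic)); last by [].
rewrite E !lebesgue_measure_itv/= !lte_fin ltrD2r; case: ifP => // _.
by rewrite -!EFinB; congr EFin; ring.
Qed.

Definition translate n (a x : 'rV[R]_n) : 'rV[R]_n := x + a.

Lemma measurable_translate n (a : 'rV[R]_n) :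
  measurable_fun [set: 'rV[R]_n] (translate a).
Proof.
apply: measurable_fun_rV => i; under eq_fun do rewrite mxE.
by apply: measurable_funD => //; exact: measurable_coord.
Qed.

HB.instance Definition _ n (a : 'rV[R]_n) :=
  isMeasurableFun.Build _ _ _ _ (translate a) (measurable_translate a).

(** By uniqueness it suffices to look at boxes, where the product formula reduces the claim to the
    real line. *)
Lemma lebesgue_rV_translate n (a : 'rV[R]_n) (A : set 'rV[R]_n) : measurable A ->
  lebesgue_rV n (translate a @^-1` A) = lebesgue_rV n A.
Proof.
move=> mA; apply/esym.
apply: (rV_measure_unique (m2 := pushforward (lebesgue_rV n) (translate a))) => //.
  move=> B mB.
  have E : translate a @^-1` box B = box (fun i => (fun x => x + a ord0 i) @^-1` (B i)).
    by apply/seteqP; split=> x /= Bx i; have := Bx i; rewrite mxE.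
  rewrite -[LHS]/(lebesgue_rV n (box B)).
  rewrite -[RHS]/(lebesgue_rV n (translate a @^-1` box B)).
  rewrite E lebesgue_box// lebesgue_box.
    by apply: eq_bigr => i _; rewrite lebesgue_measure_shift.
  by move=> i; rewrite -[X in measurable X]setTI; apply: measurable_funD.
move=> k; rewrite -[ltLHS]/(lebesgue_rV n (cube n (- k%:R) k%:R)).
rewrite lebesgue_box_itv ?ltry//.
by rewrite (@le_trans _ _ 0)// oppr_le0.
Qed.

Lemma ge0_integral_translate n (a : 'rV[R]_n) (f : 'rV[R]_n -> \bar R) :
  measurable_fun setT f -> (forall x, 0 <= f x)%E ->
  (\int[lebesgue_rV n]_x f (x + a)%R = \int[lebesgue_rV n]_x f x)%E.
Proof.
move=> mf f0.
have := ge0_integral_pushforward (measurable_translate a) (lebesgue_rV n) measurableT mf (fun x _ => f0 x).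
rewrite preimage_setT => <-.
by apply: eq_measure_integral => A mA _; exact: lebesgue_rV_translate.
Qed.

Lemma Rintegral_translate n (a : 'rV[R]_n) (f : 'rV[R]_n -> R) :
  measurable_fun setT f ->
  \int[lebesgue_rV n]_x f (x + a) = \int[lebesgue_rV n]_x f x.
Proof.
move=> mf; rewrite /Rintegral; congr fine; rewrite integralE [RHS]integralE; congr (_ - _)%E.
  rewrite -[RHS](ge0_integral_translate a)//; last first.
    by apply: measurable_funepos; exact/measurable_EFinP.
  by apply: eq_integral => x _; rewrite unlock.
rewrite -[RHS](ge0_integral_translate a)//; last first.
  by apply: measurable_funeneg; exact/measurable_EFinP.
by apply: eq_integral => x _; rewrite unlock.
Qed.

Lemma coord_le_norm n (x : 'rV[R]_n) (i : 'I_n) : `|x ord0 i| <= `|x|.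
Proof. by rewrite [leRHS]mx_normrE; apply: (le_bigmax _ (fun i => `|x i.1 i.2|) (ord0, i)). Qed.

Lemma bounded_subset_cube n (A : set 'rV[R]_n) : bounded_set A ->
  exists2 M, 0 < M & A `<=` cube n (- M) M.
Proof.
move=> /pinfty_ex_gt0[M M0 HM]; exists M => // x Ax i /=.
rewrite in_itv/= -ler_norml; apply: le_trans (HM x Ax).
exact: coord_le_norm.
Qed.

Lemma measurable_cube n (a b : R) : measurable (cube n a b).
Proof. by apply: measurable_box => i; exact: measurable_itv. Qed.

End lebesgue_rV_theory.
Arguments cube {R} n a b.

(** * Smooth functions and cutoffs *)

Section smooth_functions.
Context {R : realType} (n : nat).
Implicit Types (f g : 'rV[R]_n -> R) (i : 'I_n).

Local Notation e_ i := (delta_mx ord0 i : 'rV[R]_n).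

Lemma smooth_continuous f : smooth f -> continuous f.
Proof. by move=> /(_ [::])[]. Qed.

Lemma smooth_derivable f i x : smooth f -> derivable f x (e_ i).
Proof. by move=> /(_ [::])[_]; exact. Qed.

Lemma smooth_partial f i : smooth f -> smooth (partial i f).
Proof. by move=> sf s; have := sf (rcons s i); rewrite foldr_rcons. Qed.

(** A coinduction principle: smoothness follows from membership in any class stable under partial
    derivatives, so no formula for iterated derivatives is ever written. *)
Lemma smooth_stable_class (P : set ('rV[R]_n -> R)) :
  (forall f, P f -> [/\ continuous f, forall i x, derivable f x (e_ i) &
    forall i, P (partial i f)]) ->
  forall f, P f -> smooth f.
Proof.
move=> H f Pf s.
have : P (foldr (@partial R n) f s) by elim: s => //= i s /H[].
by move=> /H[].
Qed.

Lemma partialD f g i : smooth f -> smooth g ->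
  partial i (f + g) = partial i f + partial i g.
Proof.
by move=> sf sg; apply/funext => x; rewrite /partial deriveD//; exact: smooth_derivable.
Qed.

Lemma partialZ k f i : smooth f -> partial i (k *: f) = k *: partial i f.
Proof.
by move=> sf; apply/funext => x; rewrite /partial deriveZ//; exact: smooth_derivable.
Qed.

Lemma partialM f g i : smooth f -> smooth g ->
  partial i (f * g) = f * partial i g + g * partial i f.
Proof.
by move=> sf sg; apply/funext => x; rewrite /partial deriveM//; exact: smooth_derivable.
Qed.

Lemma smoothD f g : smooth f -> smooth g -> smooth (f + g).
Proof.
move=> sf sg.
apply: (@smooth_stable_class [set h | exists a b, [/\ smooth a, smooth b & h = a + b]]); last by exists f, g.
move=> _ [a [b [sa sb ->]]]; split.
- by move=> x; apply: continuousD; [exact: (smooth_continuous sa)|exact: (smooth_continuous sb)].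
- by move=> i x; apply: derivableD; apply: smooth_derivable.
- move=> i; exists (partial i a), (partial i b); split; [exact: smooth_partial|exact: smooth_partial|].
  exact: partialD.
Qed.

Lemma smooth_cst (c : R) : smooth (cst c : 'rV[R]_n -> R).
Proof.
apply: (@smooth_stable_class [set h | exists c, h = cst c]); last by exists c.
move=> _ [a ->]; split; [exact: cst_continuous|by move=> *; exact: derivable_cst|].
by move=> i; exists 0; apply/funext => x; rewrite /partial derive_cst.
Qed.

Lemma smoothM f g : smooth f -> smooth g -> smooth (f * g).
Proof.
(* Products alone are not stable under differentiation, but by the Leibniz rule their finite sums
   are. *)
pose P := smallest [set Q : set ('rV[R]_n -> R) |
  (forall a b, smooth a -> smooth b -> Q (a * b)) /\ (forall a b, Q a -> Q b -> Q (a + b))] set0.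
have Pmul a b : smooth a -> smooth b -> P (a * b).
  by move=> sa sb Q [[Qm Qa] _]; exact: Qm.
have Padd a b : P a -> P b -> P (a + b).
  by move=> Pa Pb Q [[Qm Qa] sQ]; apply: (Qa); [exact: Pa|exact: Pb].
(* Minimality of [P] serves as an induction principle: [S] satisfies its two closure conditions,
   hence contains it. *)
pose S := [set h | P h /\ [/\ continuous h, forall i x, derivable h x (e_ i) & forall i, P (partial i h)]].
have PS : P `<=` S.
  move=> h; apply; split=> //; split.
    move=> a b sa sb; split; first exact: Pmul.
    split.
    - by move=> x; apply: continuousM; [exact: (smooth_continuous sa)|exact: (smooth_continuous sb)].
    - by move=> i x; apply: derivableM; apply: smooth_derivable.
    - move=> i; rewrite (@partialM a b i sa sb); apply: Padd; apply: Pmul.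
      + exact: sa.
      + exact: smooth_partial.
      + exact: sb.
      + exact: smooth_partial.
  move=> a b [Pa [ca da Da]] [Pb [cb db Db]]; split; first exact: Padd.
  split.
  - by move=> x; apply: continuousD; [exact: ca|exact: cb].
  - by move=> i x; apply: derivableD.
  - move=> i; rewrite (_ : partial i (a + b) = partial i a + partial i b); first exact: Padd.
    by apply/funext => x; rewrite /partial deriveD.
move=> sf sg; apply: (@smooth_stable_class P); last exact: Pmul.
by move=> h /PS[].
Qed.

Lemma smoothZ k f : smooth f -> smooth (k *: f).
Proof.
move=> sf; rewrite (_ : k *: f = cst k * f); last by apply/funext.
by apply: smoothM; [exact: smooth_cst|exact: sf].
Qed.

Lemma smoothN f : smooth f -> smooth (- f).
Proof. by rewrite -scaleN1r; exact: smoothZ. Qed.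

Lemma partialB f g i : smooth f -> smooth g ->
  partial i (f - g) = partial i f - partial i g.
Proof.
move=> sf sg; rewrite (@partialD f (- g) i sf (smoothN sg)) -scaleN1r.
by rewrite (@partialZ (-1) g i sg) scaleN1r.
Qed.

Lemma smooth_sum (I : Type) (r : seq I) (F : I -> 'rV[R]_n -> R) :
  (forall j, smooth (F j)) -> smooth (\sum_(j <- r) F j).
Proof.
move=> sF; elim: r => [|j r IH]; first by rewrite big_nil; exact: (smooth_cst 0).
by rewrite big_cons; apply: smoothD; [exact: sF|exact: IH].
Qed.

Lemma smooth_prod (I : Type) (r : seq I) (F : I -> 'rV[R]_n -> R) :
  (forall j, smooth (F j)) -> smooth (\prod_(j <- r) F j).
Proof.
move=> sF; elim: r => [|j r IH]; first by rewrite big_nil; exact: (smooth_cst 1).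
by rewrite big_cons; apply: smoothM; [exact: sF|exact: IH].
Qed.

Lemma partial_sum (I : Type) (r : seq I) (F : I -> 'rV[R]_n -> R) i :
  (forall j, smooth (F j)) ->
  partial i (\sum_(j <- r) F j) = \sum_(j <- r) partial i (F j).
Proof.
move=> sF; elim: r => [|j r IH].
  by rewrite !big_nil; apply/funext => x; rewrite /partial (derive_cst (0 : R)).
by rewrite !big_cons partialD ?IH//; exact: smooth_sum.
Qed.

Lemma line_derive f i x (t : R) : derivable f (x + t *: e_ i) (e_ i) ->
  is_derive t (1 : R) (fun s : R => f (x + s *: e_ i)) (partial i f (x + t *: e_ i)).
Proof.
rewrite /partial /derivable /derive => df.
have E : (fun h : R => h^-1 *: (((fun s : R => f (x + s *: e_ i)) \o shift t) (h *: (1 : R)) - f (x + t *: e_ i))) =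
  (fun h : R => h^-1 *: ((f \o shift (x + t *: e_ i)) (h *: e_ i) - f (x + t *: e_ i))).
  apply/funext => h /=; congr (_ *: (f _ - _)).
  by rewrite scaler1 scalerDl addrCA.
by split; rewrite /derivable /derive E.
Qed.

End smooth_functions.

Section compactly_supported.
Context {R : realType} (n : nat).
Implicit Types (f g : 'rV[R]_n -> R) (omega : set 'rV[R]_n).

Local Notation mu := (@lebesgue_rV R n).

Definition bounded_support f := measurable_fun setT f /\
  exists M, (forall x, `|f x| <= M) /\ (forall x, f x != 0 -> cube n (- M) M x).

Lemma cube_fin_measure M : (mu (cube n (- M) M) < +oo)%E.
Proof.
have [M0|M0] := leP 0 M; first by rewrite lebesgue_box_itv ?ltry// (@le_trans _ _ 0)// oppr_le0.
apply: (@le_lt_trans _ _ (mu (cube n 0 0))).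
  apply: le_measure; rewrite ?inE; try exact: measurable_cube.
  by move=> x H i; have := H i; rewrite /= !in_itv/= => /andP[]; lra.
by rewrite lebesgue_box_itv ?ltry.
Qed.

Lemma bounded_support_integrable f : bounded_support f ->
  mu.-integrable setT (EFin \o f).
Proof.
move=> [mf [M [fM fc]]].
have mc := @measurable_cube R n (- M) M.
have : mu.-integrable setT (EFin \o (fun x => M * \1_(cube n (- M) M) x)).
  apply: (eq_integrable measurableT (fun x => M%:E * (\1_(cube n (- M) M) x)%:E)%E) => //.
  apply: integrableZl => //; apply/integrableP; split.
    by apply/measurable_EFinP; exact: measurable_indic.
  rewrite (eq_integral (fun x => (\1_(cube n (- M) M) x)%:E)).
    by rewrite integral_indic// setIT; exact: cube_fin_measure.
  by move=> x _; rewrite gee0_abs// lee_fin.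
apply: le_integrable => //; first exact/measurable_EFinP.
move=> x _ /=; rewrite lee_fin.
have [->|/fc xc] := eqVneq (f x) 0; first by rewrite normr0.
by rewrite indicE mem_set// mulr1 (le_trans (fM x))// ler_norm.
Qed.

Lemma bounded_support_mul f g : bounded_support f -> bounded_support g ->
  bounded_support (f * g).
Proof.
move=> [mf [M [fM fc]]] [mg [L [gL gc]]]; split; first exact: measurable_funM.
exists (M * L + M); split=> x.
  rewrite normrM; apply: (@le_trans _ _ (M * L)); first by rewrite ler_pM.
  by rewrite lerDl; exact: le_trans (normr_ge0 _) (fM x).
rewrite mulf_eq0 negb_or => /andP[/fc xc _] i.
have := xc i; rewrite /= !in_itv/= => /andP[x1 x2].
have : 0 <= M * L by rewrite mulr_ge0// ?(le_trans (normr_ge0 _) (fM x)) ?(le_trans (normr_ge0 _) (gL x)).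
by move=> ?; lra.
Qed.

Lemma bounded_support_sqint f : bounded_support f -> sqint mu setT f.
Proof.
move=> bf; split; first by case: bf.
have := bounded_support_integrable (bounded_support_mul bf bf).
move=> /(integral_fune_lt_pinfty measurableT); congr (_ < _)%E.
Qed.

Lemma test_function_ccontinuous omega f : test_function omega f ->
  bounded_support f /\ forall i, bounded_support (partial i f).
Proof.
move=> [sf cK _]; set K := closure _ in cK.
have bd g : continuous g -> (forall x, g x != 0 -> K x) -> bounded_support g.
  move=> cg gK; split; first exact: continuous_measurable_rV.
  have cgK : compact (g @` K) by apply: continuous_compact => //; exact: continuous_subspaceT.
  have [M1 M10 HM1] := bounded_subset_cube (compact_bounded cK).
  have [M2 M20 HM2] := pinfty_ex_gt0 (compact_bounded cgK).
  exists (M1 + M2); split=> x.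
    have [->|/gK Kx] := eqVneq (g x) 0; first by rewrite normr0 addr_ge0// ltW.
    apply: (@le_trans _ _ M2); last by rewrite lerDr ltW.
    by apply: HM2; exists x.
  move=> /gK /HM1 xc i; have := xc i; rewrite /= !in_itv/= => /andP[]; lra.
split; first by apply: bd; [exact: smooth_continuous|exact: subset_closure].
move=> i; apply: bd; first exact/smooth_continuous/smooth_partial.
move=> x; apply: contraNP => Kx; apply/eqP.
rewrite /partial (near_eq_derive (g := cst 0)) ?derive_cst//.
have : nbhs x (~` K) by apply: open_nbhs_nbhs; split => //; exact/closed_openC/closed_closure.
apply: filterS => y Ky /=; apply/eqP; apply: contrapT => /negP fy; apply: Ky.
exact: subset_closure.
Qed.

End compactly_supported.

(** * A smooth step function on the line *)

Section smooth_step.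
Context {R : realType}.
Implicit Types (f g : R -> R).

Fixpoint Cn (n : nat) f : Prop := continuous f /\
  if n is m.+1 then (forall x, derivable f x 1) /\ Cn m (derive1 f) else True.

Definition Cinfty f := forall n, Cn n f.

Lemma Cn_continuous n f : Cn n f -> continuous f.
Proof. by case: n => [|n] []. Qed.

Lemma Cn_prev n f : Cn n.+1 f -> Cn n f.
Proof.
elim: n f => [|n IH] f; first by case.
by move=> [cf [df Df]]; split=> //; split=> //; exact: IH.
Qed.

Lemma CnD n f g : Cn n f -> Cn n g -> Cn n (f + g).
Proof.
elim: n f g => [|n IH] f g.
  by move=> [cf _] [cg _]; split=> // x; apply: continuousD; [exact: cf|exact: cg].
move=> [cf [df Df]] [cg [dg Dg]].
split; first by move=> x; apply: continuousD; [exact: cf|exact: cg].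
split; first by move=> x; exact: derivableD.
rewrite (_ : derive1 (f + g) = (derive1 f) + (derive1 g)); first exact: IH.
by apply/funext => x; rewrite derive1E (deriveD (df x) (dg x)) -!derive1E.
Qed.

Lemma Cn_cst n (c : R) : Cn n (cst c).
Proof.
elim: n c => [|n IH] c; first by split=> //; exact: cst_continuous.
split; first exact: cst_continuous.
split; first by move=> x; exact: derivable_cst.
rewrite (_ : derive1 (cst c) = cst 0)//.
by apply/funext => x; rewrite derive1_cst.
Qed.

Lemma CnM n f g : Cn n f -> Cn n g -> Cn n (f * g).
Proof.
elim: n f g => [|n IH] f g.
  by move=> [cf _] [cg _]; split=> // x; apply: continuousM; [exact: cf|exact: cg].
move=> Cf Cg; have [cf [df Df]] := Cf; have [cg [dg Dg]] := Cg.
split; first by move=> x; apply: continuousM; [exact: cf|exact: cg].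
split; first by move=> x; exact: derivableM.
rewrite (_ : derive1 (f * g) = f * (derive1 g) + g * (derive1 f)).
  by apply: CnD; apply: IH => //; exact: Cn_prev.
by apply/funext => x; rewrite derive1E (deriveM (df x) (dg x)) -!derive1E.
Qed.

Lemma CnZ n k f : Cn n f -> Cn n (k *: f).
Proof.
by move=> Cf; rewrite (_ : k *: f = cst k * f)//; apply: CnM => //; exact: Cn_cst.
Qed.

Lemma CnV n f : (forall x, f x != 0) -> Cn n f -> Cn n (fun x => (f x)^-1).
Proof.
move=> f0; elim: n => [|n IH].
  by move=> [cf _]; split=> // x; apply: continuousV; [exact: f0|exact: cf].
move=> Cf; have [cf [df Df]] := Cf.
split; first by move=> x; apply: continuousV; [exact: f0|exact: cf].
split; first by move=> x; exact: derivableV.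
have IV := IH (Cn_prev Cf).
rewrite (_ : derive1 _ = -1 *: ((fun x => (f x)^-1) * (fun x => (f x)^-1) * (derive1 f))).
  by apply: CnZ; apply: CnM => //; exact: CnM.
apply/funext => x; rewrite derive1E deriveV// -derive1E !fctE.
by rewrite scaleN1r scaleNr -exprVn expr2.
Qed.

Lemma affine_is_derive f (a b x : R) : (forall x, derivable f x 1) ->
  is_derive x (1 : R) (fun x => f (a * x + b)) (a * (derive1 f) (a * x + b)).
Proof.
move=> df.
have Df : is_derive (a * x + b) (1 : R) f ((derive1 f) (a * x + b)).
  by rewrite derive1E; exact: derivableP.
have Dg : is_derive x (1 : R) (fun x => a * x + b) a.
  by apply: is_derive_eq; rewrite addr0 scaler1.
by have := @is_derive1_comp _ f (fun x => a * x + b) x _ _ Df Dg; rewrite mulrC.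
Qed.

Lemma Cn_affine n f (a b : R) : Cn n f -> Cn n (fun x => f (a * x + b)).
Proof.
have caff x : {for x, continuous (fun x : R => a * x + b)}.
  by apply: continuousD; [exact: mulrl_continuous|exact: cst_continuous].
elim: n f => [|n IH] f.
  by move=> [cf _]; split=> // x; apply: continuous_comp; [exact: caff|exact: cf].
move=> Cf; have [cf [df Df]] := Cf.
split; first by move=> x; apply: continuous_comp; [exact: caff|exact: cf].
split; first by move=> x; have [] := affine_is_derive a b x df.
rewrite (_ : derive1 _ = a *: (fun x => (derive1 f) (a * x + b))); first exact/CnZ/IH.
by apply/funext => x; rewrite derive1E; have [_ ->] := affine_is_derive a b x df.
Qed.

(* The factor [x ^- k] makes the family stable under differentiation. *)
Definition expinv (k : nat) (x : R) : R := if 0 < x then x ^- k * expR (- x^-1) else 0.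

(** The exponential series gives exp(1/x) >= x^-(k+1) / (k+1)!. The linear bound yields continuity
    at 0 for all k at once. *)
Lemma expinv_le k (x : R) : 0 < x -> `|expinv k x| <= (k.+1)`!%:R * x.
Proof.
move=> x0; rewrite /expinv x0 ger0_norm; last by rewrite mulr_ge0 ?expR_ge0// invr_ge0 exprn_ge0// ltW.
rewrite expRN ler_pdivrMr ?expR_gt0//.
have := @expR_ge1Dxn R x^-1 k; rewrite invr_ge0 ltW// => /(_ isT) h.
have f0 : 0 < (k.+1)`!%:R :> R by rewrite ltr0n fact_gt0.
have : x^-1 ^+ k.+1 <= (k.+1)`!%:R * expR x^-1.
  by rewrite -ler_pdivrMl// mulrC; apply: le_trans h; rewrite lerDr.
rewrite exprS mulrC ler_pdivrMr// exprVn => /le_trans; apply.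
by rewrite mulrAC.
Qed.

Lemma expinv_cvg0 k : expinv k x @[x --> (0 : R)] --> (0 : R).
Proof.
apply/cvgrPdist_le => e e0.
have f0 : 0 < (k.+1)`!%:R :> R by rewrite ltr0n fact_gt0.
have N : \forall x \near (0 : R), `|x| <= e / (k.+1)`!%:R.
  by apply: (@nbhs0_le R R^o); rewrite divr_gt0.
near=> x.
rewrite sub0r normrN; have [x0|x0] := ltP 0 x; last first.
  by rewrite /expinv ltNge x0/= normr0 ltW.
apply: (le_trans (expinv_le k x0)).
rewrite -ler_pdivlMl// mulrC; apply: le_trans (ler_norm x) _.
by near: x.
Unshelve. all: by end_near. Qed.

Lemma expinv_is_derive k (x : R) :
  is_derive x (1 : R) (expinv k) (- k%:R * expinv k.+1 x + expinv k.+2 x).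
Proof.
have [x0|x0|x0] := ltgtP 0 x.
- pose g (y : R) := y ^- k * expR (- y^-1).
  have ng : \near x, g x = expinv k x.
    near=> y; rewrite /expinv /g ifT//; near: y; exact: lt_nbhsr.
  apply: (near_eq_is_derive ng).
  have xn0 : x != 0 by rewrite gt_eqF.
  have D1 : is_derive x (1 : R) (fun y : R => y ^+ k) (k%:R * x ^+ k.-1).
    apply: DeriveDef; first exact: exprn_derivable.
    by rewrite exp_derive [LHS]mulr1.
  have D2 : is_derive x (1 : R) (fun y : R => (y ^+ k)^-1) (- (x ^+ k) ^- 2 *: (k%:R * x ^+ k.-1)).
    by apply: is_deriveV; rewrite expf_neq0.
  have D3 : is_derive x (1 : R) (fun y : R => y^-1) (- x ^- 2 *: 1).
    by apply: (@is_deriveV _ id).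
  have D4 : is_derive x (1 : R) (fun y : R => - y^-1) (x ^- 2).
    by apply: is_derive_eq; rewrite scaleNr opprK scaler1.
  have D5 : is_derive x (1 : R) (fun y : R => expR (- y^-1)) (expR (- x^-1) * x ^- 2).
    exact: (@is_derive1_comp _ expR (fun y : R => - y^-1)).
  have D6 := @is_deriveM _ _ _ _ x 1 _ _ D2 D5.
  apply: (is_derive_eq D6).
  rewrite /expinv x0 /GRing.scale/=; case: k {D1 D2 D6 ng g} => [|k].
    by rewrite !mul0r !mulr0 oppr0 !mul0r expr0 invr1 !expr2; field.
  rewrite [(k.+1).-1]/= !exprS; field.
  by rewrite xn0 expf_neq0.
- have ng : \near x, cst 0 x = expinv k x.
    near=> y; rewrite /expinv ltNge ltW//; near: y; exact: lt_nbhsl.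
  apply: (near_eq_is_derive ng).
  rewrite /expinv ltNge (ltW x0)/= mulr0 addr0; exact: is_derive_cst.
- rewrite -x0 /expinv ltxx mulr0 addr0.
  have H : (fun h : R => h^-1 *: ((expinv k \o shift 0) (h *: (1 : R)) - expinv k 0)) @ 0^' --> (0 : R).
    (* The difference quotient at 0 is itself the next member of the family, which tends to 0. *)
    rewrite (_ : (fun h : R => _) = expinv k.+1).
      by apply: cvg_within_filter; exact: expinv_cvg0.
    apply/funext => h /=; rewrite /expinv ltxx subr0 addr0 /GRing.scale/= mulr1.
    by case: ifP => _; rewrite ?mulr0// exprS invfM mulrA.
  split; first by apply/cvg_ex; exists 0.
  exact: (cvg_lim _ H).
Unshelve. all: by end_near. Qed.

Lemma expinv_Cinfty k : Cinfty (expinv k).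
Proof.
have dk k' x : derivable (expinv k') x 1 by have [] := expinv_is_derive k' x.
have ck k' : continuous (expinv k').
  by move=> x; apply: differentiable_continuous; exact/derivable1_diffP.
move=> n; elim: n k => [|n IH] k; first by split.
split=> //; split=> //.
rewrite (_ : derive1 _ = (- k%:R) *: expinv k.+1 + expinv k.+2).
  by apply: CnD => //; exact: CnZ.
by apply/funext => x; rewrite derive1E; have [_ ->] := expinv_is_derive k x.
Qed.

Definition smooth_step (x : R) := expinv 0 x / (expinv 0 x + expinv 0 (1 - x)).

Lemma expinv0_ge0 x : 0 <= expinv 0 x.
Proof. by rewrite /expinv; case: ifP => // _; rewrite expr0 invr1 mul1r expR_ge0. Qed.

Lemma expinv0_gt0 x : 0 < x -> 0 < expinv 0 x.
Proof. by move=> x0; rewrite /expinv x0 expr0 invr1 mul1r expR_gt0. Qed.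

Lemma expinv0_eq0 x : x <= 0 -> expinv 0 x = 0.
Proof. by move=> x0; rewrite /expinv ltNge x0. Qed.

Lemma smooth_step_den_gt0 x : 0 < expinv 0 x + expinv 0 (1 - x).
Proof.
have [x0|x0] := ltP 0 x.
  by rewrite ltr_wpDr ?expinv0_ge0// expinv0_gt0.
by rewrite ltr_wpDl ?expinv0_ge0// expinv0_gt0// subr_gt0 (le_lt_trans x0).
Qed.

Lemma smooth_step_Cinfty : Cinfty smooth_step.
Proof.
move=> n; rewrite (_ : smooth_step = expinv 0 * (fun x => (expinv 0 x + expinv 0 (-1 * x + 1))^-1)).
  apply: CnM; first exact: expinv_Cinfty.
  apply: CnV.
    by move=> x; rewrite mulN1r addrC gt_eqF// addrC; have := smooth_step_den_gt0 x; rewrite [1 - x]addrC.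
  apply: CnD; first exact: expinv_Cinfty.
  by apply: Cn_affine; exact: expinv_Cinfty.
by apply/funext => x; rewrite !fctE /smooth_step mulN1r [- x + 1]addrC.
Qed.

Lemma smooth_step_ge0 x : 0 <= smooth_step x.
Proof. by rewrite divr_ge0 ?expinv0_ge0// ltW// smooth_step_den_gt0. Qed.

Lemma smooth_step_le1 x : smooth_step x <= 1.
Proof.
by rewrite ler_pdivrMr ?smooth_step_den_gt0// mul1r lerDl expinv0_ge0.
Qed.

Lemma smooth_step_eq0 x : x <= 0 -> smooth_step x = 0.
Proof. by move=> x0; rewrite /smooth_step expinv0_eq0// mul0r. Qed.

Lemma smooth_step_eq1 x : 1 <= x -> smooth_step x = 1.
Proof.
move=> x1; rewrite /smooth_step (@expinv0_eq0 (1 - x)) ?subr_le0// addr0 divff//.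
by rewrite gt_eqF// expinv0_gt0// (lt_le_trans ltr01).
Qed.

(** The derivative lives on [0, 1], where the difference on the right equals 1. Writing the bound
    with differences of the step itself lets it telescope when summed over unit translates. *)
Lemma smooth_step_derive_bound : exists2 M : R, 0 < M &
  forall x, `|derive1 smooth_step x| <= M * (smooth_step (x + 1) - smooth_step (x - 1)).
Proof.
have cd : continuous (derive1 smooth_step).
  by have [_ [_ []]] := smooth_step_Cinfty 1.
have [M M0 HM] := pinfty_ex_gt0 (compact_bounded (continuous_compact (continuous_subspaceT cd) (@segment_compact R 0 1))).
exists M => // x.
have [x0|x0] := ltP x 0.
  rewrite derive1E (near_eq_derive (g := cst 0)) ?derive_cst ?normr0.
    by rewrite mulr_ge0 ?(ltW M0)// (@smooth_step_eq0 (x - 1)) ?subr0 ?smooth_step_ge0//; lra.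
  near=> y; rewrite smooth_step_eq0// ltW//; near: y; exact: lt_nbhsl.
have [x1|x1] := ltP 1 x.
  rewrite derive1E (near_eq_derive (g := cst (1 : R))) ?derive_cst ?normr0.
    by rewrite mulr_ge0 ?(ltW M0)// (@smooth_step_eq1 (x + 1)) ?subr_ge0 ?smooth_step_le1//; lra.
  near=> y; rewrite smooth_step_eq1// ltW//; near: y; exact: lt_nbhsr.
rewrite smooth_step_eq1 ?lerDr// smooth_step_eq0 ?subr_le0// subr0 mulr1.
by apply: HM; exists x => //=; rewrite in_itv/= x0.
Unshelve. all: by end_near. Qed.

End smooth_step.

(** * Grid partitions of unity and cutoffs *)

Section cutoff.
Context {R : realType}.

(** A bump supported in [-1, 1], defined as a difference so that its integer translates telescope to
    a partition of unity. *)
Definition hat (v : R) := smooth_step (v + 1) - smooth_step v.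

Lemma hat_Cinfty : Cinfty hat.
Proof.
move=> n; rewrite (_ : hat = (fun v => smooth_step (1 * v + 1)) + (-1 *: smooth_step)).
  apply: CnD; first by apply: Cn_affine; exact: smooth_step_Cinfty.
  by apply: CnZ; exact: smooth_step_Cinfty.
by apply/funext => v; rewrite !fctE /hat mul1r /GRing.scale/= mulN1r.
Qed.

Lemma hat_ge0 v : 0 <= hat v.
Proof.
rewrite subr_ge0; have [v0|v0] := leP v 0.
  by rewrite smooth_step_eq0// smooth_step_ge0.
by rewrite (@smooth_step_eq1 _ (v + 1)) ?smooth_step_le1// lerDr ltW.
Qed.

Lemma hat0 : hat 0 = 1.
Proof. by rewrite /hat add0r smooth_step_eq1// smooth_step_eq0// subr0. Qed.

Lemma hat_neq0 v : hat v != 0 -> `|v| < 1.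
Proof.
apply: contraNT; rewrite -leNgt ler_normr => /orP[v1|v1].
  by rewrite /hat !smooth_step_eq1 ?subrr//; lra.
by rewrite /hat !smooth_step_eq0 ?subrr//; lra.
Qed.

Lemma sum_smooth_step (m : nat) (w : R) :
  \sum_(j < m) (smooth_step (w + 1 - j%:R) - smooth_step (w - j%:R)) =
  smooth_step (w + 1) - smooth_step (w + 1 - m%:R).
Proof.
elim: m => [|m IH]; first by rewrite big_ord0 subr0 subrr.
rewrite big_ord_recr/= IH -[m.+1%:R]natr1 (_ : w + 1 - (m%:R + 1) = w - m%:R); last by ring.
by ring.
Qed.

Lemma smooth_step_diff_le1 (a b : R) : smooth_step a - smooth_step b <= 1.
Proof.
by rewrite lerBlDr (le_trans (smooth_step_le1 a))// lerDl smooth_step_ge0.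
Qed.

Lemma hat_is_derive v :
  is_derive v (1 : R) hat (derive1 smooth_step (v + 1) - derive1 smooth_step v).
Proof.
have ds x : derivable (@smooth_step R) x 1.
  by have [_ [+ _]] := @smooth_step_Cinfty R 1; exact.
have D1 := affine_is_derive 1 1 v ds.
have D2 : is_derive v (1 : R) (@smooth_step R) (derive1 smooth_step v).
  by rewrite derive1E; exact: derivableP.
rewrite (_ : hat = (fun v => smooth_step (1 * v + 1)) - (@smooth_step R)).
  by apply: (is_derive_eq (is_deriveB D1 D2)); rewrite !mul1r.
by apply/funext => x; rewrite !fctE /hat mul1r.
Qed.

(** Each term is bounded by M times four consecutive step differences, and each of the four
    resulting sums telescopes to at most 1. The bound is therefore independent of the number of
    translates. *)
Lemma hat_derive_sum_le : exists2 K : R, 0 < K & forall (m : nat) (w : R),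
  \sum_(j < m) `|derive1 hat (w - j%:R)| <= K.
Proof.
have [M M0 HM] := @smooth_step_derive_bound R.
exists (4 * M); first by rewrite mulr_gt0.
move=> m w.
pose S u := \sum_(j < m) (smooth_step (u + 1 - j%:R) - smooth_step (u - j%:R)) : R.
have S1 u : S u <= 1 by rewrite /S sum_smooth_step smooth_step_diff_le1.
apply: (@le_trans _ _ (M * (S (w + 1) + S w + S w + S (w - 1)))); last first.
  by rewrite mulrC ler_pM2r//; have := (S1 (w + 1), S1 w, S1 (w - 1)) => -[[]]; lra.
rewrite /S -!big_split/= mulr_sumr; apply: ler_sum => j _.
have [_ Dh] := hat_is_derive (w - j%:R); rewrite derive1E Dh.
apply: (le_trans (ler_normB _ _)).
apply: (le_trans (lerD (HM _) (HM _))).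
rewrite -mulrDr ler_pM2l//.
rewrite (_ : w - j%:R + 1 + 1 = w + 1 + 1 - j%:R); last by ring.
rewrite (_ : w - j%:R + 1 - 1 = w - j%:R); last by ring.
rewrite (_ : w - j%:R + 1 = w + 1 - j%:R); last by ring.
rewrite (_ : w - 1 + 1 - j%:R = w - j%:R); last by ring.
rewrite (_ : w - 1 - j%:R = w - j%:R - 1); last by ring.
lra.
Qed.

Section coordinates.
Context (n : nat).
Implicit Types i j : 'I_n.

Local Notation e_ i := (delta_mx ord0 i : 'rV[R]_n).

Lemma is_derive_along_line (f : 'rV[R]_n -> R) (x v : 'rV[R]_n) (d : R) :
  is_derive (0 : R) (1 : R) (fun s : R => f (x + s *: v)) d -> is_derive x v f d.
Proof.
move=> [df Df].
have E : (fun h : R => h^-1 *: (((fun s : R => f (x + s *: v)) \o shift 0) (h *: (1 : R)) - f (x + 0 *: v))) =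
  (fun h : R => h^-1 *: ((f \o shift x) (h *: v) - f x)).
  apply/funext => h /=; congr (_ *: (f _ - f _)).
    by rewrite addr0 [h *: 1]mulr1 addrC.
  by rewrite scale0r addr0.
by move: df Df; rewrite /derivable /derive E => df Df; split.
Qed.

Lemma coordinate_derive (h : R -> R) (a b : R) i j (x : 'rV[R]_n) : (forall y, derivable h y 1) ->
  is_derive x (e_ j) (fun x : 'rV[R]_n => h (a * x ord0 i + b))
    (if i == j then a * derive1 h (a * x ord0 i + b) else 0).
Proof.
move=> dh; apply: is_derive_along_line.
rewrite (_ : (fun s : R => _) = (fun s => h ((a * (i == j)%:R) * s + (a * x ord0 i + b)))).
  have := affine_is_derive (a * (i == j)%:R) (a * x ord0 i + b) 0 dh.
  by case: eqP => _; rewrite ?mulr1 ?mulr0 ?mul0r ?add0r.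
by apply/funext => s; rewrite !mxE eqxx/=; congr h; ring.
Qed.

Lemma smooth_coordinate (h : R -> R) (a b : R) i : Cinfty h ->
  smooth (fun x : 'rV[R]_n => h (a * x ord0 i + b)).
Proof.
move=> Ch.
apply: (@smooth_stable_class _ _ [set f | exists c g, Cinfty g /\ f = (fun x : 'rV[R]_n => c * g (a * x ord0 i + b))]); last first.
  by exists 1, h; split => //; apply/funext => x; rewrite mul1r.
move=> _ [c [g [Cg ->]]].
have dg y : derivable g y 1 by have [_ [+ _]] := Cg 1%N; exact.
have D j x := coordinate_derive a b i j x dg.
have D' j x : is_derive x (e_ j) (fun x : 'rV[R]_n => c * g (a * x ord0 i + b))
    (c * (if i == j then a * derive1 g (a * x ord0 i + b) else 0)).
  exact: (@is_deriveZ _ _ _ (fun x : 'rV[R]_n => g (a * x ord0 i + b)) c).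
split.
- move=> x; apply: continuousM; first exact: cst_continuous.
  apply: (@continuous_comp _ _ _ (fun x : 'rV[R]_n => a * x ord0 i + b) g).
    apply: continuousD; last exact: cst_continuous.
    apply: continuousM; first exact: cst_continuous.
    exact: coord_continuous.
  exact: (Cn_continuous (Cg 0%N)).
- by move=> j x; have [] := D' j x.
- move=> j; exists (c * (if i == j then a else 0)), (derive1 g); split.
    by move=> m; have [_ [_]] := Cg m.+1.
  apply/funext => x; rewrite /partial; have [_ ->] := D' j x.
  by case: eqP => _; rewrite ?mulr0 ?mul0r// mulrA.
Qed.

Lemma partial_prod0 (I : Type) (r : seq I) (P : pred I) (F : I -> 'rV[R]_n -> R) i :
  (forall k, smooth (F k)) -> (forall k, P k -> partial i (F k) = 0) ->
  partial i (\prod_(k <- r | P k) F k) = 0.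
Proof.
move=> sF PF; rewrite -big_filter.
elim: r => [|k r IH] /=.
  by rewrite big_nil; apply/funext => x; rewrite /partial (derive_cst (1 : R)).
case: ifP => Pk; last exact: IH.
rewrite big_cons partialM//; last exact: smooth_prod.
by rewrite IH PF// !mulr0 addr0.
Qed.

Lemma prod_fctE (I : Type) (r : seq I) (P : pred I) (F : I -> 'rV[R]_n -> R) x :
  (\prod_(k <- r | P k) F k) x = \prod_(k <- r | P k) F k x.
Proof. by elim/big_ind2 : _ => // f a g b <- <-. Qed.

Lemma partial_prod_coordinate (F : 'I_n -> 'rV[R]_n -> R) i x :
  (forall j, smooth (F j)) -> (forall j, j != i -> partial i (F j) = 0) ->
  partial i (\prod_j F j) x = partial i (F i) x * \prod_(j | j != i) F j x.
Proof.
move=> sF H.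
have -> : \prod_j F j = F i * \prod_(j | j != i) F j.
  by apply/funext => y; rewrite fctE !prod_fctE (bigD1 i).
rewrite partialM//; last by rewrite -big_filter; exact: smooth_prod.
by rewrite partial_prod0// mulr0 add0r fctE prod_fctE mulrC.
Qed.

End coordinates.

Section grid.
Context (n : nat).

(* [2 L + 1] grid points per axis, the [j]-th one being [delta (j - L)]. *)
Definition grid_point (delta : R) (L : nat) (z : {ffun 'I_n -> 'I_(L.*2.+1)}) : 'rV[R]_n :=
  \row_i (delta * ((z i)%:R - L%:R)).

(** The argument of the i-th [hat] is (x_i - p_i) / delta, where p is the point
    [grid_point delta z]. *)
Definition grid_bump (delta : R) (L : nat) (z : {ffun 'I_n -> 'I_(L.*2.+1)}) : 'rV[R]_n -> R :=
  \prod_i (fun x : 'rV[R]_n => hat (delta^-1 * x ord0 i + (L%:R - (z i)%:R))).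

Lemma smooth_grid_bump delta L z : smooth (@grid_bump delta L z).
Proof. by apply: smooth_prod => i; apply: smooth_coordinate; exact: hat_Cinfty. Qed.

Lemma grid_bump_ge0 delta L z x : 0 <= @grid_bump delta L z x.
Proof. by rewrite /grid_bump prod_fctE; apply: prodr_ge0 => i _; exact: hat_ge0. Qed.

Lemma hat_sum (L : nat) (y : R) :
  \sum_(j < L.*2.+1) hat (y + (L%:R - j%:R)) = smooth_step (y + L%:R + 1) - smooth_step (y - L%:R).
Proof.
rewrite (eq_bigr (fun j : 'I_ _ => smooth_step (y + L%:R + 1 - j%:R) - smooth_step (y + L%:R - j%:R))).
  rewrite sum_smooth_step; congr (_ - smooth_step _).
  by rewrite -natr1 -addnn natrD; ring.
by move=> j _; rewrite /hat; congr (smooth_step _ - smooth_step _); ring.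
Qed.

Lemma sum_grid_bump delta L x : \sum_z @grid_bump delta L z x =
  \prod_i (smooth_step (delta^-1 * x ord0 i + L%:R + 1) - smooth_step (delta^-1 * x ord0 i - L%:R)).
Proof.
rewrite (eq_bigr (fun z : {ffun 'I_n -> 'I_(L.*2.+1)} =>
  \prod_i hat (delta^-1 * x ord0 i + (L%:R - (z i)%:R)))); last first.
  by move=> z _; rewrite /grid_bump prod_fctE.
rewrite -(bigA_distr_bigA (fun i (j : 'I_(L.*2.+1)) => hat (delta^-1 * x ord0 i + (L%:R - j%:R))))/=.
by apply: eq_bigr => i _; rewrite hat_sum.
Qed.

Lemma sum_grid_bump_le1 delta L x (P : pred {ffun 'I_n -> 'I_(L.*2.+1)}) :
  \sum_(z | P z) grid_bump delta z x <= 1.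
Proof.
apply: (@le_trans _ _ (\sum_(z : {ffun 'I_n -> 'I_(L.*2.+1)}) grid_bump delta z x)).
  by rewrite [leRHS](bigID P)/= lerDl sumr_ge0// => z _; exact: grid_bump_ge0.
rewrite sum_grid_bump; apply: prodr_ile1 => i _.
by rewrite smooth_step_diff_le1 -hat_sum sumr_ge0// => j _; exact: hat_ge0.
Qed.

Lemma grid_bump_neq0 delta L z x : 0 < delta -> @grid_bump delta L z x != 0 ->
  ball x delta (grid_point delta z).
Proof.
move=> d0; rewrite /grid_bump prod_fctE => /prodf_neq0 H; apply/ball_rVP => // i.
have := hat_neq0 (H i isT); rewrite mxE => h.
rewrite (_ : _ - _ = delta * (delta^-1 * x ord0 i + (L%:R - (z i)%:R))); last first.
  by field; rewrite gt_eqF.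
by rewrite normrM gtr0_norm// gtr_pMr.
Qed.

(** The cutoff is the sum of the bumps centred at the grid points lying in [G]. This replaces
    mollification, and [K] depends neither on [G] nor on the scales because the derivative of the
    partition of unity is controlled one axis at a time. *)
Lemma exists_cutoff : exists2 K : R, 0 < K &
  forall (G : set 'rV[R]_n) (delta M : R), 0 < delta -> 0 < M ->
  exists eta : 'rV[R]_n -> R, [/\ smooth eta, forall x, 0 <= eta x <= 1,
    forall x, eta x != 0 -> exists2 p, G p & ball x delta p,
    forall x, cube n (- M) M x -> (forall p, ball x delta p -> G p) -> eta x = 1 &
    forall i x, `|partial i eta x| <= K / delta].
Proof.
have [K K0 HK] := hat_derive_sum_le; exists K => // G delta M d0 M0.
(* Enough grid points for the bumps to sum to 1 on the whole cube of half-width [M]. *)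
pose L := Num.bound (M / delta).
have ML : M / delta <= L%:R by apply/ltW/archi_boundP; rewrite divr_ge0// ltW.
pose good (z : {ffun 'I_n -> 'I_(L.*2.+1)}) := `[< G (grid_point delta z) >].
have sum_fctE (P : pred {ffun 'I_n -> 'I_(L.*2.+1)}) (F : {ffun 'I_n -> 'I_(L.*2.+1)} -> 'rV[R]_n -> R) x :
    (\sum_(z | P z) F z) x = \sum_(z | P z) F z x.
  by elim/big_ind2 : _ => // f a g b <- <-.
exists (\sum_(z | good z) grid_bump delta z); split.
- by rewrite -big_filter; apply: smooth_sum => z; exact: smooth_grid_bump.
- move=> x; rewrite sum_fctE sum_grid_bump_le1 andbT.
  by apply: sumr_ge0 => z _; exact: grid_bump_ge0.
- move=> x; rewrite sum_fctE => H.
  have [z gz zx] : exists2 z, good z & grid_bump delta z x != 0.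
    apply: contrapT => N; move/eqP: H; apply; apply: big1 => z gz.
    by apply/eqP; apply: contrapT => /negP zx; apply: N; exists z.
  by exists (grid_point delta z); [exact/asboolP|exact: grid_bump_neq0].
- move=> x xM Hx; rewrite sum_fctE.
  transitivity (\sum_(z : {ffun 'I_n -> 'I_(L.*2.+1)}) grid_bump delta z x).
    rewrite [RHS](bigID good)/= [X in _ + X]big1 ?addr0// => z /asboolP Nz.
    apply/eqP; apply: contrapT => /negP zx; apply: Nz; apply: Hx.
    exact: grid_bump_neq0.
  rewrite sum_grid_bump; apply: big1 => i _.
  have := xM i; rewrite /= in_itv/= -ler_norml => xi.
  have : `|delta^-1 * x ord0 i| <= L%:R.
    rewrite normrM gtr0_norm ?invr_gt0// mulrC.
    by apply: le_trans ML; rewrite ler_pM2r ?invr_gt0.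
  rewrite ler_norml => /andP[l1 l2].
  by rewrite smooth_step_eq1 ?smooth_step_eq0 ?subr0//; lra.
- move=> i x; rewrite -big_filter partial_sum; last by move=> z; exact: smooth_grid_bump.
  rewrite big_filter sum_fctE.
  apply: (le_trans (ler_norm_sum _ _ _)).
  have dh y : derivable hat y 1 by have [] := hat_is_derive y.
  have pF (z : {ffun 'I_n -> 'I_(L.*2.+1)}) j :
      partial i (fun x : 'rV[R]_n => hat (delta^-1 * x ord0 j + (L%:R - (z j)%:R))) x =
      if j == i then delta^-1 * derive1 hat (delta^-1 * x ord0 j + (L%:R - (z j)%:R)) else 0.
    by rewrite /partial; have [_ ->] := coordinate_derive delta^-1 (L%:R - (z j)%:R) j i x dh.
  pose F j (k : 'I_(L.*2.+1)) := if j == i then delta^-1 * `|derive1 hat (delta^-1 * x ord0 j + (L%:R - k%:R))|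
    else hat (delta^-1 * x ord0 j + (L%:R - k%:R)).
  apply: (@le_trans _ _ (\sum_(z : {ffun 'I_n -> 'I_(L.*2.+1)}) \prod_j F j (z j))).
    rewrite [leRHS](bigID good)/= ler_wpDr//.
      apply: sumr_ge0 => z _; apply: prodr_ge0 => j _; rewrite /F; case: ifP => _; last exact: hat_ge0.
      by rewrite mulr_ge0// invr_ge0 ltW.
    apply: ler_sum => z _.
    rewrite /grid_bump partial_prod_coordinate.
    - rewrite pF eqxx normrM [leRHS](bigD1 i)//=; apply: ler_pM => //.
        by rewrite /F eqxx normrM gtr0_norm ?invr_gt0.
      rewrite ger0_norm; last by apply: prodr_ge0 => j _; exact: hat_ge0.
      by rewrite le_eqVlt; apply/orP; left; apply/eqP; apply: eq_bigr => j /negbTE ji; rewrite /F ji.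
    - by move=> j; apply: smooth_coordinate; exact: hat_Cinfty.
    - move=> j ji; apply/funext => y; rewrite /partial.
      have [_ ->] := coordinate_derive delta^-1 (L%:R - (z j)%:R) j i y dh.
      by rewrite (negbTE ji).
  (* By distributivity the sum over the grid is a product of sums over single axes: axis i
     contributes at most [K / delta], the others at most 1. *)
  rewrite -(bigA_distr_bigA F) (bigD1 i)//= mulrC.
  rewrite -[K / delta]mul1r; apply: ler_pM.
  + apply: prodr_ge0 => j ji; apply: sumr_ge0 => k _; rewrite /F (negbTE ji); exact: hat_ge0.
  + by apply: sumr_ge0 => k _; rewrite /F eqxx mulr_ge0// invr_ge0 ltW.
  + apply: prodr_ile1 => j ji; rewrite sumr_ge0/=.
      rewrite (eq_bigr (fun k : 'I_(L.*2.+1) => hat (delta^-1 * x ord0 j + (L%:R - k%:R)))).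
        by rewrite hat_sum smooth_step_diff_le1.
      by move=> k _; rewrite /F (negbTE ji).
    by move=> k _; rewrite /F (negbTE ji); exact: hat_ge0.
  + rewrite /F eqxx -mulr_sumr mulrC ler_pM2r ?invr_gt0//.
    under eq_bigr do rewrite addrA.
    exact: HK.
Qed.

End grid.
End cutoff.

(** * Restriction of the domain of integration *)

Section restriction.
Context d (T : measurableType d) (R : realType) (mu : {measure set T -> \bar R}).
Implicit Types (D E : set T) (f g : T -> R).

Lemma sqint_subset D E f : measurable D -> measurable E -> D `<=` E ->
  sqint mu E f -> sqint mu D f.
Proof.
move=> mD mE DE [mf foo]; split; first exact: measurable_funS mf.
apply: le_lt_trans foo; apply: ge0_subset_integral => //.
by apply/measurable_EFinP; exact: measurable_funX.
by move=> x _; rewrite lee_fin sqr_ge0.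
Qed.

Lemma sqn_subset D E f : measurable D -> measurable E -> D `<=` E ->
  sqint mu E f -> ip mu D f f <= ip mu E f f.
Proof.
move=> mD mE DE sf; have sfD := sqint_subset mD mE DE sf.
rewrite -lee_fin -!sqnE//; apply: ge0_subset_integral => //.
  by apply/measurable_EFinP; apply: measurable_funX; case: sf.
by move=> x _; rewrite lee_fin sqr_ge0.
Qed.

Lemma ip_supported D f g : (forall x, ~ D x -> f x * g x = 0) ->
  ip mu D f g = ip mu setT f g.
Proof.
move=> H; rewrite /ip Rintegral_mkcond; apply: eq_Rintegral => x _.
by rewrite patchE; case: ifPn => // /negP; rewrite inE => /H.
Qed.

Lemma sqn_cover (I : finType) D (A : I -> set T) f : measurable D ->
  (forall i, measurable (A i)) -> (forall x, D x -> exists i, A i x) ->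
  sqint mu setT f -> ip mu D f f <= \sum_i ip mu (A i) f f.
Proof.
move=> mD mA DA sf.
have sD := sqint_subset mD measurableT (@subsetT _ _) sf.
have sA i := sqint_subset (mA i) measurableT (@subsetT _ _) sf.
rewrite -lee_fin -sqnE// -sumEFin.
under eq_bigr do rewrite -sqnE//.
rewrite integral_mkcond; under eq_bigr do rewrite integral_mkcond.
rewrite -ge0_integral_sum//.
- have mf2 : measurable_fun setT (fun x => (f x ^+ 2)%:E).
    by apply/measurable_EFinP; apply: measurable_funX; case: sf.
  apply: ge0_le_integral => //.
  + by move=> x _; rewrite erestrict_ge0// => y _; rewrite lee_fin sqr_ge0.
  + by apply/(measurable_restrictT _ mD); exact: measurable_funS mf2.
  + apply: emeasurable_sum => i.
    by apply/(measurable_restrictT _ (mA i)); exact: measurable_funS mf2.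
  + move=> x _; rewrite patchE; case: ifPn => xD; last first.
      by apply: sume_ge0 => i _; rewrite erestrict_ge0// => y _; rewrite lee_fin sqr_ge0.
    have [i Ai] := DA x (set_mem xD).
    rewrite (bigD1 i)//= patchE mem_set// leeDl//.
    by apply: sume_ge0 => j _; rewrite erestrict_ge0// => y _; rewrite lee_fin sqr_ge0.
- move=> i; apply/(measurable_restrictT _ (mA i)).
  by apply/measurable_EFinP; apply: measurable_funX; case: (sA i).
- by move=> i x _; rewrite erestrict_ge0// => y _; rewrite lee_fin sqr_ge0.
Qed.

Lemma sqn_eq0P D (u : T -> R) : measurable D -> sqint mu D u ->
  ip mu D u u = 0 <-> mu.-negligible (D `&` [set x | u x != 0]).
Proof.
move=> mD su.
have mu2 : measurable_fun D (EFin \o (fun x => u x ^+ 2)).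
  by apply/measurable_EFinP; apply: measurable_funX; case: su.
have aeE : ae_eq mu D (EFin \o (fun x => u x ^+ 2)) (cst 0%E) <->
    mu.-negligible (D `&` [set x | u x != 0]).
  rewrite /ae_eq /prop_near1 /nbhs/= /almost_everywhere.
  set S := ~` _; suff -> : S = D `&` [set x | u x != 0] by [].
  apply/seteqP; split=> [x /= /not_implyP[Dx H]|x [Dx /= ux] H].
    by split=> //; apply/eqP => u0; apply: H; rewrite u0 expr0n.
  have /eqP := H Dx; rewrite /= eqe sqrf_eq0; exact/negP.
have := ae_eq_integral_abs mu mD mu2.
rewrite (_ : integral _ _ _ = (ip mu D u u)%:E); last first.
  by rewrite -sqnE//; apply: eq_integral => x _ /=; rewrite ger0_norm ?sqr_ge0.
move=> H; rewrite -aeE -H; split=> [->//|[]]//.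
Qed.

End restriction.

Section sqn_of_sums.
Context d (T : measurableType d) (R : realType) (mu : {measure set T -> \bar R}).
Variables (D : set T) (mD : measurable D).

Lemma sqint_sum (m : nat) (f : 'I_m -> T -> R) : (forall j, sqint mu D (f j)) ->
  sqint mu D (\sum_j f j).
Proof.
by move=> sf; elim/big_ind : _ => //; [exact: sqint0|move=> *; exact: sqintD].
Qed.

Lemma sqn0 : ip mu D 0 0 = 0.
Proof. by rewrite -(scale0r (0 : T -> R)) sqnZ ?expr0n ?mul0r//; exact: sqint0. Qed.

Lemma ip_suml (m : nat) (f : 'I_m -> T -> R) g : (forall j, sqint mu D (f j)) ->
  sqint mu D g -> ip mu D (\sum_j f j) g = \sum_j ip mu D (f j) g.
Proof.
move=> + sg; elim: m f => [|m IH] f sf.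
  by rewrite !big_ord0 /ip; under eq_Rintegral do rewrite mul0r; rewrite Rintegral_cst// mul0r.
rewrite !big_ord_recr/= ipDl// ?IH//.
exact: sqint_sum.
Qed.

(** Expand the square and bound each cross term by the mean of the two squares. *)
Lemma sqn_sum_le (m : nat) (f : 'I_m -> T -> R) : (forall j, sqint mu D (f j)) ->
  ip mu D (\sum_j f j) (\sum_j f j) <= m%:R * \sum_j ip mu D (f j) (f j).
Proof.
move=> sf; have sS := sqint_sum sf.
rewrite ip_suml//; set S := \sum_j ip mu D (f j) (f j).
apply: (@le_trans _ _ (\sum_(i < m) (m%:R / 2 * ip mu D (f i) (f i) + S / 2))).
  apply: ler_sum => i _; rewrite ipC ip_suml//.
  apply: (@le_trans _ _ (\sum_(j < m) (ip mu D (f i) (f i) / 2 + ip mu D (f j) (f j) / 2))).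
    apply: ler_sum => j _; have := sqn_ge0 mu D (f i - f j).
    by rewrite sqnB// (ipC mu D (f j)); lra.
  rewrite big_split/= sumr_const card_ord -mulr_suml -/S -mulr_natl.
  by rewrite lerD2r le_eqVlt; apply/orP; left; apply/eqP; field.
rewrite big_split/= -mulr_sumr -/S sumr_const card_ord -mulr_natl.
by rewrite le_eqVlt; apply/orP; left; apply/eqP; field.
Qed.

End sqn_of_sums.

(** * Functions of bounded support and their translates *)

Section translations.
Context {R : realType} (n : nat).
Implicit Types (f g : 'rV[R]_n -> R) (omega E : set 'rV[R]_n) (i : 'I_n).

Local Notation mu := (@lebesgue_rV R n).
Local Notation e_ i := (delta_mx ord0 i : 'rV[R]_n).
Local Notation sqn f := (ip mu setT f f).

Lemma cube_bound (M : R) (x : 'rV[R]_n) i : cube n (- M) M x -> `|x ord0 i| <= M.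
Proof. by move=> /(_ i); rewrite /= in_itv/= -ler_norml. Qed.

Lemma bounded_supportP f : measurable_fun setT f ->
  (exists M1 M2, (forall x, `|f x| <= M1) /\ (forall x, f x != 0 -> forall i, `|x ord0 i| <= M2)) ->
  bounded_support f.
Proof.
move=> mf [M1 [M2 [H1 H2]]]; split=> //; exists (`|M1| + `|M2|); split=> x.
  by rewrite (le_trans (H1 x))// (le_trans (ler_norm _))// lerDl.
move=> fx i; rewrite /= in_itv/= -ler_norml (le_trans (H2 _ fx _))//.
by rewrite (le_trans (ler_norm _))// lerDr.
Qed.

Lemma bounded_supportZ (k : R) f : bounded_support f -> bounded_support (k *: f).
Proof.
move=> [mf [M [H1 H2]]]; apply: bounded_supportP; first exact: measurable_funM.
exists (`|k| * M), M; split=> x; first by rewrite normrM ler_wpM2l.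
by rewrite mulf_eq0 negb_or => /andP[_ /H2 xc] i; exact: cube_bound.
Qed.

Lemma bounded_supportD f g : bounded_support f -> bounded_support g ->
  bounded_support (f + g).
Proof.
move=> [mf [M [H1 H2]]] [mg [L [K1 K2]]].
apply: bounded_supportP; first exact: measurable_funD.
exists (M + L), (M + L); split=> x; first by rewrite (le_trans (ler_normD _ _))// lerD.
have M0 : 0 <= M by exact: le_trans (normr_ge0 _) (H1 x).
have L0 : 0 <= L by exact: le_trans (normr_ge0 _) (K1 x).
have [f0|/H2 xc] := eqVneq (f x) 0; last first.
  by move=> _ i; rewrite (le_trans (cube_bound i xc))// lerDl.
rewrite fctE f0 add0r => /K2 xc i.
by rewrite (le_trans (cube_bound i xc))// lerDr.
Qed.

Lemma bounded_supportB f g : bounded_support f -> bounded_support g ->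
  bounded_support (f - g).
Proof. by move=> bf bg; rewrite -scaleN1r; apply: bounded_supportD => //; exact: bounded_supportZ. Qed.

Lemma bounded_support_translate f (a : 'rV[R]_n) : bounded_support f ->
  bounded_support (fun x => f (x + a)).
Proof.
move=> [mf [M [H1 H2]]]; apply: bounded_supportP.
  exact: (measurableT_comp mf (measurable_translate a)).
exists M, (M + `|a|); split=> x; first exact: H1.
move=> /H2 xc i; have := cube_bound i xc; rewrite mxE => h.
have ai := coord_le_norm a i.
by rewrite -[x ord0 i](addrK (a ord0 i)) (le_trans (ler_normB _ _))// lerD.
Qed.

Lemma sqn_translate f (a : 'rV[R]_n) : measurable_fun setT f ->
  sqn (fun x => f (x + a)) = sqn f.
Proof.
move=> mf; rewrite /ip (Rintegral_translate a (f := fun x => f x * f x))//.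
exact: measurable_funM.
Qed.

Lemma bounded_convergence (F_ : nat -> 'rV[R]_n -> R) (F : 'rV[R]_n -> R) (B M : R) E :
  measurable E -> (forall m, measurable_fun setT (F_ m)) -> measurable_fun setT F ->
  (forall m x, `|F_ m x| <= B) -> (forall m x, F_ m x != 0 -> cube n (- M) M x) ->
  (forall x, F_ m x @[m --> \oo] --> F x) ->
  \int[mu]_(x in E) F_ m x @[m --> \oo] --> \int[mu]_(x in E) F x.
Proof.
move=> mE mF_ mF FB FM cF.
have B0 : 0 <= B by exact: le_trans (normr_ge0 _) (FB 0%N 0).
have bs : bounded_support (fun x => B * \1_(cube n (- M) M) x).
  apply: bounded_supportP.
    by apply: measurable_funM => //; apply: measurable_indic; exact: measurable_cube.
  exists B, M; split=> x.
    by rewrite normrM ger0_norm// ger0_norm// ler_piMr// indicE; case: (_ \in _).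
  rewrite indicE mulf_eq0 negb_or pnatr_eq0 eqb0 negbK => /andP[_ /set_mem xc] i.
  exact: cube_bound.
have ig : mu.-integrable E (EFin \o (fun x => B * \1_(cube n (- M) M) x)).
  exact: (integrableS measurableT mE (@subsetT _ _) (bounded_support_integrable bs)).
have dom m x : (`|(F_ m x)%:E| <= (B * \1_(cube n (- M) M) x)%:E)%E.
  rewrite lee_fin; have [->|/FM xc] := eqVneq (F_ m x) 0.
    by rewrite normr0 mulr_ge0.
  by rewrite indicE mem_set// mulr1.
have mF_E m : measurable_fun E (EFin \o F_ m).
  by apply/measurable_EFinP; exact: measurable_funS (mF_ m).
have mFE : measurable_fun E (EFin \o F).
  by apply/measurable_EFinP; exact: measurable_funS mF.
have aecv : {ae mu, forall x, E x -> (fun m => (F_ m x)%:E) @ \oo --> (F x)%:E}.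
  by apply: aeW => x _; apply: cvg_EFin; [exact: nearW|exact: cF].
pose G x := (B * \1_(cube n (- M) M) x)%:E.
have aedom : {ae mu, forall x m, E x -> (`|(EFin \o F_ m) x| <= G x)%E}.
  by apply: aeW => x m _; exact: dom.
have [iF _ cI] := dominated_convergence mE mF_E mFE aecv ig aedom.
apply: fine_cvg; rewrite fineK; first exact: cI.
exact: integrable_fin_num.
Qed.

Lemma increment_le f i (B : R) x (h : R) : smooth f -> (forall y, `|partial i f y| <= B) ->
  0 <= h -> `|f (x + h *: e_ i) - f x| <= B * h.
Proof.
move=> sf HB h0.
have D s : is_derive s (1 : R) (fun s : R => f (x + s *: e_ i)) (partial i f (x + s *: e_ i)).
  exact/line_derive/smooth_derivable.
have cl : {within `[0, h], continuous (fun s : R => f (x + s *: e_ i))}.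
  apply: continuous_subspaceT => s; apply: differentiable_continuous.
  by apply/derivable1_diffP; have [] := D s.
have [c _] := MVT_segment h0 (fun s _ => D s) cl.
rewrite scale0r addr0 subr0 => ->.
by rewrite normrM (ger0_norm h0) ler_wpM2r.
Qed.

Definition quotient f i (h : R) x := h^-1 * (f (x + h *: e_ i) - f x).

Lemma quotient_cvg omega f i (h : nat -> R) x : test_function omega f ->
  (forall m, 0 < h m) -> h m @[m --> \oo] --> 0 ->
  quotient f i (h m) x @[m --> \oo] --> partial i f x.
Proof.
move=> [sf _ _] h0 ch.
have := @line_derive R n f i x 0 (@smooth_derivable R n f i _ sf); rewrite scale0r addr0 => -[d D].
have H : (fun k : R => k^-1 *: (((fun s : R => f (x + s *: e_ i)) \o shift 0) (k *: (1 : R)) - f (x + 0 *: e_ i))) @ 0^' --> partial i f x.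
  by rewrite -D; exact: d.
have hc : h @ \oo `=>` 0^'.
  move=> A /= [e e0 HA]; have /cvgrPdist_lt/(_ _ e0) := ch.
  apply: filterS => m /= hm; apply: HA => //.
  by rewrite gt_eqF.
apply: cvg_trans (cvg_comp h _ hc H); apply: near_eq_cvg; apply: nearW => m /=.
by rewrite /quotient addr0 scale0r addr0 [_ *: 1]mulr1.
Qed.

End translations.

(** * Test functions *)

Section test_functions.
Context {R : realType} (n : nat).
Implicit Types (f g : 'rV[R]_n -> R) (omega E : set 'rV[R]_n) (i : 'I_n).

Local Notation mu := (@lebesgue_rV R n).
Local Notation e_ i := (delta_mx ord0 i : 'rV[R]_n).
Local Notation sqn f := (ip mu setT f f).

Lemma test_function_bs omega f : test_function omega f -> bounded_support f.
Proof. by move=> /test_function_ccontinuous[]. Qed.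

Lemma test_function_partial_bs omega f i : test_function omega f -> bounded_support (partial i f).
Proof. by move=> /test_function_ccontinuous[_]; exact. Qed.

Lemma test_function_sqint omega f : test_function omega f -> sqint mu setT f.
Proof. by move=> /test_function_bs/bounded_support_sqint. Qed.

Lemma test_function_partial_sqint omega f i : test_function omega f -> sqint mu setT (partial i f).
Proof. by move=> /test_function_partial_bs - /(_ i)/bounded_support_sqint. Qed.

Lemma test_function_of_support omega (K : set 'rV[R]_n) f : smooth f -> compact K ->
  K `<=` omega -> (forall x, f x != 0 -> K x) -> test_function omega f.
Proof.
move=> sf cK Ko fK.
have clK : closure [set x | f x != 0] `<=` K.
  rewrite (closure_id K).1; last exact: compact_closed.
  exact: closure_subset.
split=> //; last exact: subset_trans Ko.
by apply: (subclosed_compact _ cK) => //; exact: closed_closure.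
Qed.

Lemma test_functionD omega f g : test_function omega f -> test_function omega g ->
  test_function omega (f + g).
Proof.
move=> [sf cf fo] [sg cg go].
apply: (test_function_of_support (smoothD sf sg) (compactU cf cg)).
  by rewrite subUset.
move=> x; have [fx|fx] := eqVneq (f x) 0; last by move=> _; left; exact: subset_closure.
by rewrite fctE fx add0r => gx; right; exact: subset_closure.
Qed.

Lemma test_functionM omega f g : test_function omega f -> smooth g ->
  test_function omega (f * g).
Proof.
move=> [sf cf fo] sg; apply: (test_function_of_support (smoothM sf sg) cf) => // x.
by rewrite mulf_eq0 negb_or => /andP[fx _]; exact: subset_closure.
Qed.

Lemma test_functionZ omega (k : R) f : test_function omega f -> test_function omega (k *: f).
Proof.
move=> tf; rewrite (_ : k *: f = f * cst k); last first.
  by apply/funext => x; rewrite fctE mulrC.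
by apply: test_functionM => //; exact: smooth_cst.
Qed.

Lemma test_functionB omega f g : test_function omega f -> test_function omega g ->
  test_function omega (f - g).
Proof. by move=> tf tg; rewrite -scaleN1r; apply: test_functionD => //; exact: test_functionZ. Qed.

Lemma test_function_subset omega E f : omega `<=` E -> test_function omega f ->
  test_function E f.
Proof. by move=> oE [sf cf fo]; split=> //; exact: subset_trans oE. Qed.

Lemma test_function_partial omega f i : test_function omega f -> test_function omega (partial i f).
Proof.
move=> [sf cf fo]; apply: (test_function_of_support (smooth_partial i sf) cf) => // x.
apply: contraNP => Kx; apply/eqP.
rewrite /partial (near_eq_derive (g := cst 0)) ?derive_cst//.
have : nbhs x (~` closure [set x | f x != 0]).
  by apply: open_nbhs_nbhs; split => //; exact/closed_openC/closed_closure.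
apply: filterS => y Ky /=; apply/eqP; apply: contrapT => /negP fy; apply: Ky.
exact: subset_closure.
Qed.

Lemma test_function_eq0 omega f x : test_function omega f -> ~ omega x -> f x = 0.
Proof.
move=> [_ _ fo] ox; apply/eqP; apply: contrapT => /negP fx; apply: ox.
by apply: fo; exact: subset_closure.
Qed.

Lemma smooth_measurable f : smooth f -> measurable_fun setT f.
Proof. by move=> /smooth_continuous; exact: continuous_measurable_rV. Qed.

Lemma measurable_quotient f i h : smooth f -> measurable_fun setT (quotient f i h).
Proof.
move=> /smooth_measurable mf; apply: measurable_funM => //; apply: measurable_funB => //.
exact: (measurableT_comp mf (measurable_translate (h *: e_ i))).
Qed.

Lemma quotient_bounds omega f i : test_function omega f -> exists B M : R,
  [/\ 0 <= B, forall h x, 0 < h -> `|quotient f i h x| <= B &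
   forall h x, 0 < h -> h <= 1 -> quotient f i h x != 0 -> cube n (- M) M x].
Proof.
move=> tf; have [sf _ _] := tf.
have [_ [B [HB _]]] := test_function_partial_bs i tf.
have [_ [M [fM fc]]] := test_function_bs tf.
exists B, (M + 1); split.
- exact: le_trans (normr_ge0 _) (HB 0).
- move=> h x h0; rewrite /quotient normrM gtr0_norm ?invr_gt0// ler_pdivrMl// mulrC.
  by apply: increment_le => //; exact: ltW.
- move=> h x h0 h1 q0 j; rewrite /= in_itv/= -ler_norml.
  have [fx|/fc/(cube_bound j)] := eqVneq (f x) 0; last by move=> xj; rewrite (le_trans xj)// lerDl.
  have /fc/(cube_bound j) : f (x + h *: e_ i) != 0.
    by apply: contraNneq q0 => fxh; rewrite /quotient fx fxh subrr mulr0.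
  rewrite !mxE eqxx/= => H.
  rewrite -[x ord0 j](addrK (h * (j == i)%:R)) (le_trans (ler_normB _ _))// lerD//.
  by rewrite normrM gtr0_norm//; case: eqP => _; rewrite ?normr1 ?normr0 ?mulr1 ?mulr0.
Qed.

Lemma invn_cvg0 (t : R) : t / m.+1%:R @[m --> \oo] --> (0 : R).
Proof.
rewrite -[X in _ --> X](mulr0 t); apply: cvgM; first exact: cvg_cst.
exact: cvg_harmonic.
Qed.

(** Difference quotients have zero integral by translation invariance, and converge to the
    derivative boundedly with a common support. This stands in for Fubini and the fundamental
    theorem of calculus. *)
Lemma integral_partial_eq0 omega f i : test_function omega f ->
  \int[mu]_x partial i f x = 0.
Proof.
move=> tf; have [sf _ _] := tf.
have [B [M [B0 qB qM]]] := quotient_bounds i tf.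
pose h m : R := 1 / m.+1%:R.
have h0 m : 0 < h m by rewrite divr_gt0.
have h1 m : h m <= 1 by rewrite ler_pdivrMr// mul1r ler1n.
have cI : \int[mu]_x quotient f i (h m) x @[m --> \oo] --> \int[mu]_x partial i f x.
  apply: (@bounded_convergence R n (fun m => quotient f i (h m)) (partial i f) B M) => //.
  - by move=> m; exact: measurable_quotient.
  - apply: smooth_measurable; exact: smooth_partial.
  - by move=> m x; exact: qB.
  - by move=> m x; exact: qM.
  - by move=> x; apply: (quotient_cvg tf) => //; exact: invn_cvg0.
rewrite -(cvg_lim _ cI)//.
rewrite (_ : (fun m => _) = cst 0); first exact: lim_cst.
apply/funext => m; have bf := test_function_bs tf.
have bft := bounded_support_translate (h m *: e_ i) bf.
rewrite RintegralZl//; last first.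
  exact: (bounded_support_integrable (bounded_supportB bft bf)).
rewrite RintegralB//; try exact: bounded_support_integrable.
by rewrite Rintegral_translate ?subrr ?mulr0//; exact: smooth_measurable.
Qed.

Lemma test_integration_by_parts omega f g i : test_function omega f -> smooth g ->
  ip mu setT f (partial i g) = - ip mu setT (partial i f) g.
Proof.
move=> tf sg; have [sf _ _] := tf.
have := integral_partial_eq0 i (test_functionM tf sg).
rewrite partialM//.
have b1 : bounded_support (f * partial i g).
  exact: test_function_bs (test_functionM tf (smooth_partial i sg)).
have b2 : bounded_support (partial i f * g).
  exact: test_function_bs (test_functionM (test_function_partial i tf) sg).
rewrite (_ : g * partial i f = partial i f * g); last by apply/funext => x; rewrite fctE mulrC.
rewrite RintegralD//; try exact: bounded_support_integrable.
by move/eqP; rewrite addr_eq0 => /eqP.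
Qed.

Definition increment f (a : 'rV[R]_n) x := f (x + a) - f x.

Lemma increment_bs f a : bounded_support f -> bounded_support (increment f a).
Proof. by move=> bf; apply: bounded_supportB => //; exact: bounded_support_translate. Qed.

(* The increment over [t e_i] is split into [m] equal pieces: convexity of the
   square and translation invariance bound it by the squared norm of a
   difference quotient, and [m] tends to infinity. *)
Lemma sqn_increment_le omega f i (t : R) E E' : test_function omega f -> 0 < t ->
  measurable E -> measurable E' ->
  (forall x s, E x -> 0 <= s <= t -> E' (x + s *: e_ i)) ->
  ip mu E (increment f (t *: e_ i)) (increment f (t *: e_ i)) <=
  t ^+ 2 * ip mu E' (partial i f) (partial i f).
Proof.
move=> tf t0 mE mE' EE'; have [sf _ _] := tf; have bf := test_function_bs tf.
have [B [M [B0 qB qM]]] := quotient_bounds i tf.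
have [N HN] : exists N : nat, forall m, (N <= m)%N -> t / m.+1%:R <= 1.
  exists (Num.bound t) => m Nm; rewrite ler_pdivrMr// mul1r.
  rewrite (le_trans (ltW (archi_boundP (ltW t0))))// ler_nat.
  by rewrite (leq_trans Nm).
pose h m : R := t / (m + N).+1%:R.
have h0 m : 0 < h m by rewrite divr_gt0.
have h1 m : h m <= 1 by apply: HN; rewrite leq_addl.
have ch : h m @[m --> \oo] --> (0 : R).
  by have := invn_cvg0 t; rewrite -(cvg_shiftn N).
have cI : \int[mu]_(x in E') (quotient f i (h m) x * quotient f i (h m) x) @[m --> \oo] -->
    ip mu E' (partial i f) (partial i f).
  apply: (@bounded_convergence R n (fun m => quotient f i (h m) * quotient f i (h m)) (partial i f * partial i f) (B * B) M) => //.
  - by move=> m; apply: measurable_funM; exact: measurable_quotient.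
  - by apply: measurable_funM; apply: smooth_measurable; exact: smooth_partial.
  - by move=> m x; rewrite normrM ler_pM// qB.
  - by move=> m x; rewrite mulf_eq0 negb_or => /andP[_]; exact: qM.
  - by move=> x; apply: cvgM; apply: (quotient_cvg tf) => //.
have cI2 : t ^+ 2 * \int[mu]_(x in E') (quotient f i (h m) x * quotient f i (h m) x) @[m --> \oo] -->
    t ^+ 2 * ip mu E' (partial i f) (partial i f).
  by apply: cvgM => //; exact: cvg_cst.
rewrite -(cvg_lim _ cI2)//; apply: limr_ge; first by apply/cvg_ex; eexists; exact: cI2.
apply: nearW => m.
pose p := (m + N).+1.
pose g := increment f (h m *: e_ i).
have bg : bounded_support g by exact: increment_bs.
have sg := bounded_support_sqint bg.
have pE : t = p%:R * h m by rewrite /h mulrC divfK.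
have tele x : increment f (t *: e_ i) x = \sum_(j < p) g (x + (j%:R * h m) *: e_ i).
  rewrite pE; elim: (p) => [|q IH]; first by rewrite big_ord0 /increment mul0r scale0r addr0 subrr.
  rewrite big_ord_recr/= -IH /g /increment -[q.+1%:R]natr1.
  have -> : x + ((q%:R + 1) * h m) *: e_ i = x + (q%:R * h m) *: e_ i + h m *: e_ i.
    by rewrite -addrA -scalerDl mulrDl mul1r.
  ring.
have bgj (j : nat) := bounded_support_translate ((j%:R * h m) *: e_ i) bg.
(* The j-th piece starts at distance [j%:R * h m] <= t from a point of [E], hence inside [E'];
   translating it back compares it with the single increment [g]. *)
have piece (j : 'I_p) : ip mu E (fun x => g (x + (j%:R * h m) *: e_ i)) (fun x => g (x + (j%:R * h m) *: e_ i))
    <= ip mu E' g g.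
  pose b := (j%:R * h m) *: e_ i.
  rewrite /ip Rintegral_mkcond [leRHS]Rintegral_mkcond.
  have mgg : measurable_fun setT (fun x => g x * g x) by apply: measurable_funM; case: bg.
  rewrite -[leRHS](Rintegral_translate b); last first.
    by apply/(measurable_restrictT _ mE'); exact: measurable_funS mgg.
  have igg : mu.-integrable setT (EFin \o (fun x => g x * g x)).
    exact: (bounded_support_integrable (bounded_support_mul bg bg)).
  have igt : mu.-integrable setT (EFin \o (fun x => g (x + b) * g (x + b))).
    exact: (bounded_support_integrable (bounded_support_mul (bgj j) (bgj j))).
  apply: le_Rintegral => //.
  - rewrite -restrict_EFin; apply/(integrable_mkcond _ mE).
    exact: (integrableS measurableT mE (@subsetT _ _) igt).
  - apply: (@le_integrable _ _ _ mu setT _ _ (EFin \o (fun x => g (x + b) * g (x + b)))) => //.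
      apply/measurable_EFinP.
      apply: (measurableT_comp (f := (fun x => g x * g x) \_ E') _ (measurable_translate b)).
      by apply/(measurable_restrictT _ mE'); exact: measurable_funS mgg.
    move=> x _; rewrite /= patchE; case: ifP => _//.
    by rewrite normr0 lee_fin.
  - move=> x _; rewrite !patchE; case: ifPn => xE; last first.
      by case: ifP => // _; rewrite -expr2 sqr_ge0.
    rewrite ifT//; apply/mem_set; apply: EE'; first exact/set_mem.
    apply/andP; split; first by apply: mulr_ge0 => //; exact: ltW.
    by rewrite pE; apply: ler_wpM2r; [exact: ltW|rewrite ler_nat ltnW].
have siE : sqint mu E (increment f (t *: e_ i)).
  exact: (sqint_subset mE measurableT (@subsetT _ _) (bounded_support_sqint (increment_bs _ bf))).
have sgE (j : nat) : sqint mu E (fun x => g (x + (j%:R * h m) *: e_ i)).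
  exact: (sqint_subset mE measurableT (@subsetT _ _) (bounded_support_sqint (bgj j))).
apply: (@le_trans _ _ (p%:R * \sum_(j < p) ip mu E (fun x => g (x + (j%:R * h m) *: e_ i)) (fun x => g (x + (j%:R * h m) *: e_ i)))).
  rewrite (_ : increment f (t *: e_ i) = \sum_(j < p) (fun x => g (x + (j%:R * h m) *: e_ i))).
    exact: sqn_sum_le.
  apply/funext => x; rewrite tele; elim/big_ind2 : _ => // u1 v1 u2 v2 -> ->//.
apply: (@le_trans _ _ (p%:R * \sum_(j < p) ip mu E' g g)).
  by rewrite ler_wpM2l//; apply: ler_sum => j _; exact: piece.
rewrite sumr_const card_ord -(mulr_natl (ip mu E' g g)) mulrA.
rewrite (_ : ip mu E' g g = h m ^+ 2 * \int[mu]_(x in E') (quotient f i (h m) x * quotient f i (h m) x)).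
  have tE : t ^+ 2 = p%:R * p%:R * h m ^+ 2 by rewrite pE exprMn -expr2.
  by rewrite mulrA tE.
have sgE' : sqint mu E' g := sqint_subset mE' measurableT (@subsetT _ _) sg.
rewrite (_ : quotient f i (h m) = (h m)^-1 *: g); last by apply/funext.
rewrite -/(ip mu E' ((h m)^-1 *: g) ((h m)^-1 *: g)) sqnZ//.
by rewrite mulrA -exprMn divff ?expr1n ?mul1r// gt_eqF.
Qed.

End test_functions.

(** * The Poincare inequality and compactness *)

Section poincare.
Context {R : realType} (n : nat).
Implicit Types (f g : 'rV[R]_n -> R) (omega E : set 'rV[R]_n) (i : 'I_n).

Local Notation mu := (@lebesgue_rV R n).
Local Notation e_ i := (delta_mx ord0 i : 'rV[R]_n).
Local Notation sqn f := (ip mu setT f f).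

Lemma measurable_translate_preimage (a : 'rV[R]_n) E : measurable E ->
  measurable [set x | E (x + a)].
Proof.
move=> mE; rewrite -[X in measurable X]setTI.
exact: (measurable_translate a measurableT mE).
Qed.

Lemma ip_translate f (a : 'rV[R]_n) E : measurable E -> measurable_fun setT f ->
  ip mu [set x | E (x + a)] (fun x => f (x + a)) (fun x => f (x + a)) = ip mu E f f.
Proof.
move=> mE mf; rewrite /ip Rintegral_mkcond [RHS]Rintegral_mkcond.
rewrite -[RHS](Rintegral_translate a).
  apply: eq_Rintegral => x _; rewrite !patchE.
  by congr (if _ then _ else _); apply/idP/idP => /set_mem H; exact/mem_set.
apply/(measurable_restrictT _ mE); apply: measurable_funS measurableT _ _ => //.
exact: measurable_funM.
Qed.

Lemma sqn_increment_sign_le omega f i (b : bool) (t : R) E E' :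
  test_function omega f -> 0 < t -> measurable E -> measurable E' ->
  (forall x s, E x -> 0 <= s <= t -> E' (x + ((-1) ^+ b * s) *: e_ i)) ->
  ip mu E (increment f (((-1) ^+ b * t) *: e_ i)) (increment f (((-1) ^+ b * t) *: e_ i)) <=
  t ^+ 2 * ip mu E' (partial i f) (partial i f).
Proof.
case: b => tf t0 mE mE' H; last first.
  rewrite expr0 mul1r; apply: (sqn_increment_le tf) => // x s Ex st.
  by have := H x s Ex st; rewrite expr0 mul1r.
rewrite expr1 mulN1r; pose a := t *: e_ i.
have bg := increment_bs ((- t) *: e_ i) (test_function_bs tf).
(* A backward increment at the end point of a segment is minus the forward increment at its starting
   point. *)
rewrite -(@ip_translate (increment f ((- t) *: e_ i)) a E mE); last by case: bg.
rewrite (_ : ip _ _ _ _ = ip mu [set x | E (x + a)] (increment f a) (increment f a)).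
  apply: (sqn_increment_le tf) => //; first exact: measurable_translate_preimage.
  move=> x s Ex /andP[s0 st].
  have := H (x + a) (t - s) Ex; rewrite subr_ge0 st lerBlDr lerDl s0 => /(_ isT).
  by rewrite expr1 mulN1r opprB /a -addrA -scalerDl addrCA subrr addr0.
apply: eq_Rintegral => x _; rewrite /increment scaleNr addrK; ring.
Qed.

(** A translation by [2 * M + 1] moves the support off itself, so the increment has squared norm
    exactly [2 * sqn f], and the increment estimate applies. *)
Lemma poincare omega f i (M : R) : 0 < M -> omega `<=` cube n (- M) M ->
  test_function omega f ->
  2 * sqn f <= (2 * M + 1) ^+ 2 * sqn (partial i f).
Proof.
move=> M0 oM tf; have bf := test_function_bs tf; have sf := bounded_support_sqint bf.
have t0 : 0 < 2 * M + 1 by rewrite addr_gt0// mulr_gt0.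
have := @sqn_increment_le _ n omega f i (2 * M + 1) setT setT tf t0 measurableT measurableT.
move=> /(_ (fun _ _ _ _ => I)); apply: le_trans.
set a := (2 * M + 1) *: e_ i.
have sfa := bounded_support_sqint (bounded_support_translate a bf).
rewrite (_ : increment f a = (fun x => f (x + a)) - f); last by apply/funext.
rewrite sqnB// sqn_translate; last by case: bf.
rewrite (_ : ip _ _ (fun x : 'rV[R]_n => f (x + a)) f = 0); first lra.
have fa (x : 'rV[R]_n) : f (x + a) * f x = 0.
  have [->|fx] := eqVneq (f x) 0; first by rewrite mulr0.
  have [->|fxa] := eqVneq (f (x + a)) 0; first by rewrite mul0r.
  have inc (y : 'rV[R]_n) : f y != 0 -> `|y ord0 i| <= M.
    move=> fy; apply: cube_bound; apply: oM; apply: contrapT => oy.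
    by move/eqP : fy; apply; exact: test_function_eq0 tf oy.
  have := inc _ fx; have := inc _ fxa; rewrite /a !mxE !eqxx/= mulr1.
  by rewrite !ler_norml => /andP[_ h1] /andP[h2 _]; exfalso; lra.
rewrite /ip (@eq_Rintegral _ _ _ mu setT (cst 0)).
  by rewrite Rintegral_cst// mul0r.
by move=> x _; exact: fa.
Qed.

Lemma sum_fctE (m : nat) (F : 'I_m -> 'rV[R]_n -> R) x : (\sum_j F j) x = \sum_j F j x.
Proof. by elim/big_ind2 : _ => // u1 v1 u2 v2 <- <-. Qed.

(** The displacement is performed one coordinate at a time; [p j] below consists of the first j
    coordinates of [a]. *)
Lemma sqn_increment_vector_le omega f (a : 'rV[R]_n) (t : R) : test_function omega f ->
  0 < t -> (forall i, `|a ord0 i| <= t) ->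
  sqn (increment f a) <= n%:R * t ^+ 2 * \sum_i sqn (partial i f).
Proof.
move=> tf t0 at_; have bf := test_function_bs tf.
pose p (j : nat) : 'rV[R]_n := \row_i (if (i < j)%N then a ord0 i else 0).
have -> : increment f a = \sum_(j < n) (fun x => increment f (a ord0 j *: e_ j) (x + p j)).
  apply/funext => x; rewrite sum_fctE.
  transitivity (\sum_(0 <= j < n) (f (x + p j.+1) - f (x + p j))).
    rewrite telescope_sumr// /increment; congr (f _ - f _).
      by congr (_ + _); apply/rowP => i; rewrite mxE ltn_ord.
    by rewrite -[LHS]addr0; congr (_ + _); apply/rowP => i; rewrite !mxE.
  rewrite big_mkord; apply: eq_bigr => j _; rewrite /increment; congr (f _ - _).
  rewrite -addrA; congr (_ + _); apply/rowP => i; rewrite !mxE eqxx/= ltnS leq_eqVlt.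
  case: eqP => [/val_inj ->|/eqP ij]; first by rewrite ltnn eqxx mulr1 add0r.
  by rewrite (_ : (i == j) = false) ?mulr0 ?addr0//; apply/negbTE.
have binc (b : 'rV[R]_n) := increment_bs b bf.
apply: le_trans (sqn_sum_le measurableT _) _.
  by move=> j; apply: bounded_support_sqint; exact: bounded_support_translate.
rewrite -mulrA ler_wpM2l// mulr_sumr; apply: ler_sum => j _.
rewrite sqn_translate; last by case: (binc (a ord0 j *: e_ j)).
have [a0|a0] := eqVneq (a ord0 j) 0.
  rewrite (_ : increment _ _ = 0).
    by rewrite sqn0// mulr_ge0 ?sqr_ge0 ?sqn_ge0.
  by apply/funext => x; rewrite /increment a0 scale0r addr0 subrr.
apply: (@le_trans _ _ (`|a ord0 j| ^+ 2 * sqn (partial j f))); last first.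
  by rewrite ler_wpM2r ?sqn_ge0// lerXn2r// nnegrE ltW.
have := @sqn_increment_sign_le omega f j (a ord0 j < 0)%R `|a ord0 j| setT setT tf.
rewrite normr_gt0 a0 => /(_ isT measurableT measurableT (fun _ _ _ _ => I)).
by rewrite -realEsign// num_real.
Qed.

End poincare.

(** * Oscillation on cells and Rellich compactness *)

Section oscillation.
Context d (T : measurableType d) (R : realType) (mu : {measure set T -> \bar R}).
Variables (D : set T) (mD : measurable D) (V : R).
Hypothesis DV : (mu D = V%:E)%E.

Lemma sqint_cst (c : R) : sqint mu D (cst c).
Proof.
split; first exact: measurable_cst.
rewrite (eq_integral (cst (c ^+ 2)%:E)) ?integral_cst// ?DV ?ltry//.
Qed.

(** Expanding |h(y) - h(x)|^2 and integrating in both variables. The identity recovers the norm of h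
    from its mean and its increments. *)
Lemma sqn_oscillation (h : T -> R) : sqint mu D h ->
  mu.-integrable D (EFin \o (fun x => ip mu D (h - cst (h x)) (h - cst (h x)))) /\
  \int[mu]_(x in D) ip mu D (h - cst (h x)) (h - cst (h x)) =
    2 * V * ip mu D h h - 2 * (\int[mu]_(x in D) h x) ^+ 2.
Proof.
move=> sh; set J := ip mu D h h; set I := \int[mu]_(x in D) h x.
have s1 := sqint_cst 1.
have ih : mu.-integrable D (EFin \o h).
  have := sqint_prod_integrable mD sh s1.
  by apply: eq_integrable => // x _ /=; rewrite mulr1.
have ih2 : mu.-integrable D (EFin \o (fun x => h x ^+ 2)) := sqint_integrable_sqr sh.
have ic (c : R) : mu.-integrable D (EFin \o cst c).
  have := sqint_prod_integrable mD (sqint_cst c) s1.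
  by apply: eq_integrable => // x _ /=; rewrite mulr1.
have E x : ip mu D (h - cst (h x)) (h - cst (h x)) = (J + (-2 * I) * h x) + V * h x ^+ 2.
  rewrite sqnB//; last exact: sqint_cst.
  rewrite (_ : ip mu D h (cst (h x)) = I * h x); last by rewrite -RintegralZr.
  rewrite (_ : ip mu D (cst _) (cst _) = V * h x ^+ 2); last first.
    rewrite /ip (@eq_Rintegral _ _ _ mu D (cst (h x ^+ 2))); last by move=> y _; rewrite expr2.
    by rewrite Rintegral_cst// DV mulrC.
  by rewrite -/J; ring.
have i1 : mu.-integrable D (EFin \o (fun x => (-2 * I) * h x)) by exact: (integrableZl mD (-2 * I) ih).
have i2 : mu.-integrable D (EFin \o (fun x => V * h x ^+ 2)) by exact: (integrableZl mD V ih2).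
have i12 : mu.-integrable D (EFin \o (fun x => J + (-2 * I) * h x)).
  by have := integrableD mD (ic J) i1; apply: eq_integrable => // x _ /=; rewrite EFinD.
have -> : (fun x => ip mu D (h - cst (h x)) (h - cst (h x))) = (fun x => (J + (-2 * I) * h x) + V * h x ^+ 2).
  by apply/funext.
split.
  by have := integrableD mD i12 i2; apply: eq_integrable => // x _ /=; rewrite -EFinD.
rewrite RintegralD// RintegralD//; last exact: ic.
rewrite RintegralZl// RintegralZl// -/I Rintegral_cst// DV/=.
rewrite (_ : \int[mu]_(x in D) h x ^+ 2 = J)//; ring.
Qed.

End oscillation.

Section rellich.
Context {R : realType} (n : nat).
Implicit Types (f g h : 'rV[R]_n -> R) (omega E : set 'rV[R]_n) (i : 'I_n).

Local Notation mu := (@lebesgue_rV R n).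
Local Notation sqn f := (ip mu setT f f).
Local Notation dirichlet f := (\sum_i sqn (partial i f)).

(** Half-open intervals make the cells pairwise disjoint while they still cover the cube. *)
Definition cell (delta M : R) (L : nat) (z : {ffun 'I_n -> 'I_L}) : set 'rV[R]_n :=
  box (fun i => `[delta * (z i)%:R - M, delta * (z i).+1%:R - M[%classic).

Lemma measurable_cell delta M L z : measurable (@cell delta M L z).
Proof. by apply: measurable_box => i; exact: measurable_itv. Qed.

Lemma lebesgue_cell delta M L z : 0 < delta -> mu (@cell delta M L z) = ((delta ^+ n)%:E)%E.
Proof.
move=> d0; rewrite lebesgue_box; last by move=> i; exact: measurable_itv.
rewrite (eq_bigr (fun=> delta%:E)); first by rewrite prodEFin prodr_const card_ord.
move=> i _; rewrite lebesgue_measure_itv/= lte_fin -natr1 mulrDr mulr1 ltrD2r ltrDl d0.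
by rewrite -EFinB; congr EFin; ring.
Qed.

Lemma cell_index delta M L z x i : 0 < delta -> @cell delta M L z x ->
  (z i : nat) = Num.truncn ((x ord0 i + M) / delta).
Proof.
move=> d0 /(_ i); rewrite /= in_itv/= lerBlDr ltrBrDr => /andP[x1 x2].
apply/esym/eqP; rewrite truncn_eq; last first.
  by rewrite divr_ge0 ?(ltW d0)// (le_trans _ x1)// mulr_ge0// ltW.
by rewrite ler_pdivlMr// ltr_pdivrMr// ![_%:R * delta]mulrC x1 x2.
Qed.

Lemma cells_cover delta M L x : 0 < delta -> 2 * M / delta < L%:R ->
  cube n (- M) M x -> exists z, @cell delta M L z x.
Proof.
move=> d0 LM xM.
have tr i : let q := (x ord0 i + M) / delta in
    (Num.truncn q < L)%N /\ ((Num.truncn q)%:R <= q < (Num.truncn q).+1%:R).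
  have := cube_bound i xM; rewrite ler_norml => /andP[x1 x2] q.
  have q0 : 0 <= q by rewrite divr_ge0// ?(ltW d0)//; lra.
  have := truncn_itv q0 => /[dup] ? /andP[q1 _]; split=> //.
  rewrite -(@ltr_nat R); apply: le_lt_trans q1 _; apply: le_lt_trans LM.
  by rewrite ler_pM2r ?invr_gt0//; lra.
exists [ffun i => Ordinal (tr i).1] => i /=; have [_] := tr i.
rewrite in_itv/= ffunE/= ler_pdivlMr// ltr_pdivrMr// => /andP[x1 x2].
by rewrite lerBlDr ltrBrDr ![delta * _]mulrC x1 x2.
Qed.

Lemma increment_measurable2 f : measurable_fun setT f ->
  measurable_fun setT (fun p : 'rV[R]_n * 'rV[R]_n => ((increment f p.2 p.1) ^+ 2)%:E).
Proof.
move=> mf; apply/measurable_EFinP; apply: measurable_funX.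
apply: measurable_funB; last exact: measurableT_comp mf measurable_fst.
apply: (measurableT_comp mf); apply: measurable_fun_rV => i.
under eq_fun do rewrite mxE.
apply: measurable_funD.
  exact: measurableT_comp (measurable_coord i) measurable_fst.
exact: measurableT_comp (measurable_coord i) measurable_snd.
Qed.

(** Two points of the same cell differ by a vector of the cube of half-width [delta]. By Tonelli the
    sum is at most the integral of the squared norms of the increments over that cube, which has
    volume (2 delta)^n. *)
Lemma cells_oscillation omega h (delta M : R) L : test_function omega h -> 0 < delta ->
  (\sum_(z : {ffun 'I_n -> 'I_L})
     \int[mu]_(x in cell delta M z) ip mu (cell delta M z) (h - cst (h x)) (h - cst (h x)))
  <= (2 * delta) ^+ n * (n%:R * delta ^+ 2 * dirichlet h).
Proof.
move=> th d0; have bh := test_function_bs th; have mh := bh.1.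
have mC z := @measurable_cell delta M L z.
have sh z := sqint_subset (mC z) measurableT (@subsetT _ _) (bounded_support_sqint bh).
pose G x := (\int[mu]_(a in cube n (- delta) delta) ((increment h a x) ^+ 2)%:E)%E.
have mcube := @measurable_cube R n (- delta) delta.
pose H (p : 'rV[R]_n * 'rV[R]_n) := (((increment h p.2 p.1) ^+ 2)%:E * (\1_(cube n (- delta) delta) p.2)%:E)%E.
have mH : measurable_fun setT H.
  apply: emeasurable_funM; first exact: increment_measurable2.
  apply/measurable_EFinP; apply: measurableT_comp measurable_snd.
  exact: measurable_indic.
have H0 p : (0 <= H p)%E by rewrite mule_ge0// lee_fin ?sqr_ge0.
have GE x : G x = (\int[mu]_a H (x, a))%E.
  rewrite /G integral_mkcond; apply: eq_integral => a _; rewrite patchE /H indicE.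
  by case: ifPn => ac; rewrite ?mule1 ?mule0.
have mG : measurable_fun setT G.
  rewrite (_ : G = fun x => (\int[mu]_a H (x, a))%E); last exact/funext.
  exact: measurable_fun_fubini_tonelli_F.
have G0 x : (0 <= G x)%E by rewrite GE; apply: integral_ge0.
have intG : (\int[mu]_x G x <= ((2 * delta) ^+ n * (n%:R * delta ^+ 2 * dirichlet h))%:E)%E.
  under eq_integral do rewrite GE.
  rewrite (@fubini_tonelli _ _ _ _ _ mu mu H mH H0).
  apply: (@le_trans _ _ (\int[mu]_a ((n%:R * delta ^+ 2 * dirichlet h)%:E * (\1_(cube n (- delta) delta) a)%:E)%E)%E).
    apply: ge0_le_integral => //.
    - by move=> a _; apply: integral_ge0.
    - exact: measurable_fun_fubini_tonelli_G.
    - apply: emeasurable_funM => //.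
      by apply/measurable_EFinP; exact: measurable_indic.
    - move=> a _; rewrite /H/= indicE; have [/set_mem ac|_] := boolP (a \in cube n (- delta) delta).
        under eq_integral do rewrite mule1.
        rewrite mule1 sqnE//; last exact: bounded_support_sqint (increment_bs a bh).
        by rewrite lee_fin; apply: (sqn_increment_vector_le th) => // i; exact: cube_bound.
      by under eq_integral do rewrite mule0; rewrite integral0 mule0.
  rewrite integralZl//; last first.
    apply/integrableP; split; first by apply/measurable_EFinP; exact: measurable_indic.
    rewrite (eq_integral (fun x => (\1_(cube n (- delta) delta) x)%:E)).
      by rewrite integral_indic// setIT; exact: cube_fin_measure.
    by move=> x _; rewrite gee0_abs// lee_fin.
  rewrite integral_indic// setIT -[X in (_ * X)%E]/(mu (cube n (- delta) delta)).
  rewrite lebesgue_box_itv; last by rewrite (@le_trans _ _ 0)// ?oppr_le0 ltW.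
  by rewrite -EFinM lee_fin mulrC opprK -mulr2n -[delta *+ 2]mulr_natl.
rewrite -lee_fin -sumEFin; apply: le_trans intG.
have oscE (z : {ffun 'I_n -> 'I_L}) : ((\int[mu]_(x in cell delta M z) ip mu (cell delta M z) (h - cst (h x)) (h - cst (h x)))%:E =
    \int[mu]_(x in cell delta M z) (ip mu (cell delta M z) (h - cst (h x)) (h - cst (h x)))%:E)%E.
  rewrite /Rintegral fineK//; apply: integrable_fin_num => //.
  exact: (sqn_oscillation (mC z) (lebesgue_cell M z d0) (sh z)).1.
(* The substitution y = x + a turns the integral over the cell into one over displacements a; [G x]
   extends it to the whole cube, independently of z. *)
have oscG (z : {ffun 'I_n -> 'I_L}) x : cell delta M z x ->
    ((ip mu (cell delta M z) (h - cst (h x)) (h - cst (h x)))%:E <= G x)%E.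
  move=> zx.
  have sz : sqint mu (cell delta M z) (h - cst (h x)).
    by apply: sqintB => //; exact: sqint_cst (lebesgue_cell M z d0) _.
  rewrite -sqnE// integral_mkcond -(ge0_integral_translate x).
  - rewrite /G [leRHS]integral_mkcond; apply: ge0_le_integral => //.
    + by move=> a _; rewrite erestrict_ge0// => y _; rewrite lee_fin sqr_ge0.
    + apply: (measurableT_comp (f := (fun y => ((h - cst (h x)) y ^+ 2)%:E) \_ (cell delta M z)) _ (measurable_translate x)).
      apply/(measurable_restrictT _ (mC z)).
      by apply/measurable_EFinP; apply: measurable_funX; case: sz.
    + apply/(measurable_restrictT _ mcube); apply/measurable_EFinP; apply: measurable_funX.
      apply: measurable_funB => //.
      rewrite (_ : (fun a => h (x + a)) = h \o translate x); last by apply/funext => a /=; rewrite addrC.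
      by apply: measurable_funS (measurableT_comp mh (measurable_translate x)).
    + move=> a _; rewrite !patchE; case: ifPn => [/set_mem axz|_]; last first.
        by case: ifP => // _; rewrite lee_fin sqr_ge0.
      rewrite ifT; first by rewrite lee_fin /increment (addrC x).
      apply/mem_set => i /=; rewrite in_itv/=.
      have := zx i; have := axz i; rewrite /= !in_itv/= mxE -[(z i).+1%:R]natr1 mulrDr mulr1.
      by move=> /andP[a1 a2] /andP[x1 x2]; apply/andP; split; lra.
  - apply/(measurable_restrictT _ (mC z)).
    by apply/measurable_EFinP; apply: measurable_funX; case: sz.
  - by move=> y; rewrite erestrict_ge0// => y' _; rewrite lee_fin sqr_ge0.
apply: (@le_trans _ _ (\sum_(z : {ffun 'I_n -> 'I_L}) \int[mu]_(x in cell delta M z) G x)%E).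
  apply: lee_sum => z _; rewrite oscE; apply: ge0_le_integral => //.
  - by move=> x _; rewrite lee_fin sqn_ge0.
  - by have [/integrableP[]] := sqn_oscillation (mC z) (lebesgue_cell M z d0) (sh z).
  - exact: measurable_funS mG.
  - by move=> x; exact: oscG.
rewrite -ge0_integral_bigsetU//=.
- apply: ge0_subset_integral => //.
  by apply: bigsetU_measurable.
- exact: index_enum_uniq.
- move=> z w _ _ [x [zx wx]]; apply/ffunP => i; apply/val_inj => /=.
  by rewrite (cell_index _ d0 zx) (cell_index _ d0 wx).
- exact: measurable_funS mG.
Qed.

(** The norm is controlled by finitely many linear functionals up to an error of order [delta ^+ 2]
    times the energy; this is the quantitative core of Rellich's theorem. *)
Lemma sqn_le_cells omega h (delta M : R) L : test_function omega h ->
  omega `<=` cube n (- M) M -> 0 < delta -> 2 * M / delta < L%:R ->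
  sqn h <= delta ^- n * (\sum_(z : {ffun 'I_n -> 'I_L}) (\int[mu]_(x in cell delta M z) h x) ^+ 2)
     + 2 ^+ n * n%:R * delta ^+ 2 * dirichlet h.
Proof.
move=> th oM d0 LM; have bh := test_function_bs th; have sh := bounded_support_sqint bh.
have mC z := @measurable_cell delta M L z.
have shz z := sqint_subset (mC z) measurableT (@subsetT _ _) sh.
have V0 : 0 < delta ^+ n by rewrite exprn_gt0.
have cov : sqn h <= \sum_(z : {ffun 'I_n -> 'I_L}) ip mu (cell delta M z) h h.
  rewrite -(@ip_supported _ _ _ mu (cube n (- M) M)); last first.
    move=> x xM; rewrite (test_function_eq0 th) ?mul0r//; apply: contra_not xM; exact: oM.
  apply: sqn_cover => //; first exact: measurable_cube.
  by move=> x; exact: cells_cover.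
have osc := cells_oscillation M L th d0.
rewrite (eq_bigr (fun z : {ffun 'I_n -> 'I_L} => 2 * delta ^+ n * ip mu (cell delta M z) h h
   - 2 * (\int[mu]_(x in cell delta M z) h x) ^+ 2)) in osc; last first.
  by move=> z _; rewrite (sqn_oscillation (mC z) (lebesgue_cell M z d0) (shz z)).2.
rewrite big_split/= sumrN -!mulr_sumr in osc.
apply: (le_trans cov).
rewrite -(ler_pM2l V0) mulrDr mulrA divff ?gt_eqF// mul1r.
rewrite exprMn in osc.
have K0 : 0 <= 2 ^+ n * (n%:R * delta ^+ 2 * dirichlet h).
  by rewrite !mulr_ge0 ?exprn_ge0 ?(ltW d0)// sumr_ge0// => i _; exact: sqn_ge0.
have := mulr_ge0 (ltW V0) K0.
move: osc; set S1 := \sum_z ip _ _ _ _; set S2 := \sum_z _ ^+ 2; set Q := dirichlet h.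
set P := delta ^+ n; nra.
Qed.

End rellich.

Lemma ultra_bounded_cvg (R : realType) (U : set_system nat) (u : nat -> R) (B : R) :
  UltraFilter U -> (forall m, `|u m| <= B) ->
  exists c, forall e, 0 < e -> U [set m | `|u m - c| <= e].
Proof.
move=> UU uB; have PU : ProperFilter U := @ultra_proper _ _ UU.
have F : ProperFilter (u @ U) by exact: fmap_proper_filter.
have [|c [_ cc]] := @segment_compact R (- B) B (u @ U) F.
  by apply: (@filterS _ U _ setT) filterT => m _ /=; rewrite in_itv/= -ler_norml.
exists c => e e0.
have [//|H] := in_ultra_setVsetC [set m | `|u m - c| <= e] UU.
have [y [/= ye]] := cc _ _ (H : (u @ U) [set y | ~ `|y - c| <= e]) (nbhsx_ballx c e e0).
by move=> /ltW; rewrite /= distrC.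
Qed.

Lemma le_add1_sqr (R : realFieldType) (t : R) : t <= 1 + t ^+ 2.
Proof.
have := sqr_ge0 (t - 1); have := sqr_ge0 t; rewrite sqrrB1 mulr2n; move: (t ^+ 2) => u; lra.
Qed.

(** * Strong compactness and almost minimizers of the energy *)

Section compactness.
Context {R : realType} (n : nat).
Implicit Types (f g h : 'rV[R]_n -> R) (omega E : set 'rV[R]_n) (i : 'I_n).

Local Notation mu := (@lebesgue_rV R n).
Local Notation sqn f := (ip mu setT f f).

Definition energy f := \sum_i sqn (partial i f).

Definition energy_form f g := \sum_i ip mu setT (partial i f) (partial i g).

Lemma energy_ge0 f : 0 <= energy f.
Proof. by apply: sumr_ge0 => i _; exact: sqn_ge0. Qed.

Lemma sqn_partial_le_energy f i : sqn (partial i f) <= energy f.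
Proof.
by rewrite /energy (bigD1 i)//= lerDl sumr_ge0// => j _; exact: sqn_ge0.
Qed.

Lemma energyZ omega k f : test_function omega f -> energy (k *: f) = k ^+ 2 * energy f.
Proof.
move=> tf; rewrite mulr_sumr; apply: eq_bigr => i _.
by rewrite partialZ ?sqnZ//; [exact: test_function_partial_sqint tf|case: tf].
Qed.

Lemma energyD omega f g : test_function omega f -> test_function omega g ->
  energy (f + g) = energy f + 2 * energy_form f g + energy g.
Proof.
move=> tf tg; rewrite mulr_sumr -!big_split/=; apply: eq_bigr => i _.
rewrite partialD; [|by case: tf|by case: tg].
by rewrite sqnD//; [exact: test_function_partial_sqint tf|exact: test_function_partial_sqint tg].
Qed.

Lemma energy_formZr omega k f g : test_function omega f -> test_function omega g ->
  energy_form f (k *: g) = k * energy_form f g.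
Proof.
move=> tf tg; rewrite mulr_sumr; apply: eq_bigr => i _.
by rewrite partialZ ?ipZr//; [exact: test_function_partial_sqint tf|exact: test_function_partial_sqint tg|case: tg].
Qed.

Lemma energy_parallelogram omega f g : test_function omega f -> test_function omega g ->
  energy (f - g) = 2 * energy f + 2 * energy g - 4 * energy (2^-1 *: (f + g)).
Proof.
move=> tf tg; rewrite (energyZ _ (test_functionD tf tg)) (energyD tf tg).
rewrite -scaleN1r (energyD tf (test_functionZ _ tg)) (energy_formZr _ tf tg) (energyZ _ tg).
by move: (energy f) (energy g) (energy_form f g) => a b c; field.
Qed.

Lemma energyB_le omega f g : test_function omega f -> test_function omega g ->
  energy (f - g) <= 2 * energy f + 2 * energy g.
Proof.
by move=> tf tg; rewrite (energy_parallelogram tf tg) gerBl mulr_ge0// energy_ge0.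
Qed.

(** Along an ultrafilter all the finitely many cell integrals converge simultaneously, so on one of
    its members any two functions have almost the same integrals, and [sqn_le_cells] applies to
    their difference. *)
Lemma rellich (U : set_system nat) (f_ : nat -> 'rV[R]_n -> R) (M B : R) :
  UltraFilter U -> 0 < M -> (forall m, test_function (cube n (- M) M) (f_ m)) ->
  (forall m, sqn (f_ m) <= B) -> (forall m, energy (f_ m) <= B) ->
  forall e, 0 < e -> exists2 A, U A & forall m k, A m -> A k -> sqn (f_ m - f_ k) <= e.
Proof.
move=> UU M0 tf fB fE e e0; have PU : ProperFilter U := @ultra_proper _ _ UU.
have B0 : 0 <= B by exact: le_trans (energy_ge0 _) (fE 0%N).
(* [4 * B] bounds the energy of a difference; [delta] is chosen to bring the gradient term below
   e/2. *)
pose C : R := 2 ^+ n * n%:R * (4 * B) + 1.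
have C0 : 0 < C by rewrite ltr_wpDl// !mulr_ge0// exprn_ge0.
pose delta := Num.min 1 (e / (2 * C)).
have d0 : 0 < delta by rewrite lt_min ltr01 divr_gt0// mulr_gt0.
have dle : 2 ^+ n * n%:R * delta ^+ 2 * (4 * B) <= e / 2.
  have d1 : delta ^+ 2 <= e / (2 * C).
    apply: (@le_trans _ _ delta); last by rewrite ge_min lexx orbT.
    by rewrite expr2 ger_pMl// ge_min lexx.
  apply: (@le_trans _ _ (C * delta ^+ 2)).
    by rewrite mulrAC ler_wpM2r ?exprn_ge0 ?(ltW d0)// lerDl.
  apply: (le_trans (ler_wpM2l (ltW C0) d1)).
  by rewrite le_eqVlt; apply/orP; left; apply/eqP; field; rewrite gt_eqF.
pose L := (Num.bound (2 * M / delta)).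
have LM : 2 * M / delta < L%:R by apply: archi_boundP; rewrite divr_ge0 ?(ltW d0)// mulr_ge0// ltW.
pose I_ (z : {ffun 'I_n -> 'I_L}) m := \int[mu]_(x in cell delta M z) f_ m x.
have V0 : 0 < delta ^+ n by rewrite exprn_gt0.
have mC z := @measurable_cell R n delta M L z.
have sf m := test_function_sqint (tf m).
have sfz z m := sqint_subset (mC z) measurableT (@subsetT _ _) (sf m).
have s1 z (c : R) := sqint_cst (mC z) (lebesgue_cell M z d0) c.
have IE z m : I_ z m = ip mu (cell delta M z) (f_ m) (cst 1).
  by apply: eq_Rintegral => x _; rewrite mulr1.
have Ibd z m : `|I_ z m| <= 1 + B * delta ^+ n.
  have := cauchy_schwarz (mC z) (sfz z m) (s1 z 1); rewrite -IE.
  have -> : ip mu (cell delta M z) (cst 1) (cst 1) = delta ^+ n.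
    rewrite /ip (@eq_Rintegral _ _ _ mu _ (cst 1)); last by move=> x _; rewrite mulr1.
    by rewrite Rintegral_cst// mul1r -[LHS]/(fine (mu (cell delta M z))) lebesgue_cell.
  have := sqn_subset (mC z) measurableT (@subsetT _ _) (sf m) => h1 h2.
  have h3 : I_ z m ^+ 2 <= B * delta ^+ n.
    by apply: (le_trans h2); rewrite ler_pM2r//; exact: le_trans h1 (fB m).
  rewrite -[I_ z m ^+ 2]real_normK ?num_real// in h3.
  apply: le_trans (le_add1_sqr _) _; rewrite lerD2l; exact: h3.
pose eta := e * delta ^+ n / (8 * (#|{ffun 'I_n -> 'I_L}|%:R + 1)).
(* Since [eta1 <= 1], the square of an error [2 * eta1] is at most [4 * eta], which avoids a square
   root. *)
pose eta1 := Num.min 1 eta.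
have N0 : 0 < (#|{ffun 'I_n -> 'I_L}|%:R + 1) :> R by rewrite ltr_wpDl.
have eta0 : 0 < eta by rewrite divr_gt0 ?mulr_gt0.
have eta10 : 0 < eta1 by rewrite lt_min ltr01.
have /choice[c Hc] : forall z, exists c, forall e, 0 < e -> U [set m | `|I_ z m - c| <= e].
  by move=> z; apply: ultra_bounded_cvg; exact: Ibd.
have UA : U [set m | forall z, `|I_ z m - c z| <= eta1].
  by apply: filter_forall => z; exact: Hc.
exists [set m | forall z, `|I_ z m - c z| <= eta1] => // m k Am Ak.
have tmk := test_functionB (tf m) (tf k).
apply: (le_trans (sqn_le_cells tmk (@subset_refl _ _) d0 LM)).
rewrite (splitr e); apply: lerD; last first.
  apply: le_trans dle; rewrite ler_wpM2l ?mulr_ge0 ?exprn_ge0 ?(ltW d0)//.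
  apply: (le_trans (energyB_le (tf m) (tf k))).
  by move: (energy (f_ m)) (energy (f_ k)) (fE m) (fE k) => a b; clear; lra.
rewrite mulrC ler_pdivrMr//.
apply: (@le_trans _ _ (\sum_(z : {ffun 'I_n -> 'I_L}) 4 * eta)).
  apply: ler_sum => z _.
  have -> : \int[mu]_(x in cell delta M z) (f_ m - f_ k) x = I_ z m - I_ z k.
    by rewrite !IE -ipBl//; apply: eq_Rintegral => x _; rewrite mulr1.
  have e1 : eta1 <= 1 by rewrite ge_min lexx.
  have e2 : eta1 <= eta by rewrite ge_min lexx orbT.
  have := Am z; have := Ak z; rewrite !ler_norml.
  move: (I_ z m) (I_ z k) (c z) => a b c0 /andP[a1 a2] /andP[a3 a4].
  apply: (@le_trans _ _ (4 * eta1)); last by rewrite ler_pM2l.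
  have : (a - b) ^+ 2 <= (2 * eta1) ^+ 2.
    rewrite -[leLHS]real_normK ?num_real// lerXn2r ?nnegrE ?mulr_ge0 ?(ltW eta10)//.
    by rewrite ler_norml; clear -a1 a2 a3 a4; apply/andP; split; lra.
  move=> /le_trans; apply; rewrite exprMn (_ : 2 ^+ 2 = 4); last by rewrite -natrX.
  by rewrite ler_pM2l// expr2 ger_pMr.
rewrite sumr_const -[_ *+ _]mulr_natr.
rewrite (_ : 4 * eta * _ = e / 2 * delta ^+ n * (#|{ffun 'I_n -> 'I_L}|%:R / (#|{ffun 'I_n -> 'I_L}|%:R + 1))).
  by rewrite ger_pMr ?mulr_gt0// ler_pdivrMr// mul1r lerDl.
by rewrite /eta; move: (delta ^+ n) (#|{ffun 'I_n -> 'I_L}|%:R : R) N0 => v q; clear; move=> N0; field; rewrite gt_eqF.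
Qed.

(* In place of weak compactness: [psi m] almost minimizes the energy among the
   test functions close to [u], and the parallelogram identity makes it
   energy-Cauchy. *)
Lemma mazur omega u (f_ : nat -> 'rV[R]_n -> R) (B : R) : sqint mu setT u ->
  (forall m, test_function omega (f_ m)) -> sqn (f_ m - u) @[m --> \oo] --> 0 ->
  (forall m, energy (f_ m) <= B + m.+1%:R^-1) ->
  exists psi : nat -> 'rV[R]_n -> R,
   [/\ forall m, test_function omega (psi m), sqn (psi m - u) @[m --> \oo] --> 0,
       forall m, energy (psi m) <= B + m.+1%:R^-1 &
       forall e, 0 < e -> exists N, forall m k, (N <= m)%N -> (N <= k)%N ->
         energy (psi m - psi k) <= e].
Proof.
move=> su tf cf fE.
pose P m := [set f | test_function omega f /\ sqn (f - u) <= m.+1%:R^-1].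
have decr m k : (m <= k)%N -> P k `<=` P m.
  move=> mk f [tk fk]; split=> //; apply: le_trans fk _.
  by rewrite lef_pV2 ?posrE// ler_nat.
have mid m f g : P m f -> P m g -> P m (2^-1 *: (f + g)).
  move=> [t1 H1] [t2 H2]; split; first exact/test_functionZ/test_functionD.
  have s1 := sqintB measurableT (test_function_sqint t1) su.
  have s2 := sqintB measurableT (test_function_sqint t2) su.
  have -> : 2^-1 *: (f + g) - u = 2^-1 *: ((f - u) + (g - u)).
    by apply/funext => x; rewrite !fctE /GRing.scale/=; field.
  rewrite sqnZ//; last exact: sqintD.
  have := sqnD_le2 measurableT s1 s2; rewrite exprVn -natrX.
  move: H1 H2; move: (sqn _) (sqn _) (sqn _) (m.+1%:R^-1) => a b c d; clear; lra.
pose S m := [set energy f | f in P m].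
have Slb m : lbound (S m) 0 by move=> _ [f _ <-]; exact: energy_ge0.
have fP m : exists2 k, (m <= k)%N & P m (f_ k).
  move/cvgrPdist_le : cf => /(_ m.+1%:R^-1); rewrite invr_gt0 ltr0n => /(_ isT)[N _ HN].
  exists (maxn m N); rewrite ?leq_maxl//; split=> //.
  by have := HN (maxn m N) (leq_maxr _ _); rewrite /= sub0r normrN ger0_norm ?sqn_ge0.
have Sinf m : has_inf (S m).
  split; last by exists 0.
  by have [k _ Pk] := fP m; exists (energy (f_ k)), (f_ k).
pose I m := inf (S m).
have IB m : I m <= B.
  apply/ler_addgt0Pr => e e0.
  have [k ke] : exists k : nat, k.+1%:R^-1 < e.
    by have [k _ /(_ k (leqnn _)) ?] := near_infty_natSinv_lt (PosNum e0); exists k.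
  have [l kl Pl] := fP (maxn m k).
  apply: (@le_trans _ _ (energy (f_ l))).
    apply: ge_inf; first by exists 0.
    by exists (f_ l) => //; apply: decr Pl; exact: leq_maxl.
  apply: (le_trans (fE l)); rewrite lerD2l; apply: le_trans (ltW ke).
  by rewrite lef_pV2 ?posrE// ler_nat ltnS (leq_trans _ kl)// leq_maxr.
(* The neighbourhoods [P m] of [u] shrink, so the infima increase; being bounded by [B], they
   converge. *)
have Imono : nondecreasing_seq I.
  move=> m k mk; apply: lb_le_inf; first by case: (Sinf k).
  move=> _ [f Pf <-]; apply: ge_inf; first by exists 0.
  by exists f => //; exact: decr Pf.
have cI : cvgn I.
  by apply: nondecreasing_is_cvgn => //; exists B => _ [m _ <-].
have /choice[psi Hpsi] : forall m, exists f, P m f /\ energy f <= I m + m.+1%:R^-1.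
  move=> m; have m0 : 0 < m.+1%:R^-1 :> R by rewrite invr_gt0.
  by have [_ [f Pf <-] fI] := inf_adherent m0 (Sinf m); exists f; split => //; exact: ltW.
exists psi; split.
- by move=> m; have [[]] := Hpsi m.
- apply/cvgrPdist_le => e e0; have [k _ ke] := near_infty_natSinv_lt (PosNum e0).
  exists k => // m km; rewrite sub0r normrN ger0_norm ?sqn_ge0//.
  have [[_ H] _] := Hpsi m; apply: le_trans H _; exact/ltW/ke.
- by move=> m; have [_ H] := Hpsi m; apply: le_trans H _; rewrite lerD2r.
- move=> e e0.
  have e8 : 0 < e / 8 by rewrite divr_gt0.
  have [k _ ke] := near_infty_natSinv_lt (PosNum e8).
  have /cvgrPdist_le/(_ _ e8)[N _ HN] := cI.
  exists (maxn k N).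
  suff H m l : (maxn k N <= m)%N -> (m <= l)%N -> energy (psi m - psi l) <= e.
    move=> m l mN lN; have [ml|/ltnW lm] := leqP m l; first exact: H.
    have [[tm _] _] := Hpsi m; have [[tl _] _] := Hpsi l.
    rewrite -opprB -scaleN1r (energyZ _ (test_functionB tl tm)) sqrrN expr1n mul1r.
    exact: H.
  move=> mN ml; have lN := leq_trans mN ml.
  have [Pm Em] := Hpsi m; have [Pl El] := Hpsi l.
  have [tm _] := Pm; have [tl _] := Pl.
  (* For m <= l the midpoint lies in [P m], so its energy is at least [I m]; the energy of the
     difference is then at most 2 ([I l] - [I m]) plus the two adherence errors. *)
  rewrite (energy_parallelogram tm tl).
  have h1 : I m <= energy (2^-1 *: (psi m + psi l)).
    apply: ge_inf; first by exists 0.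
    by exists (2^-1 *: (psi m + psi l)); [exact: mid Pm (decr _ _ ml _ Pl)|].
  have km := ltW (ke m (leq_trans (leq_maxl _ _) mN)).
  have kl := ltW (ke l (leq_trans (leq_maxl _ _) lN)).
  have := HN m (leq_trans (leq_maxr _ _) mN); have := HN l (leq_trans (leq_maxr _ _) lN).
  rewrite /= !ler_norml => /andP[a1 a2] /andP[a3 a4].
  move: (energy _) (energy _) (energy _) h1 Em El => x y z.
  move: (I m) (I l) a1 a2 a3 a4 km kl => u1 u2; rewrite /=.
  move: (m.+1%:R^-1) (l.+1%:R^-1) (limn _) => p q r; clear; lra.
Qed.

End compactness.

(** * The Rayleigh quotient *)

Lemma linear_term_eq0 (R : realFieldType) (b c : R) :
  (forall s, 0 <= 2 * s * b + s ^+ 2 * c) -> b = 0.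
Proof.
move=> H; apply/eqP; apply: contrapT => /negP b0.
(* At s = -b/k the expression is (b^2 / k) (c/k - 2), which is negative unless b = 0 because c <
   k. *)
pose k := `|c| + 1; have k0 : 0 < k by rewrite ltr_wpDl.
have := H (- b / k).
rewrite (_ : _ + _ = (b ^+ 2 / k) * (c / k - 2)); last by field; rewrite gt_eqF.
rewrite pmulr_rge0; last by rewrite divr_gt0// exprn_even_gt0.
rewrite subr_ge0 ler_pdivlMr// /k; have := ler_norm c; have := normr_ge0 c.
move: `|c| => d; clear; lra.
Qed.

Section subsequences.
Context {R : realType} (n : nat).

Local Notation mu := (@lebesgue_rV R n).
Local Notation sqn f := (ip mu setT f f).

(** A single ultrafilter refining the filter at infinity serves all indices i and both kinds of
    convergence, so no successive extraction is required; only at the end is an ordinary subsequence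
    read off. *)
Lemma compact_subsequence (I : finType) (f_ : I -> nat -> 'rV[R]_n -> R)
    (l : I -> nat -> R) (M B : R) : 0 < M ->
  (forall i m, test_function (cube n (- M) M) (f_ i m)) ->
  (forall i m, sqn (f_ i m) <= B) -> (forall i m, energy (f_ i m) <= B) ->
  (forall i m, `|l i m| <= B) ->
  exists (s : nat -> nat) (u : I -> 'rV[R]_n -> R) (c : I -> R),
    [/\ forall k, (k <= s k)%N, forall i, sqint mu setT (u i),
        forall i, sqn (f_ i (s k) - u i) @[k --> \oo] --> 0 &
        forall i, l i (s k) @[k --> \oo] --> c i].
Proof.
move=> M0 tf fB fE lB.
have [U [UU ooU]] := @ultraFilterLemma nat \oo _.
have PU : ProperFilter U := @ultra_proper _ _ UU.
have /choice[c Hc] : forall i, exists c, forall e, 0 < e -> U [set m | `|l i m - c| <= e].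
  by move=> i; exact: ultra_bounded_cvg.
have /choice[A HA] : forall k : nat, exists A : set nat, [/\ U A,
    forall i m m', A m -> A m' -> sqn (f_ i m - f_ i m') <= k.+1%:R^-1,
    forall i m, A m -> `|l i m - c i| <= k.+1%:R^-1 & forall m, A m -> (k <= m)%N].
  move=> k; have k0 : 0 < k.+1%:R^-1 :> R by rewrite invr_gt0.
  have /choice[A1 H1] : forall i, exists A, U A /\ forall m m', A m -> A m' -> sqn (f_ i m - f_ i m') <= k.+1%:R^-1.
    by move=> i; have [A UA HA] := rellich UU M0 (tf i) (fB i) (fE i) k0; exists A.
  exists [set m | (forall i, A1 i m) /\ (forall i, `|l i m - c i| <= k.+1%:R^-1) /\ (k <= m)%N].
  split.
  - apply: filterI; first by apply: filter_forall => i; case: (H1 i).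
    apply: filterI; first by apply: filter_forall => i; exact: Hc.
    by apply: ooU; exists k.
  - by move=> i m m' [Am _] [Am' _]; have [_] := H1 i; apply; [exact: Am|exact: Am'].
  - by move=> i m [_ [+ _]]; exact.
  - by move=> m [_ [_]].
have UAk k : U [set m | forall j : 'I_k.+1, A j m].
  by apply: filter_forall => j; have [] := HA j.
(* Diagonal choice: [s k] lies in the first k + 1 members of the ultrafilter at once. *)
have /choice[s Hs] : forall k, exists m, forall j : 'I_k.+1, A j m.
  by move=> k; have [m Am] := filter_ex (UAk k); exists m.
have As k m : (k <= m)%N -> A k (s m).
  by move=> km; exact: (Hs m (Ordinal (km : (k < m.+1)%N))).
have cu i : exists u, sqint mu setT u /\ sqn (f_ i (s k) - u) @[k --> \oo] --> 0.
  apply: (sqint_complete measurableT (f_ := fun k => f_ i (s k))).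
    by move=> k; exact: test_function_sqint (tf i _).
  move=> e e0; have [N _ /(_ N (leqnn _)) Ne] := near_infty_natSinv_lt (PosNum e0).
  exists N => m k Nm Nk; apply: le_trans (ltW Ne).
  by have [_ H _ _] := HA N; apply: H; exact: As.
have /choice[u Hu] := cu.
exists s, u, c; split.
- by move=> k; have [_ _ _] := HA k; apply; exact: As.
- by move=> i; case: (Hu i).
- by move=> i; case: (Hu i).
- move=> i; apply/cvgrPdist_le => e e0.
  have [N _ HN] := near_infty_natSinv_lt (PosNum e0).
  exists N => // k Nk; rewrite distrC.
  have [_ _ H _] := HA k; apply: le_trans (H i _ (As k k (leqnn _))) _.
  exact/ltW/HN.
Qed.

End subsequences.

Section rayleigh_quotient.
Context {R : realType} (n : nat).
Implicit Types (f g h : 'rV[R]_n -> R) (omega E : set 'rV[R]_n) (i : 'I_n).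

Local Notation mu := (@lebesgue_rV R n).
Local Notation sqn f := (ip mu setT f f).

Lemma exists_test_function omega a : open omega -> omega a ->
  exists f, test_function omega f /\ f a = 1.
Proof.
move=> oo oa; have /nbhs_ballP[r /= r0 ar] : nbhs a omega by exact: open_nbhs_nbhs.
pose d := r / 2; have d0 : 0 < d by rewrite divr_gt0.
pose f : 'rV[R]_n -> R := \prod_i (fun x : 'rV[R]_n => hat (d^-1 * x ord0 i + - (d^-1 * a ord0 i))).
have fa x : f x = \prod_i hat (d^-1 * x ord0 i + - (d^-1 * a ord0 i)) by exact: prod_fctE.
exists f; split; last by rewrite fa big1// => i _; rewrite subrr hat0.
apply: (@test_function_of_support _ _ _ (box (fun i => `[a ord0 i - d, a ord0 i + d]%classic))).
- by apply: smooth_prod => i; apply: smooth_coordinate; exact: hat_Cinfty.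
- by apply: rV_compact => i; exact: segment_compact.
- move=> x xK; apply: ar; apply/ball_rVP => // i; have := xK i.
  rewrite /= in_itv/= => /andP[x1 x2]; rewrite ltr_norml.
  by have : d < r; [rewrite ltr_pdivrMr// mulr_natr mulr2n ltrDl|move=> ?; apply/andP; split; lra].
- move=> x; rewrite fa => /prodf_neq0 H i; have := hat_neq0 (H i isT).
  rewrite -mulrBr normrM gtr0_norm ?invr_gt0// ltr_pdivrMl// mulr1 => /ltW.
  by rewrite ler_norml /= in_itv/= => /andP[x1 x2]; apply/andP; split; lra.
Qed.

Lemma sqn_gt0 omega f a : test_function omega f -> f a != 0 -> 0 < sqn f.
Proof.
move=> tf fa; have [sf _ _] := tf; have cf := smooth_continuous sf.
have /cvgrPdist_lt := cf a; move=> /(_ (`|f a| / 2)); rewrite divr_gt0 ?normr_gt0// => /(_ isT).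
move=> /nbhs_ballP[r /= r0 Hr].
pose K := box (fun i => `[a ord0 i - r / 2, a ord0 i + r / 2]%classic).
have mK : measurable K by apply: measurable_box => i; exact: measurable_itv.
have r20 : 0 < r / 2 by rewrite divr_gt0.
have muK : (mu K = ((r ^+ n)%:E))%E.
  rewrite lebesgue_box; last by move=> i; exact: measurable_itv.
  rewrite (eq_bigr (fun=> r%:E)); first by rewrite prodEFin prodr_const card_ord.
  move=> i _; rewrite lebesgue_measure_itv/= lte_fin ifT; last by lra.
  by rewrite -EFinB; congr EFin; field.
have sK := sqint_subset mK measurableT (@subsetT _ _) (test_function_sqint tf).
apply: lt_le_trans (sqn_subset mK measurableT (@subsetT _ _) (test_function_sqint tf)).
apply: (@lt_le_trans _ _ (ip mu K (cst (`|f a| / 2)) (cst (`|f a| / 2)))).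
  rewrite /ip (@eq_Rintegral _ _ _ mu _ (cst ((`|f a| / 2) * (`|f a| / 2))))//.
  rewrite Rintegral_cst// -[X in _ * X]/(fine (mu K)) muK/=.
  by rewrite !mulr_gt0 ?exprn_gt0// ?invr_gt0// normr_gt0.
apply: sqn_le => //.
move=> x xK; rewrite /= ger0_norm ?divr_ge0//.
have xa : ball a r x.
  apply/ball_rVP => // i; have := xK i; rewrite /= in_itv/= => /andP[x1 x2].
  by rewrite ltr_norml; apply/andP; split; lra.
have := Hr x xa; rewrite /= => h.
have := ler_normD (f x) (f a - f x); rewrite addrCA subrr addr0.
by move: h; move: (`|f a|) (`|f x|) (`|_ - _|) => p q t; clear; lra.
Qed.

Lemma test_normalize omega f : test_function omega f -> 0 < sqn f ->
  exists g, [/\ test_function omega g, sqn g = 1 & energy g = energy f / sqn f].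
Proof.
move=> tf f0; exists ((Num.sqrt (sqn f))^-1 *: f); split; first exact: test_functionZ.
  rewrite sqnZ//; last exact: test_function_sqint tf.
  by rewrite exprVn sqr_sqrtr ?(ltW f0)// mulVf// gt_eqF.
by rewrite (energyZ _ tf) exprVn sqr_sqrtr ?(ltW f0)// mulrC.
Qed.

(** Only test functions compete, not all of H^1_0; the two infima agree by density, and a competitor
    can then be cut off and translated freely. *)
Definition rayleigh omega := inf [set energy f | f in [set f | test_function omega f /\ sqn f = 1]].

(** Without competitors the infimum is 0 by convention, so the bound holds for every set. *)
Lemma rayleigh_ge0 omega : 0 <= rayleigh omega.
Proof.
have [[x [f tf xE]]|N] := pselect ([set energy f | f in
    [set f | test_function omega f /\ sqn f = 1]] !=set0).
  by apply: lb_le_inf; [exists x, f|move=> _ [g _ <-]; exact: energy_ge0].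
rewrite /rayleigh (_ : [set _ | _ in _] = set0) ?inf0//.
by apply: contrapT => /eqP/set0P.
Qed.

Lemma rayleigh_le omega f : test_function omega f -> rayleigh omega * sqn f <= energy f.
Proof.
move=> tf; have := sqn_ge0 mu setT f; rewrite le_eqVlt => /predU1P[<-|f0].
  by rewrite mulr0 energy_ge0.
have [g [tg g1 gE]] := test_normalize tf f0.
rewrite -ler_pdivlMr// -gE; apply: ge_inf; last by exists g.
by exists 0 => _ [h _ <-]; exact: energy_ge0.
Qed.

Lemma rayleigh_has_inf omega : open omega -> omega !=set0 ->
  has_inf [set energy f | f in [set f | test_function omega f /\ sqn f = 1]].
Proof.
move=> oo [a oa]; have [f [tf fa]] := exists_test_function oo oa.
have f0 : 0 < sqn f by apply: (@sqn_gt0 _ _ a tf); rewrite fa oner_eq0.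
have [g [tg g1 _]] := test_normalize tf f0.
split; first by exists (energy g), g.
by exists 0 => _ [h _ <-]; exact: energy_ge0.
Qed.

Lemma rayleigh_approx omega e : open omega -> omega !=set0 -> 0 < e ->
  exists f, [/\ test_function omega f, sqn f = 1 & energy f <= rayleigh omega + e].
Proof.
move=> oo o0 e0; have [_ [f [tf f1] <-] fe] := inf_adherent e0 (rayleigh_has_inf oo o0).
by exists f; split => //; exact: ltW.
Qed.

(** Poincare's inequality in the direction i, whose existence means n > 0. The bound depends on the
    cube only, hence is common to all admissible sets. *)
Lemma rayleigh_ge omega (M : R) (i : 'I_n) : open omega -> omega !=set0 -> 0 < M ->
  omega `<=` cube n (- M) M -> 2 / (2 * M + 1) ^+ 2 <= rayleigh omega.
Proof.
move=> oo o0 M0 oM; apply: lb_le_inf; first by case: (rayleigh_has_inf oo o0).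
move=> _ [f [tf f1] <-].
have P0 : 0 < (2 * M + 1) ^+ 2 by rewrite exprn_gt0// addr_gt0// mulr_gt0.
rewrite ler_pdivrMr// mulrC.
have := poincare i M0 oM tf; rewrite f1 mulr1 => /le_trans; apply.
by rewrite ler_pM2l// sqn_partial_le_energy.
Qed.

End rayleigh_quotient.

(** * The first eigenvalue as a Rayleigh quotient *)

Section first_eigenvalue.
Context {R : realType} (n : nat).
Implicit Types (f g h : 'rV[R]_n -> R) (omega E : set 'rV[R]_n) (i : 'I_n).

Local Notation mu := (@lebesgue_rV R n).
Local Notation sqn f := (ip mu setT f f).

Lemma cvg_sqnE omega (f_ : nat -> 'rV[R]_n -> R) : measurable omega -> (forall m, sqint mu omega (f_ m)) ->
  (\int[mu]_(x in omega) ((f_ m x) ^+ 2)%:E @[m --> \oo] --> 0)%E <->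
  ip mu omega (f_ m) (f_ m) @[m --> \oo] --> 0.
Proof.
move=> mo sf; rewrite (_ : (fun m => _) = (fun m => (ip mu omega (f_ m) (f_ m))%:E)).
  split; last by move=> H; apply: cvg_EFin => //; exact: nearW.
  by move/fine_cvg.
by apply/funext => m; exact: sqnE.
Qed.

Lemma cvg_sqn omega (f_ : nat -> 'rV[R]_n -> R) f : measurable omega ->
  (forall m, sqint mu omega (f_ m)) -> sqint mu omega f ->
  ip mu omega (f_ m - f) (f_ m - f) @[m --> \oo] --> 0 ->
  ip mu omega (f_ m) (f_ m) @[m --> \oo] --> ip mu omega f f.
Proof. by move=> mo sf_ sf cf; exact: cvg_ip. Qed.

Lemma cvg_sqn_restrict D (f : nat -> 'rV[R]_n -> R) (u : 'rV[R]_n -> R) : measurable D ->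
  (forall m, sqint mu setT (f m)) -> sqint mu setT u ->
  sqn (f m - u) @[m --> \oo] --> 0 ->
  ip mu D (f m) (f m) @[m --> \oo] --> ip mu D u u.
Proof.
move=> mD sf su cf.
apply: cvg_sqn => //.
- by move=> m; exact: (sqint_subset mD measurableT (@subsetT _ _) (sf m)).
- exact: (sqint_subset mD measurableT (@subsetT _ _) su).
- apply: (@squeeze_cvgr _ _ _ _ (cst 0) (fun m => sqn (f m - u))) => //; last exact: cvg_cst.
  by apply: nearW => m; rewrite sqn_ge0/=; apply: sqn_subset => //; exact: sqintB.
Qed.

Lemma cvg_ipl omega (f_ : nat -> 'rV[R]_n -> R) f g : measurable omega ->
  (forall m, sqint mu omega (f_ m)) -> sqint mu omega f -> sqint mu omega g ->
  ip mu omega (f_ m - f) (f_ m - f) @[m --> \oo] --> 0 ->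
  ip mu omega (f_ m) g @[m --> \oo] --> ip mu omega f g.
Proof.
move=> mo sf_ sf sg cf; apply: (@cvg_ip _ _ _ mu _ mo f_ (fun=> g)) => //.
rewrite subrr (_ : (fun m => _) = cst 0); first exact: cvg_cst.
by apply/funext => m; exact: sqn0.
Qed.


Lemma cvg_finsum (I : Type) (r : seq I) (a_ : I -> nat -> R) (a : I -> R) :
  (forall j, a_ j m @[m --> \oo] --> a j) ->
  \sum_(j <- r) a_ j m @[m --> \oo] --> \sum_(j <- r) a j.
Proof.
move=> H; elim: r => [|j r IH].
  by rewrite big_nil; under eq_fun do rewrite big_nil; exact: cvg_cst.
by rewrite big_cons; under eq_fun do rewrite big_cons; exact: cvgD.
Qed.

Lemma rayleigh_le_eigenvalue omega l : open omega -> dirichlet_eigenvalue omega l ->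
  rayleigh omega <= l.
Proof.
move=> oo [u [g [[[su sg _] [phi [tphi cphi cgrad]]] nz EL]]].
have mo := open_measurable_rV oo.
have {}su : sqint mu omega u := su.
have {}sg : forall i, sqint mu omega (g i) := sg.
have sphi m := sqint_subset mo measurableT (@subsetT _ _) (test_function_sqint (tphi m)).
have sgrad i m := sqint_subset mo measurableT (@subsetT _ _) (test_function_partial_sqint i (tphi m)).
have {}cphi : ip mu omega (phi m - u) (phi m - u) @[m --> \oo] --> 0.
  under eq_fun do rewrite sqn_subC.
  by apply/(@cvg_sqnE omega (fun m => u - phi m)) => // m; exact: sqintB.
have {}cgrad i : ip mu omega (partial i (phi m) - g i) (partial i (phi m) - g i) @[m --> \oo] --> 0.
  under eq_fun do rewrite sqn_subC.
  by apply/(@cvg_sqnE omega (fun m => g i - partial i (phi m))) => //; [by move=> m; apply: sqintB => //; exact: sg|exact: cgrad].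
have supp m x : ~ omega x -> phi m x = 0 by exact: test_function_eq0 (tphi m).
have suppg i m x : ~ omega x -> partial i (phi m) x = 0.
  by apply: test_function_eq0; exact: test_function_partial (tphi m).
have sphiE m : sqn (phi m) = ip mu omega (phi m) (phi m).
  by rewrite ip_supported// => x ox; rewrite supp// mul0r.
have enE m : energy (phi m) = \sum_i ip mu omega (partial i (phi m)) (partial i (phi m)).
  by apply: eq_bigr => i _; rewrite ip_supported// => x ox; rewrite suppg// mul0r.
have c1 : ip mu omega (phi m) (phi m) @[m --> \oo] --> ip mu omega u u by exact: cvg_sqn.
have c2 : energy (phi m) @[m --> \oo] --> \sum_i ip mu omega (g i) (g i).
  under eq_fun do rewrite enE.
  by apply: cvg_finsum => i; exact: cvg_sqn.
(* The weak equation is tested against the [phi m] approximating [u] itself; in the limit it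
   identifies the energy of [u] with l times its squared norm. *)
have GL : \sum_i ip mu omega (g i) (g i) = l * ip mu omega u u.
  have e1 : (fun m => \sum_i ip mu omega (partial i (phi m)) (g i)) @ \oo --> \sum_i ip mu omega (g i) (g i).
    by apply: cvg_finsum => i; exact: cvg_ipl.
  have e2 : (fun m => l * ip mu omega (phi m) u) @ \oo --> l * ip mu omega u u.
    by apply: cvgM; [exact: cvg_cst|exact: cvg_ipl].
  have e12 : (fun m => \sum_i ip mu omega (partial i (phi m)) (g i)) = (fun m => l * ip mu omega (phi m) u).
    apply/funext => m; rewrite (ipC mu omega (phi m)) -(EL _ (tphi m)).
    by apply: eq_bigr => i _; rewrite ipC.
  by rewrite e12 in e1; exact: (cvg_unique _ e1 e2).
have c3 : (fun m => rayleigh omega * ip mu omega (phi m) (phi m)) @ \oo --> rayleigh omega * ip mu omega u u.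
  by apply: cvgM => //; exact: cvg_cst.
have ru : rayleigh omega * ip mu omega u u <= l * ip mu omega u u.
  rewrite -GL; apply: ler_cvg_to c3 c2 _; apply: nearW => m.
  by rewrite -sphiE; exact: rayleigh_le (tphi m).
have := sqn_ge0 mu omega u; rewrite le_eqVlt => /predU1P[u0|u0]; last by rewrite -(ler_pM2r u0).
exfalso; apply: nz.
apply: negligibleS ((sqn_eq0P mo su).1 (esym u0)) => x /not_implyP[ox /eqP ux].
by split.
Qed.

(** The direct method: Rellich gives an L^2 limit of a minimizing sequence, [mazur] makes the
    gradients converge too, and the first variation of the quotient is the weak eigenvalue
    equation. *)
Lemma rayleigh_eigenvalue omega (M : R) : open omega -> omega !=set0 -> 0 < M ->
  omega `<=` cube n (- M) M -> dirichlet_eigenvalue omega (rayleigh omega).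
Proof.
move=> oo o0 M0 oM; set lam := rayleigh omega.
have mo := open_measurable_rV oo.
have /choice[f_ Hf] : forall m : nat, exists f, [/\ test_function omega f, sqn f = 1 & energy f <= lam + m.+1%:R^-1].
  by move=> m; apply: rayleigh_approx => //; rewrite invr_gt0.
have lam0 : 0 <= lam.
  by apply: lb_le_inf; [case: (rayleigh_has_inf oo o0)|move=> _ [h _ <-]; exact: energy_ge0].
have tf m : test_function omega (f_ m) by case: (Hf m).
have [s [u0 [_ [ks su cu _]]]] : exists (s : nat -> nat) (u : 'I_1 -> 'rV[R]_n -> R) (c : 'I_1 -> R),
    [/\ forall k, (k <= s k)%N, forall j, sqint mu setT (u j),
        forall j, sqn (f_ (s k) - u j) @[k --> \oo] --> 0 &
        forall j, (0 : R) @[k --> \oo] --> c j].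
  apply: (@compact_subsequence R n 'I_1 (fun=> f_) (fun _ _ => 0) M (lam + 1)) => //.
  - by move=> _ m; exact: test_function_subset oM (tf m).
  - by move=> _ m; have [_ -> _] := Hf m; rewrite lerDr.
  - move=> _ m; have [_ _ fE] := Hf m; apply: le_trans fE _.
    by rewrite lerD2l invf_le1// ler1n.
  - by move=> _ _; rewrite normr0 addr_ge0.
pose u := u0 ord0; have {}su : sqint mu setT u := su ord0.
have {}cu : sqn (f_ (s k) - u) @[k --> \oo] --> 0 := cu ord0.
have [psi [tpsi cpsi psiE psiC]] : exists psi : nat -> 'rV[R]_n -> R,
   [/\ forall m, test_function omega (psi m), sqn (psi m - u) @[m --> \oo] --> 0,
       forall m, energy (psi m) <= lam + m.+1%:R^-1 &
       forall e, 0 < e -> exists N, forall m k, (N <= m)%N -> (N <= k)%N ->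
         energy (psi m - psi k) <= e].
  apply: (@mazur R n omega u (fun k => f_ (s k))) => // m.
  have [_ _ fE] := Hf (s m); apply: le_trans fE _.
  by rewrite lerD2l lef_pV2 ?posrE// ler_nat ltnS.
have spsi m := test_function_sqint (tpsi m).
have sgpsi i m := test_function_partial_sqint i (tpsi m).
(* Being Cauchy in energy, the [psi m] have gradients converging in L^2; their limits become the
   weak gradient of [u]. *)
have /choice[g Hg] : forall i, exists g, sqint mu setT g /\ sqn (partial i (psi m) - g) @[m --> \oo] --> 0.
  move=> i; apply: (sqint_complete measurableT (f_ := fun m => partial i (psi m))) => // e e0.
  have [N HN] := psiC e e0; exists N => m k Nm Nk; apply: le_trans (HN m k Nm Nk).
  rewrite -partialB; [exact: sqn_partial_le_energy|by case: (tpsi m)|by case: (tpsi k)].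
have sg i : sqint mu setT (g i) by case: (Hg i).
have cg i : sqn (partial i (psi m) - g i) @[m --> \oo] --> 0 by case: (Hg i).
have suo := sqint_subset mo measurableT (@subsetT _ _) su.
have sgo i := sqint_subset mo measurableT (@subsetT _ _) (sg i).
have sub_cvg f (h_ : nat -> 'rV[R]_n -> R) : (forall m, sqint mu setT (h_ m)) -> sqint mu setT f ->
    sqn (h_ m - f) @[m --> \oo] --> 0 ->
    (\int[mu]_(x in omega) ((f x - h_ m x) ^+ 2)%:E @[m --> \oo] --> 0)%E.
  move=> sh sf ch; apply/(@cvg_sqnE omega (fun m => f - h_ m)) => //.
    move=> m; apply: (sqint_subset mo measurableT (@subsetT _ _)); exact: sqintB.
  apply: (@squeeze_cvgr _ _ _ _ (cst 0) (fun m => sqn (h_ m - f))) => //; last exact: cvg_cst.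
  apply: nearW => m; rewrite sqn_ge0 sqn_subC/=.
  by apply: sqn_subset => //; exact: sqintB.
have one : sqn u = 1.
  have c1 : sqn (f_ (s k)) @[k --> \oo] --> sqn u.
    by apply: cvg_sqn => // k; exact: test_function_sqint (tf _).
  have E : (fun k => sqn (f_ (s k))) = cst 1.
    by apply/funext => k; have [_ -> _] := Hf (s k).
  have c2 : (fun k => sqn (f_ (s k))) @ \oo --> (1 : R) by rewrite E; exact: cvg_cst.
  exact: (cvg_unique _ c1 c2).
have G : \sum_i sqn (g i) <= lam.
  have c1 : energy (psi m) @[m --> \oo] --> \sum_i sqn (g i).
    by apply: cvg_finsum => i; exact: cvg_sqn.
  have c2 : (fun m => lam + m.+1%:R^-1) @ \oo --> lam + 0.
    by apply: cvgD; [exact: cvg_cst|exact: cvg_harmonic].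
  by rewrite addr0 in c2; apply: ler_cvg_to c1 c2 _; exact: nearW.
have test_ip phi f : test_function omega phi -> ip mu omega f phi = ip mu setT f phi.
  by move=> tphi; rewrite ip_supported// => x /(test_function_eq0 tphi) ->; rewrite mulr0.
have EL phi : test_function omega phi ->
    \sum_i ip mu setT (g i) (partial i phi) = lam * ip mu setT u phi.
  move=> tphi; apply/eqP; rewrite -subr_eq0; apply/eqP.
  have sphi := test_function_sqint tphi.
  (* Minimality applied to [psi m + t *: phi] passes to the limit. The constant terms drop since the
     energy of the limit is at most [lam] and [sqn u = 1], leaving a nonnegative polynomial in t
     whose linear coefficient is the weak equation. *)
  apply: (@linear_term_eq0 _ _ (energy phi - lam * sqn phi)) => t.
  have c1 : (fun m => energy (psi m) + 2 * (t * energy_form (psi m) phi) + t ^+ 2 * energy phi) @ \oo -->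
      \sum_i sqn (g i) + 2 * (t * \sum_i ip mu setT (g i) (partial i phi)) + t ^+ 2 * energy phi.
    apply: cvgD; last exact: cvg_cst.
    apply: cvgD; first by apply: cvg_finsum => i; exact: cvg_sqn.
    apply: cvgM; first exact: cvg_cst.
    apply: cvgM; first exact: cvg_cst.
    apply: cvg_finsum => i; apply: cvg_ipl => //; exact: test_function_partial_sqint tphi.
  have c2 : (fun m => lam * (sqn (psi m) + 2 * (t * ip mu setT (psi m) phi) + t ^+ 2 * sqn phi)) @ \oo -->
      lam * (sqn u + 2 * (t * ip mu setT u phi) + t ^+ 2 * sqn phi).
    apply: cvgM; first exact: cvg_cst.
    apply: cvgD; last exact: cvg_cst.
    apply: cvgD; first exact: cvg_sqn.
    apply: cvgM; first exact: cvg_cst.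
    by apply: cvgM; [exact: cvg_cst|exact: cvg_ipl].
  have : lam * (sqn u + 2 * (t * ip mu setT u phi) + t ^+ 2 * sqn phi) <=
      \sum_i sqn (g i) + 2 * (t * \sum_i ip mu setT (g i) (partial i phi)) + t ^+ 2 * energy phi.
    apply: ler_cvg_to c2 c1 _; apply: nearW => m.
    have := rayleigh_le (test_functionD (tpsi m) (test_functionZ t tphi)).
    rewrite (energyD (tpsi m) (test_functionZ t tphi)) (energy_formZr _ (tpsi m) tphi) (energyZ _ tphi).
    by rewrite sqnD//; [rewrite sqnZ// ipZr|exact: sqintZ].
  rewrite one; move: G.
  move: (\sum_i sqn (g i)) (\sum_i ip mu setT (g i) (partial i phi)) (ip mu setT u phi) (energy phi) (sqn phi) (t ^+ 2) => a b c d e t2.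
  clear; move=> h1 h2.
  have -> : 2 * t * (b - lam * c) + t2 * (d - lam * e) =
    ((a + 2 * (t * b) + t2 * d) - lam * (1 + 2 * (t * c) + t2 * e)) + (lam - a) by ring.
  by rewrite addr_ge0// subr_ge0.
exists u, g; split.
- split; last first.
    exists psi; split=> //; first exact: sub_cvg.
    by move=> i; exact: (@sub_cvg (g i) (fun m => partial i (psi m))).
  split=> // i phi tphi.
  have tdphi := test_function_partial i tphi.
  rewrite -/(ip mu omega u (partial i phi)) -/(ip mu omega (g i) phi) !test_ip//.
  have c1 : (fun m => ip mu setT (psi m) (partial i phi)) @ \oo --> ip mu setT u (partial i phi).
    by apply: cvg_ipl => //; exact: test_function_sqint tdphi.
  have c2 : (fun m => - ip mu setT (partial i (psi m)) phi) @ \oo --> - ip mu setT (g i) phi.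
    by apply: cvgN; apply: cvg_ipl => //; exact: test_function_sqint tphi.
  have E : (fun m => ip mu setT (psi m) (partial i phi)) = (fun m => - ip mu setT (partial i (psi m)) phi).
    by apply/funext => m; have [sp _ _] := tphi; rewrite (@test_integration_by_parts R n omega (psi m) phi i (tpsi m) sp).
  by rewrite E in c1; exact: (cvg_unique _ c1 c2).
(* The unit mass of [u] lies in [omega], because every [psi m] vanishes outside it; so [u] cannot
   vanish almost everywhere there. *)
- move=> uae.
  have c1 : sqn (psi m) @[m --> \oo] --> sqn u by exact: cvg_sqn.
  have c2 : ip mu omega (psi m) (psi m) @[m --> \oo] --> ip mu omega u u.
    apply: cvg_sqn => //.
      by move=> m; exact: (sqint_subset mo measurableT (@subsetT _ _) (spsi m)).
    apply: (@squeeze_cvgr _ _ _ _ (cst 0) (fun m => sqn (psi m - u))) => //; last exact: cvg_cst.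
    by apply: nearW => m; rewrite sqn_ge0/=; apply: sqn_subset => //; exact: sqintB.
  have E : (fun m => sqn (psi m)) = (fun m => ip mu omega (psi m) (psi m)).
    by apply/funext => m; rewrite test_ip.
  rewrite E in c1; have e : sqn u = ip mu omega u u by exact: (cvg_unique _ c1 c2).
  have /eqP := oner_neq0 R; apply; rewrite -one e.
  rewrite /ip /Rintegral (ae_eq_integral (cst 0%E)) ?integral0//.
  + by apply/measurable_EFinP; apply: measurable_funM; case: suo.
  + by move: uae; apply: filterS => x H ox; rewrite (H ox) mul0r.
- move=> phi tphi; rewrite -/(ip mu omega u phi) test_ip// -EL//.
  apply: eq_bigr => i _; rewrite -/(ip mu omega (g i) (partial i phi)) test_ip//.
  exact: test_function_partial.
Qed.

Lemma lambda1_rayleigh omega (M : R) : open omega -> omega !=set0 -> 0 < M ->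
  omega `<=` cube n (- M) M -> lambda1 omega = rayleigh omega.
Proof.
move=> oo o0 M0 oM; have re := rayleigh_eigenvalue oo o0 M0 oM.
apply/le_anti/andP; split.
  apply: ge_inf => //; exists (rayleigh omega) => l; exact: rayleigh_le_eigenvalue.
by apply: lb_le_inf; [exists (rayleigh omega)|move=> l; exact: rayleigh_le_eigenvalue].
Qed.

End first_eigenvalue.

(** * Neighbourhoods and localization *)

Section euclidean.
Context {R : realType} (n : nat).
Implicit Types (x y p : 'rV[R]_n) (C E : set 'rV[R]_n) (i : 'I_n).

Local Notation mu := (@lebesgue_rV R n).
Local Notation e_ i := (delta_mx ord0 i : 'rV[R]_n).

Lemma enorm_ge0 x : 0 <= euclidean_norm x.
Proof. exact: sqrtr_ge0. Qed.

Lemma enorm_sqr x : euclidean_norm x ^+ 2 = \sum_i x ord0 i ^+ 2.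
Proof. by rewrite sqr_sqrtr// sumr_ge0// => i _; rewrite sqr_ge0. Qed.

Lemma enorm_le x (r : R) : 0 <= r -> \sum_i x ord0 i ^+ 2 <= r ^+ 2 -> euclidean_norm x <= r.
Proof.
move=> r0 H; rewrite -(@ler_pXn2r _ 2)// ?nnegrE ?enorm_ge0//.
by rewrite enorm_sqr.
Qed.

Lemma enorm_lt x (r : R) : 0 <= r -> \sum_i x ord0 i ^+ 2 < r ^+ 2 -> euclidean_norm x < r.
Proof.
move=> r0 H; rewrite -(@ltr_pXn2r _ 2)// ?nnegrE ?enorm_ge0//.
by rewrite enorm_sqr.
Qed.

Lemma cauchy_schwarz_sum (a b : 'I_n -> R) :
  (\sum_i a i * b i) ^+ 2 <= (\sum_i a i ^+ 2) * (\sum_i b i ^+ 2).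
Proof.
set A := \sum_i a i ^+ 2; set B := \sum_i b i ^+ 2; set C := \sum_i a i * b i.
have H t : 0 <= A + 2 * t * C + t ^+ 2 * B.
  rewrite (_ : _ + _ = \sum_i (a i + t * b i) ^+ 2).
    by apply: sumr_ge0 => i _; exact: sqr_ge0.
  by rewrite /A /B /C !mulr_sumr -!big_split/=; apply: eq_bigr => i _; ring.
have A0 : 0 <= A by apply: sumr_ge0 => i _; exact: sqr_ge0.
have : 0 <= B by apply: sumr_ge0 => i _; exact: sqr_ge0.
move: A B C A0 H => A B C A0 H; clear -A0 H.
rewrite le_eqVlt => /predU1P[B0|B0].
  have -> : C = 0; last by rewrite expr0n -B0 mulr0.
  apply/eqP; apply: contrapT => /negP C0.
  have := H (- (A + 1) / (2 * C)); rewrite -B0 mulr0 addr0.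
  rewrite (_ : A + _ = -1); first by rewrite lerNr oppr0 ler10.
  by field.
have := H (- C / B).
rewrite (_ : _ + _ = (A * B - C ^+ 2) / B); last by field; rewrite gt_eqF.
by rewrite pmulr_lge0 ?invr_gt0// subr_ge0.
Qed.

Lemma enorm_triangle x y : euclidean_norm (x + y) <= euclidean_norm x + euclidean_norm y.
Proof.
apply: enorm_le; first by rewrite addr_ge0 ?enorm_ge0.
have -> : \sum_i (x + y) ord0 i ^+ 2 =
    \sum_i x ord0 i ^+ 2 + 2 * \sum_i (x ord0 i * y ord0 i) + \sum_i y ord0 i ^+ 2.
  by rewrite mulr_sumr -!big_split/=; apply: eq_bigr => i _; rewrite mxE; ring.
rewrite sqrrD !enorm_sqr lerD2r lerD2l -[_ * _ *+ 2]mulr_natl ler_pM2l//.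
apply: le_trans (ler_norm _) _.
rewrite -(@ler_pXn2r _ 2)// ?nnegrE ?mulr_ge0 ?enorm_ge0//.
rewrite real_normK ?num_real// exprMn !enorm_sqr.
exact: cauchy_schwarz_sum.
Qed.

Lemma enormN x : euclidean_norm (- x) = euclidean_norm x.
Proof. by congr Num.sqrt; apply: eq_bigr => i _; rewrite mxE sqrrN. Qed.

Lemma enorm_subC x y : euclidean_norm (x - y) = euclidean_norm (y - x).
Proof. by rewrite -enormN opprB. Qed.

Lemma enorm_dist x y p : euclidean_norm (x - p) <= euclidean_norm (x - y) + euclidean_norm (y - p).
Proof. by apply: le_trans (enorm_triangle _ _); rewrite addrA subrK. Qed.

(** The crude factor n instead of sqrt n keeps all later constants polynomial in n. *)
Lemma enorm_sup x (d : R) : 0 <= d -> (forall i, `|x ord0 i| <= d) ->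
  euclidean_norm x <= n%:R * d.
Proof.
move=> d0 H; apply: enorm_le; first by rewrite mulr_ge0.
apply: (@le_trans _ _ (\sum_(i < n) d ^+ 2)).
  by apply: ler_sum => i _; rewrite -[leLHS]real_normK ?num_real// lerXn2r// nnegrE.
rewrite sumr_const card_ord -(mulr_natl (d ^+ 2)) exprMn ler_wpM2r ?sqr_ge0//.
by rewrite -natrX ler_nat; case: (n) => // m; rewrite expnS expn1 leq_pmulr.
Qed.

Lemma enorm_delta (s : R) i : euclidean_norm (s *: e_ i) = `|s|.
Proof.
rewrite /euclidean_norm (bigD1 i)//= big1.
  by rewrite !mxE !eqxx mulr1 addr0 sqrtr_sqr.
by move=> j ji; rewrite !mxE (negbTE ji) andbF mulr0 expr0n.
Qed.

Lemma ball_enorm (d : R) x y : 0 < d -> ball x d y -> euclidean_norm (x - y) <= n%:R * d.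
Proof.
move=> d0 /(ball_rVP _ _ d0) H; apply: enorm_sup; first exact: ltW.
by move=> i; rewrite !mxE ltW.
Qed.

Lemma open_enorm_near (P : set 'rV[R]_n) : (forall x, P x -> exists2 d, 0 < d &
  forall y, euclidean_norm (x - y) < d -> P y) -> open P.
Proof.
move=> H; rewrite openE => x /H[d d0 Hd]; apply/nbhs_ballP.
have r0 : 0 < d / (n%:R + 1) by rewrite divr_gt0// ltr_wpDl.
exists (d / (n%:R + 1)) => // y xy; apply: Hd.
apply: (le_lt_trans (ball_enorm r0 xy)).
by rewrite mulrA ltr_pdivrMr ?ltr_wpDl// mulrC ltr_pM2l// ltrDl.
Qed.

Definition nbh C (r : R) : set 'rV[R]_n := [set x | exists2 p, C p & euclidean_norm (x - p) < r].

Lemma open_nbh C r : open (nbh C r).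
Proof.
apply: open_enorm_near => x [p Cp xp]; exists (r - euclidean_norm (x - p)); first by rewrite subr_gt0.
move=> y xy; exists p => //; apply: le_lt_trans (enorm_dist _ x _) _.
by rewrite enorm_subC -ltrBrDr.
Qed.

Lemma nbh_le C r s : r <= s -> nbh C r `<=` nbh C s.
Proof. by move=> rs x [p Cp xp]; exists p => //; exact: lt_le_trans rs. Qed.

Lemma nbh_shift C r x a s : euclidean_norm a <= s -> nbh C r x -> nbh C (r + s) (x + a).
Proof.
move=> As [p Cp xp]; exists p => //.
rewrite (_ : x + a - p = (x - p) + a); last by rewrite addrAC.
by apply: le_lt_trans (enorm_triangle _ _) _; rewrite ltr_leD.
Qed.

(** The strip of half-width k around the boundary of the 1-neighbourhood of [C]. *)
Definition annulus C k := nbh C (1 + k) `\` nbh C (1 - k).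

Lemma measurable_annulus C k : measurable (annulus C k).
Proof. by apply: measurableD; (apply: open_measurable_rV; exact: open_nbh). Qed.

(* The points with a point [p] of [C] at distance less than [1 + k] towards
   which the direction [(-1)^b e_i] makes definite progress. *)
Definition cone C k (d : 'I_n * bool) : set 'rV[R]_n :=
  [set x | exists2 p, C p & euclidean_norm (x - p) < 1 + k /\
     (4 * n%:R)^-1 < - ((-1) ^+ d.2 * (x - p) ord0 d.1)].

Lemma open_cone C k d : open (cone C k d).
Proof.
apply: open_enorm_near => x [p Cp [xp xd]].
exists (Num.min (1 + k - euclidean_norm (x - p)) (- ((-1) ^+ d.2 * (x - p) ord0 d.1) - (4 * n%:R)^-1)).
  by rewrite lt_min !subr_gt0 xp.
move=> y; rewrite lt_min => /andP[y1 y2]; exists p => //; split.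
  apply: le_lt_trans (enorm_dist _ x _) _.
  by rewrite enorm_subC -ltrBrDr.
have : `|(x - y) ord0 d.1| <= euclidean_norm (x - y).
  rewrite -(@ler_pXn2r _ 2)// ?nnegrE ?enorm_ge0// real_normK ?num_real// enorm_sqr.
  by rewrite (bigD1 d.1)//= lerDl sumr_ge0// => i _; rewrite sqr_ge0.
move: xd y2; rewrite !mxE ler_norml; move: (euclidean_norm _) ((4 * n%:R)^-1) => u v.
by case: d.2 => /=; rewrite ?expr1 ?expr0 ?mulN1r ?mul1r => xd y2 /andP[h1 h2]; lra.
Qed.

(** A point of the strip is at distance at least 1 - k >= 1/2 from p, so some coordinate of x - p
    exceeds 1/(4n): otherwise its norm would be at most 1/4. The boolean records the sign that leads
    towards p. *)
Lemma annulus_cone C k x : (0 < n)%N -> 0 < k -> k <= 2^-1 -> annulus C k x ->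
  exists d, cone C k d x.
Proof.
move=> n0 k0 k1 [[p Cp xp] Nx].
have xp1 : 2^-1 <= euclidean_norm (x - p).
  rewrite leNgt; apply/negP => H; apply: Nx; exists p => //; apply: (lt_le_trans H); lra.
have nR : 0 < n%:R :> R by rewrite ltr0n.
have [i Hi] : exists i, (4 * n%:R)^-1 < `|(x - p) ord0 i|.
  apply: contrapT => N.
  have : euclidean_norm (x - p) <= n%:R * (4 * n%:R)^-1.
    apply: enorm_sup; first by rewrite invr_ge0 mulr_ge0.
    by move=> i; rewrite leNgt; apply/negP => Hi; apply: N; exists i.
  rewrite (_ : n%:R * _ = 4^-1); last by field; rewrite gt_eqF.
  by move: (euclidean_norm _) xp1 => u; clear; lra.
have [s|s] := leP 0 ((x - p) ord0 i).
  by exists (i, true), p => //; split=> //; rewrite /= expr1 mulN1r opprK; rewrite ger0_norm in Hi.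
by exists (i, false), p => //; split=> //; rewrite /= expr0 mul1r; rewrite ltr0_norm in Hi.
Qed.

(** A step t towards p lowers the squared distance by more than 2t/(4n) - t^2, which is at least
    t/(4n) for t <= 1/(4n) and so at least 8k for t >= 32nk. Since (1 + k)^2 - (1 - k)^2 = 4k, this
    crosses the whole strip. *)
Lemma cone_shift C k d x t : (0 < n)%N -> 0 < k -> k <= 2^-1 -> cone C k d x ->
  32 * n%:R * k <= t -> t <= (4 * n%:R)^-1 ->
  nbh C (1 - k) (x + ((-1) ^+ d.2 * t) *: e_ d.1).
Proof.
move=> n0 k0 k1 [p Cp [xp xd]] t1 t2; exists p => //.
have nR : 0 < n%:R :> R by rewrite ltr0n.
have t0 : 0 < t by apply: lt_le_trans t1; rewrite !mulr_gt0.
apply: enorm_lt; first by move: k1; clear; lra.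
set y := x - p; set a := (-1) ^+ d.2 * t.
have aE : a ^+ 2 = t ^+ 2 by rewrite /a exprMn -exprM mulnC exprM sqrrN !expr1n mul1r.
have -> : \sum_i (x + a *: e_ d.1 - p) ord0 i ^+ 2 =
    \sum_i y ord0 i ^+ 2 + (2 * (t * ((-1) ^+ d.2 * y ord0 d.1)) + t ^+ 2).
  rewrite (bigD1 d.1)//= [in RHS](bigD1 d.1)//= -[RHS]addrA [X in _ = _ + X]addrC addrA.
  congr (_ + _).
    by rewrite !mxE !eqxx/= mulr1 -aE /a; ring.
  by apply: eq_bigr => j jd; rewrite !mxE (negbTE jd) andbF mulr0 addr0.
rewrite -enorm_sqr.
have E0 : euclidean_norm y ^+ 2 < (1 + k) ^+ 2.
  by rewrite ltrXn2r// ?nnegrE ?enorm_ge0// ltW// addr_gt0.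
have E1 : t ^+ 2 <= t * (4 * n%:R)^-1 by rewrite expr2 ler_pM2l.
have E2 : t * (4 * n%:R)^-1 < - (t * ((-1) ^+ d.2 * y ord0 d.1)) by rewrite -mulrN ltr_pM2l.
have E3 : 8 * k <= t * (4 * n%:R)^-1.
  by rewrite ler_pdivlMr ?mulr_gt0// (le_trans _ t1)// le_eqVlt; apply/orP; left; apply/eqP; ring.
move: E0 E1 E2 E3; rewrite !sqrrD sqrrN !mulr2n !mul1r expr1n.
move: (euclidean_norm y ^+ 2) (t ^+ 2) (t * _) (t * (_ * _)) (k ^+ 2) => u v w z q.
by move: k0; clear; lra.
Qed.

(** Translates of the piece by multiples of h = 32nk up to 1/(4n) are disjoint, since such a shift
    leaves the strip. More than 1/(128 n^2 k) of them fit into a cube of side 2(M + 1), which bounds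
    the measure of each. *)
Lemma cone_annulus_measure C k M d : (0 < n)%N -> 0 < k -> k <= 2^-1 -> 0 < M ->
  (mu (annulus C k `&` cone C k d `&` cube n (- M) M) <=
   (128 * n%:R ^+ 2 * k * (2 * (M + 1)) ^+ n)%:E)%E.
Proof.
move=> n0 k0 k1 M0; set A := _ `&` _ `&` _.
have mA : measurable A.
  apply: measurableI; last exact: measurable_cube.
  by apply: measurableI; [exact: measurable_annulus|(apply: open_measurable_rV; exact: open_cone)].
have nR : 0 < n%:R :> R by rewrite ltr0n.
pose h := 32 * n%:R * k; have h0 : 0 < h by rewrite !mulr_gt0.
pose t0 : R := (4 * n%:R)^-1; have t00 : 0 < t0 by rewrite invr_gt0 mulr_gt0.
pose J := Num.truncn (t0 / h).
pose a (j : nat) : 'rV[R]_n := ((-1) ^+ d.2 * (j%:R * h)) *: e_ d.1.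
have jh (j : 'I_J.+1) : j%:R * h <= t0.
  rewrite -ler_pdivlMr//; apply: (@le_trans _ _ J%:R); first by rewrite ler_nat -ltnS.
  by rewrite /J truncn_le divr_ge0// ltW.
pose F (j : 'I_J.+1) := [set x | A (x - a j)].
have mF j : measurable (F j) by exact: measurable_translate_preimage.
have muF j : mu (F j) = mu A by exact: (lebesgue_rV_translate (- a j) mA).
have tF : trivIset setT F.
  suff H (j j' : 'I_J.+1) x : F j x -> F j' x -> (j < j')%N -> False.
    move=> j j' _ _ [x [Fj Fj']]; apply/val_inj.
    by case: (ltngtP j j') => // jj; [case: (H _ _ _ Fj Fj' jj)|case: (H _ _ _ Fj' Fj jj)].
  (* An overlap would yield two points of the strip differing by a multiple of [h]; by [cone_shift]
     one of them lies in [nbh C (1 - k)]. *)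
  move=> [[[_ N1] _] _] [[_ c2] _] jj; apply: N1.
  rewrite (_ : x - a j = (x - a j') + ((-1) ^+ d.2 * ((j' - j)%:R * h)) *: e_ d.1).
    apply: (cone_shift n0 k0 k1 c2).
      by rewrite -/h ler_peMl ?(ltW h0)// ler1n subn_gt0.
    apply: (@le_trans _ _ (j'%:R * h)); last exact: jh.
    by rewrite ler_pM2r// ler_nat leq_subr.
  rewrite /a -addrA; congr (_ + _); rewrite -!scaleNr -scalerDl; congr (_ *: _).
  rewrite natrB ?(ltnW jj)//; rewrite /GRing.scale/=; ring.
have FM j : F j `<=` cube n (- (M + 1)) (M + 1).
  move=> x [_ xM] i; rewrite /= in_itv/= -ler_norml.
  have := cube_bound i xM; rewrite !mxE => H.
  have : `|(-1) ^+ d.2 * (j%:R * h) * (e_ d.1) ord0 i| <= 1.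
    rewrite normrM [X in X * _]normrM normrX normrN1 expr1n mul1r.
    rewrite (@ger0_norm _ (j%:R * h)); last by rewrite mulr_ge0// ltW.
    apply: (@le_trans _ _ (t0 * 1)).
      rewrite ler_pM//; [by rewrite mulr_ge0// ltW|].
      by rewrite mxE eqxx/=; case: eqP => _; rewrite ?normr0 ?normr1.
    rewrite mulr1 /t0 invf_le1 ?mulr_gt0//.
    by have : 1 <= n%:R :> R; [rewrite ler1n|move: (n%:R : R) => z; clear; lra].
  move: H; rewrite !mxE; move: (x ord0 i) ((-1) ^+ d.2 * _ * _) => y c.
  by rewrite !ler_norml; clear => /andP[h1 h2] /andP[h3 h4]; apply/andP; split; lra.
have : (\sum_(j < J.+1) mu A <= ((2 * (M + 1)) ^+ n)%:E)%E.
  rewrite -(eq_bigr _ (fun j _ => muF j)).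
  have mU : measurable (\big[setU/set0]_(j < J.+1) F j) by exact: bigsetU_measurable.
  rewrite -(measure_semi_additive_ord mu mF tF mU).
  have <- : mu (cube n (- (M + 1)) (M + 1)) = ((2 * (M + 1)) ^+ n)%:E.
    rewrite lebesgue_box_itv; last by move: M0; clear; lra.
    by congr ((_ ^+ n)%:E); ring.
  apply: le_measure; rewrite ?inE//; first exact: measurable_cube.
  by rewrite -bigcup_mkord_ord => x [j _]; exact: FM.
have Afin : mu A \is a fin_num.
  rewrite ge0_fin_numE//; apply: le_lt_trans (cube_fin_measure n M).
  by apply: le_measure; rewrite ?inE//; [exact: measurable_cube|move=> x []].
rewrite -(fineK Afin) sumEFin sumr_const card_ord !lee_fin -(mulr_natl (fine _)) => H.
have J1 : t0 / h < J.+1%:R by apply: truncnS_gt.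
have m0 : 0 <= fine (mu A) by rewrite fine_ge0.
have : t0 / h * fine (mu A) <= (2 * (M + 1)) ^+ n.
  by apply: le_trans H; rewrite ler_wpM2r// ltW.
have -> : t0 / h = (128 * n%:R ^+ 2 * k)^-1.
  by rewrite /t0 /h; field; rewrite !gt_eqF.
by rewrite ler_pdivrMl// !mulr_gt0// exprn_gt0.
Qed.

End euclidean.

(** * Cutting off near the boundary of a 1-neighbourhood *)

Section localization.
Context {R : realType} (n : nat).
Implicit Types (x y p : 'rV[R]_n) (C E : set 'rV[R]_n) (i : 'I_n) (f : 'rV[R]_n -> R).

Local Notation mu := (@lebesgue_rV R n).
Local Notation e_ i := (delta_mx ord0 i : 'rV[R]_n).
Local Notation sqn f := (ip mu setT f f).

(** The margin d, uniform over [C], expresses a distance strictly larger than 1 even when it is not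
    attained, and makes the set open. *)
Definition far C : set 'rV[R]_n :=
  [set x | exists2 d, 0 < d & forall p, C p -> 1 + d <= euclidean_norm (x - p)].

Lemma open_far C : open (far C).
Proof.
apply: open_enorm_near => x [d d0 Hd]; exists (d / 2); first by rewrite divr_gt0.
move=> y xy; exists (d / 2); first by rewrite divr_gt0.
move=> p Cp; have := Hd p Cp; have := enorm_dist x y p.
move: xy; move: (euclidean_norm _) (euclidean_norm _) (euclidean_norm _) => a b c; clear; lra.
Qed.

Lemma measurable_nbh C r : measurable (nbh C r).
Proof. by apply: open_measurable_rV; exact: open_nbh. Qed.

Lemma measurable_cone C k d : measurable (annulus C k `&` cone C k d).
Proof.
apply: measurableI; first exact: measurable_annulus.
by apply: open_measurable_rV; exact: open_cone.
Qed.

(** The strip splits into 2n cone pieces, each of measure O(k). It will be applied to the gradient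
    of one fixed test function, whose bound [L] is not uniform along the sequence. *)
Lemma annulus_sqn_le C k M (L : R) f : (0 < n)%N -> 0 < k -> k <= 2^-1 -> 0 < M ->
  measurable_fun setT f -> (forall x, `|f x| <= L) -> (forall x, f x != 0 -> cube n (- M) M x) ->
  ip mu (annulus C k) f f <= (2 * n)%:R * (L ^+ 2 * (128 * n%:R ^+ 2 * k * (2 * (M + 1)) ^+ n)).
Proof.
move=> n0 k0 k1 M0 mf fL fM.
have L0 : 0 <= L by exact: le_trans (normr_ge0 _) (fL 0).
have bf : bounded_support f.
  apply: bounded_supportP => //; exists L, M; split=> // x fx i.
  exact: cube_bound (fM x fx).
have sf := bounded_support_sqint bf.
pose A d := annulus C k `&` cone C k d `&` cube n (- M) M.
have mA d : measurable (A d) by apply: measurableI; [exact: measurable_cone|exact: measurable_cube].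
have mAC := @measurable_annulus R n C k.
have mcube := @measurable_cube R n (- M) M.
have -> : ip mu (annulus C k) f f = ip mu (annulus C k `&` cube n (- M) M) f f.
  rewrite /ip [RHS]Rintegral_mkcondr; apply: eq_Rintegral => x _; rewrite patchE.
  case: ifPn => // /negP xM.
  have [->|/fM/mem_set //] := eqVneq (f x) 0; by rewrite mul0r.
apply: (@le_trans _ _ (\sum_d ip mu (A d) f f)).
  apply: sqn_cover => //; first exact: measurableI.
  by move=> x [xA xM]; have [d xd] := annulus_cone n0 k0 k1 xA; exists d.
have -> : (2 * n)%:R = #|{: 'I_n * bool}|%:R :> R by rewrite card_prod card_ord card_bool mulnC.
rewrite mulr_natl -sumr_const; apply: ler_sum => d _.
have Ad := cone_annulus_measure C d n0 k0 k1 M0.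
have Afin : (mu (A d) < +oo)%E by apply: le_lt_trans Ad _; rewrite ltry.
have Afn : mu (A d) \is a fin_num by rewrite ge0_fin_numE.
have sL : sqint mu (A d) (cst L) by apply: (@sqint_cst _ _ _ mu _ (mA d) (fine (mu (A d)))); rewrite fineK.
apply: (@le_trans _ _ (ip mu (A d) (cst L) (cst L))).
  apply: sqn_le => //; first exact: measurable_funS mf.
  by move=> x _; rewrite /= (ger0_norm L0).
rewrite /ip (@eq_Rintegral _ _ _ mu _ (cst (L ^+ 2))); last by move=> x _; rewrite expr2.
rewrite Rintegral_cst// ler_wpM2l ?sqr_ge0//.
by rewrite -lee_fin fineK.
Qed.

Lemma annulus_shift C k t x s i (b : bool) : annulus C k x -> 0 <= s <= t ->
  annulus C (k + t) (x + ((-1) ^+ b * s) *: e_ i).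
Proof.
move=> [xk Nx] /andP[s0 st].
have As : euclidean_norm (((-1) ^+ b * s) *: e_ i) <= s.
  by rewrite enorm_delta normrM normrX normrN1 expr1n mul1r ger0_norm.
split.
  have := nbh_shift As xk; apply: nbh_le; by rewrite addrA lerD2l.
move=> H; apply: Nx; have := @nbh_shift _ _ C _ _ (- (((-1) ^+ b * s) *: e_ i)) s _ H.
rewrite enormN addrK => /(_ As); apply: nbh_le; move: st; clear; lra.
Qed.

(* A Hardy inequality: a translation of length [32 n k] along some coordinate
   axis carries each point of [annulus C k] into [nbh C (1 - k)]. *)
Lemma hardy omega C k psi : (0 < n)%N -> 0 < k -> k <= 2^-1 -> 32 * n%:R * k <= (4 * n%:R)^-1 ->
  test_function omega psi ->
  ip mu (nbh C (1 + k)) psi psi <= (1 + 4 * n%:R) * ip mu (nbh C 1) psi psi +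
    2 * (32 * n%:R * k) ^+ 2 * \sum_(d : 'I_n * bool)
       ip mu (annulus C (k + 32 * n%:R * k)) (partial d.1 psi) (partial d.1 psi).
Proof.
move=> n0 k0 k1; set t := 32 * n%:R * k => tle tpsi.
have nR : 0 < n%:R :> R by rewrite ltr0n.
have t0 : 0 < t by rewrite !mulr_gt0.
have bpsi := test_function_bs tpsi; have mpsi := bpsi.1.
have spsi := test_function_sqint tpsi.
have mD := measurable_nbh C 1.
apply: (@le_trans _ _ (\sum_(b : bool) ip mu (if b then nbh C 1 else annulus C k) psi psi)).
  apply: sqn_cover => //; first exact: measurable_nbh.
    by case=> //; exact: measurable_annulus.
  move=> x xk; have [xD|xD] := pselect (nbh C (1 - k) x).
    by exists true; apply: nbh_le xD; move: k0; clear; lra.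
  by exists false.
rewrite big_bool.
have H d : ip mu (annulus C k `&` cone C k d) psi psi <=
   2 * ip mu (nbh C 1) psi psi + 2 * (t ^+ 2 * ip mu (annulus C (k + t)) (partial d.1 psi) (partial d.1 psi)).
  set A := annulus C k `&` cone C k d; have mA : measurable A by exact: measurable_cone.
  pose a := ((-1) ^+ d.2 * t) *: e_ d.1.
  (* The shifted value is taken inside [nbh C (1 - k)], where it is controlled by the norm on
     [nbh C 1]; the increment is controlled by the gradient on the strip widened by t. *)
  have -> : psi = (fun x => psi (x + a)) - increment psi a.
    by apply/funext => x; rewrite !fctE /increment opprB addrC subrK.
  have bta := bounded_support_translate a bpsi.
  have sA := sqint_subset mA measurableT (@subsetT _ _) (bounded_support_sqint bta).
  have sI := sqint_subset mA measurableT (@subsetT _ _) (bounded_support_sqint (increment_bs a bpsi)).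
  apply: (le_trans (sqnB_le2 mA sA sI)); apply: lerD; rewrite ler_pM2l//.
    have -> : (fun x => psi (x + a)) - increment psi a = psi.
      by apply/funext => x; rewrite !fctE /increment opprB addrC subrK.
    rewrite -(ip_translate a mD mpsi).
    have mDa := measurable_translate_preimage a mD.
    apply: sqn_subset => //.
      move=> x [_ xc] /=; have := cone_shift n0 k0 k1 xc (lexx _) tle.
      by apply: nbh_le; move: k0; clear; lra.
    exact: (sqint_subset mDa measurableT (@subsetT _ _) (bounded_support_sqint bta)).
  have -> : (fun x => psi (x + a)) - increment psi a = psi.
    by apply/funext => x; rewrite !fctE /increment opprB addrC subrK.
  apply: (sqn_increment_sign_le tpsi) => //; first exact: measurable_annulus.
  by move=> x s [xA _] st; exact: annulus_shift.
have cov : ip mu (annulus C k) psi psi <= \sum_(d : 'I_n * bool) ip mu (annulus C k `&` cone C k d) psi psi.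
  apply: sqn_cover => //; [exact: measurable_annulus|by move=> d; exact: measurable_cone|].
  by move=> x xA; have [d xd] := annulus_cone n0 k0 k1 xA; exists d.
have : \sum_(d : 'I_n * bool) ip mu (annulus C k `&` cone C k d) psi psi <=
    \sum_(d : 'I_n * bool) (2 * ip mu (nbh C 1) psi psi + 2 * (t ^+ 2 * ip mu (annulus C (k + t)) (partial d.1 psi) (partial d.1 psi))).
  by apply: ler_sum => d _; exact: H.
rewrite [leRHS]big_split/= sumr_const card_prod card_ord card_bool -!mulr_sumr -[X in X + _]mulr_natr natrM.
move: cov; move: (\sum_(d : 'I_n * bool) ip mu (annulus C k `&` _) psi psi) => S1.
move: (\sum_(d : 'I_n * bool) _) (ip mu (nbh C 1) _ _) (ip mu (annulus C k) _ _) (t ^+ 2) => S2 a b t2 h1 h2.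
have h3 : (1 + 4 * n%:R) * a + 2 * t2 * S2 = a + (2 * a * (n%:R * 2) + 2 * (t2 * S2)) by ring.
by rewrite h3 lerD2l; exact: le_trans h1 h2.
Qed.

(** A sup-norm ball of radius d has Euclidean radius at most n d. Grid points are kept from distance
    1 + 2nd on, so the support stays beyond 1 + nd and the cutoff is 1 beyond 1 + 3nd; the extra nd
    makes it locally constant beyond 1 + 4nd. *)
Lemma exists_far_cutoff : (0 < n)%N -> exists2 K : R, 0 < K & forall C omega (d M : R), open omega ->
  0 < d -> 0 < M -> omega `<=` cube n (- M) M ->
  exists eta : 'rV[R]_n -> R, [/\ smooth eta, forall x, 0 <= eta x <= 1,
    forall x, eta x != 0 -> forall p, C p -> 1 + n%:R * d <= euclidean_norm (x - p),
    forall x, omega x -> ~ nbh C (1 + 4 * n%:R * d) x -> eta x = 1 /\ forall i, partial i eta x = 0 &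
    forall i x, `|partial i eta x| <= K / d].
Proof.
move=> n0; have nR : 0 < n%:R :> R by rewrite ltr0n.
have [K K0 HK] := @exists_cutoff R n; exists K => // C omega d M oo d0 M0 oM.
pose G q := forall p, C p -> 1 + 2 * n%:R * d <= euclidean_norm (q - p).
have [eta [seta eta01 etaG eta1 etaK]] := HK G d M d0 M0.
exists eta; split=> //.
  move=> x /etaG[q Gq xq] p Cp; have := Gq p Cp; have := enorm_dist q x p.
  have := ball_enorm d0 (ball_sym xq).
  move: (euclidean_norm _) (euclidean_norm _) (euclidean_norm _) (n%:R * d) (mulrA 2 (n%:R) d) => a b c z <-.
  clear; lra.
have one y : omega y -> (forall p, C p -> 1 + 3 * (n%:R * d) <= euclidean_norm (y - p)) -> eta y = 1.
  move=> oy Hy; apply: eta1; first exact: oM.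
  move=> q yq p Cp; have := Hy p Cp; have := enorm_dist y q p; have := ball_enorm d0 yq.
  rewrite -mulrA; move: (euclidean_norm _) (euclidean_norm _) (euclidean_norm _) (n%:R * d) => a b c z.
  clear; lra.
have nd0 : 0 < n%:R * d by rewrite mulr_gt0.
move=> x ox Nx.
have Hx p : C p -> 1 + 4 * (n%:R * d) <= euclidean_norm (x - p).
  by move=> Cp; rewrite leNgt; apply/negP => H; apply: Nx; exists p => //; rewrite -mulrA.
split.
  by apply: one => // p /Hx; move: (euclidean_norm _) nd0 => a; move: (n%:R * d) => z; clear; lra.
move=> i; rewrite /partial (near_eq_derive (g := cst (1 : R))) ?derive_cst//.
have : nbhs x (omega `&` ball x d).
  by apply: filterI; [exact: open_nbhs_nbhs|exact: nbhsx_ballx].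
apply: filterS => y [oy xy]; apply: one => // p /Hx.
have := enorm_dist x y p; have := ball_enorm d0 xy.
move: (euclidean_norm _) (euclidean_norm _) (euclidean_norm _) (n%:R * d) => a b c z.
by clear; lra.
Qed.

(** The function is [psi m * eta]. The order of choices matters: [m1] makes later gradients close to
    that of [psi m1]; then the width [d] makes the latter small on the strip; then m makes [psi m]
    small inside [nbh C 1] even compared with d^2, which pays for the factor (K/d)^2 of the
    cutoff. *)
Lemma exists_localized_test_function omega C M (u : 'rV[R]_n -> R) psi (B : R) : (0 < n)%N -> open omega -> 0 < M ->
  omega `<=` cube n (- M) M -> sqint mu setT u -> sqn u = 1 -> ip mu (nbh C 1) u u = 0 ->
  (forall m, test_function omega (psi m)) -> sqn (psi m - u) @[m --> \oo] --> 0 ->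
  (forall m, energy (psi m) <= B + m.+1%:R^-1) ->
  (forall e, 0 < e -> exists N, forall m k, (N <= m)%N -> (N <= k)%N ->
         energy (psi m - psi k) <= e) ->
  forall s tau, 0 < s -> 0 < tau -> exists f, [/\ test_function (omega `&` far C) f,
    energy f <= (1 + s) * (B + tau) + (1 + s^-1) * tau &
    1 - tau <= (1 + s) * sqn f + (1 + s^-1) * tau].
Proof.
move=> n0 oo M0 oM su u1 uD tpsi cpsi psiE psiC s tau s0 tau0.
have nR : 0 < n%:R :> R by rewrite ltr0n.
have [K K0 HK] := exists_far_cutoff n0.
have spsi m := test_function_sqint (tpsi m).
have sgrad i m := test_function_partial_sqint i (tpsi m).
pose N_ : R := n%:R.
(* The Hardy inequality with t = 128 n^2 d, mass at most tau1 d^2 inside and 2n gradient terms of at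
   most 4 tau1 bounds the mass on [nbh C (1 + k)] by Gam tau1 d^2. *)
pose Gam : R := 1 + 4 * N_ + 16 * N_ * (128 * N_ ^+ 2) ^+ 2.
have N0 : 0 < N_ by [].
have Gam0 : 0 < Gam.
  by rewrite /Gam ltr_wpDr ?mulr_ge0 ?sqr_ge0 ?(ltW N0)// ltr_wpDr ?mulr_ge0 ?(ltW N0).
(* The denominator absorbs both final errors: n K^2 Gam tau1 in the energy and Gam tau1 in the
   norm. *)
pose tau1 := tau / (N_ * K ^+ 2 * Gam + Gam + 1).
have den0 : 0 < N_ * K ^+ 2 * Gam + Gam + 1.
  exact: addr_gt0 (addr_gt0 (mulr_gt0 (mulr_gt0 N0 (exprn_gt0 2 K0)) Gam0) Gam0) ltr01.
have tau10 : 0 < tau1 by rewrite divr_gt0.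
have [m1 Hm1] := psiC tau1 tau10.
have /choice[L_ HL] : forall i, exists L, forall x, `|partial i (psi m1) x| <= L.
  by move=> i; have [_ [L [HL _]]] := test_function_partial_bs i (tpsi m1); exists L.
pose L := \sum_i `|L_ i|.
have LP i x : `|partial i (psi m1) x| <= L.
  apply: (le_trans (HL i x)); apply: (le_trans (ler_norm _)).
  by rewrite /L (bigD1 i)//= lerDl sumr_ge0.
(* The bound of [annulus_sqn_le] for [psi m1] on the strip of half-width k + t, divided by d. *)
pose W := (2 * n)%:R * (L ^+ 2 * (128 * N_ ^+ 2 * (4 * N_ + 128 * N_ ^+ 2) * (2 * (M + 1)) ^+ n)).
have Y0 : 0 < 4 * N_ + 128 * N_ ^+ 2.
  exact: addr_gt0 (mulr_gt0 (ltr0Sn _ _) N0) (mulr_gt0 (ltr0Sn _ _) (exprn_gt0 2 N0)).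
have V0 : 0 < 128 * N_ ^+ 2 by exact: mulr_gt0 (ltr0Sn _ _) (exprn_gt0 2 N0).
have W0 : 0 <= W.
  apply: mulr_ge0 (ler0n _ _) (mulr_ge0 (sqr_ge0 _) (mulr_ge0 _ _)).
    exact: ltW (mulr_gt0 V0 Y0).
  by apply: exprn_ge0; exact: (ltW (mulr_gt0 (ltr0Sn _ _) (addr_gt0 M0 ltr01))).
pose d1 := Num.min 1 (tau1 / (W + 1)).
(* The two bounds guarantee k + t <= 1/2 and t <= 1/(4n), as required by the geometric lemmas. *)
pose d2 := Num.min (2 * (4 * N_ + 128 * N_ ^+ 2))^-1 (512 * N_ ^+ 3)^-1.
pose d := Num.min d1 d2.
have Z0 : 0 < 512 * N_ ^+ 3 by exact: mulr_gt0 (ltr0Sn _ _) (exprn_gt0 3 N0).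
have d20 : 0 < d2.
  by rewrite lt_min; apply/andP; split; rewrite invr_gt0; [exact: mulr_gt0 (ltr0Sn _ _) Y0|exact: Z0].
have d10 : 0 < d1 by rewrite lt_min ltr01 divr_gt0 ?ltr_wpDl.
have d0 : 0 < d by rewrite lt_min d10 d20.
have dle1 : d <= 1 by rewrite !ge_min lexx.
have dleW : d * W <= tau1.
  have : d <= tau1 / (W + 1) by rewrite !ge_min lexx orbT.
  rewrite ler_pdivlMr ?ltr_wpDl// => h; apply: le_trans h.
  by rewrite ler_pM2l// lerDl.
have dle2 : (4 * N_ + 128 * N_ ^+ 2) * d <= 2^-1.
  have : d <= (2 * (4 * N_ + 128 * N_ ^+ 2))^-1 by rewrite !ge_min lexx !orbT.
  by rewrite invfM mulrC -ler_pdivlMl.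
have dle3 : 512 * N_ ^+ 3 * d <= 1.
  have : d <= (512 * N_ ^+ 3)^-1 by rewrite !ge_min lexx !orbT.
  by rewrite -[X in _ <= X]mulr1 (ler_pdivlMl _ _ Z0).
pose k := 4 * N_ * d.
have k0 : 0 < k by exact: mulr_gt0 (mulr_gt0 (ltr0Sn _ _) N0) d0.
pose t := 32 * N_ * k.
have tE : t = 128 * N_ ^+ 2 * d by rewrite /t /k; ring.
have kt : k + t = (4 * N_ + 128 * N_ ^+ 2) * d by rewrite tE /k; ring.
have t0 : 0 < t by exact: mulr_gt0 (mulr_gt0 (ltr0Sn _ _) N0) k0.
have kt1 : k + t <= 2^-1 by rewrite kt.
have k1 : k <= 2^-1 by apply: le_trans kt1; rewrite lerDl ltW.
have t1 : t <= (4 * N_)^-1.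
  rewrite -[leRHS]mul1r (ler_pdivlMr _ _ (mulr_gt0 (ltr0Sn _ _) N0)) tE.
  by apply: le_trans dle3; rewrite le_eqVlt; apply/orP; left; apply/eqP; ring.
have [eta [seta eta01 etaC eta1 etaK]] := HK C omega d M oo d0 M0 oM.
have mD := measurable_nbh C 1.
have cD : ip mu (nbh C 1) (psi m) (psi m) @[m --> \oo] --> 0.
  by rewrite -uD; exact: cvg_sqn_restrict.
have c1 : sqn (psi m) @[m --> \oo] --> (1 : R) by rewrite -u1; exact: cvg_sqn.
have [m [mm1 mD1 mtau mone]] : exists m, [/\ (m1 <= m)%N,
    ip mu (nbh C 1) (psi m) (psi m) <= tau1 * d ^+ 2, m.+1%:R^-1 <= tau & 1 - tau <= sqn (psi m)].
  have e1 : 0 < tau1 * d ^+ 2 by rewrite mulr_gt0// exprn_gt0.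
  have /cvgrPdist_le/(_ _ e1)[a1 _ A1] := cD.
  have /cvgrPdist_le/(_ _ tau0)[a2 _ A2] := c1.
  have [a3 _ A3] := near_infty_natSinv_lt (PosNum tau0).
  pose m := (m1 + a1 + a2 + a3)%N.
  exists m; split.
  - by rewrite /m -!addnA leq_addr.
  - have := A1 m; rewrite /= sub0r normrN ger0_norm ?sqn_ge0//; apply.
    by rewrite /m -!addnA addnCA leq_addr.
  - by apply/ltW/A3; rewrite /= /m leq_addl.
  - rewrite lerBlDr addrC -lerBlDr; apply: (le_trans (ler_norm _)); apply: A2.
    by rewrite /= /m; exact: (leq_trans (leq_addl (m1 + a1)%N a2) (leq_addr a3 _)).
have psim := tpsi m; have [spm _ _] := psim.
set R0 := ip mu (nbh C (1 + k)) (psi m) (psi m).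
have R0le : R0 <= d ^+ 2 * (Gam * tau1).
  apply: (le_trans (@hardy omega C k (psi m) n0 k0 k1 t1 psim)).
  rewrite -/t.
  have ann (e : 'I_n * bool) : ip mu (annulus C (k + t)) (partial e.1 (psi m)) (partial e.1 (psi m)) <= 4 * tau1.
    have mA := @measurable_annulus R n C (k + t).
    have sA g := @sqint_subset _ _ _ mu _ _ g mA measurableT (@subsetT _ _).
    rewrite -[partial e.1 (psi m)](subrK (partial e.1 (psi m1))).
    apply: (le_trans (sqnD_le2 mA (sA _ (sqintB measurableT (sgrad e.1 m) (sgrad e.1 m1))) (sA _ (sgrad e.1 m1)))).
    have h1 : ip mu (annulus C (k + t)) (partial e.1 (psi m) - partial e.1 (psi m1)) (partial e.1 (psi m) - partial e.1 (psi m1)) <= tau1.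
      apply: (@le_trans _ _ (sqn (partial e.1 (psi m) - partial e.1 (psi m1)))).
        by apply: sqn_subset => //; exact: sqintB.
      apply: le_trans (Hm1 m m1 mm1 (leqnn _)).
      rewrite -partialB; [exact: sqn_partial_le_energy|by []|by case: (tpsi m1)].
    have h2 : ip mu (annulus C (k + t)) (partial e.1 (psi m1)) (partial e.1 (psi m1)) <= tau1.
      apply: le_trans dleW.
      have := @annulus_sqn_le C (k + t) M L (partial e.1 (psi m1)) n0 (addr_gt0 k0 t0) kt1 M0 _ (LP e.1).
      move=> H; apply: (le_trans (H _ _)).
      - by apply: smooth_measurable; apply: smooth_partial; case: (tpsi m1).
      - move=> x px; apply: oM; apply: contrapT => ox; move/eqP : px; apply.
        exact: test_function_eq0 (test_function_partial e.1 (tpsi m1)) ox.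
      - by rewrite kt /W -/N_ le_eqVlt; apply/orP; left; apply/eqP; ring.
    by move: h1 h2; move: (ip _ _ _ _) (ip _ _ _ _) => a b; clear; lra.
  have h : \sum_(e : 'I_n * bool) ip mu (annulus C (k + t)) (partial e.1 (psi m)) (partial e.1 (psi m)) <= N_ * 2 * (4 * tau1).
    apply: (@le_trans _ _ (\sum_(e : 'I_n * bool) 4 * tau1)); first by apply: ler_sum => e _; exact: ann.
    by rewrite sumr_const card_prod card_ord card_bool -[leLHS]mulr_natl natrM.
  apply: (@le_trans _ _ ((1 + 4 * N_) * (tau1 * d ^+ 2) + 2 * t ^+ 2 * (N_ * 2 * (4 * tau1)))).
    apply: lerD; last by rewrite ler_wpM2l// mulr_ge0// sqr_ge0.
    by rewrite ler_wpM2l// addr_ge0// mulr_ge0// ltW.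
  by rewrite tE /Gam le_eqVlt; apply/orP; left; apply/eqP; ring.
have mN := measurable_nbh C (1 + k).
have spN := sqint_subset mN measurableT (@subsetT _ _) (spsi m).
have supp0 x : ~ omega x -> psi m x = 0 by exact: test_function_eq0 psim.
have meta : measurable_fun setT eta by exact: smooth_measurable.
have mpsi j : measurable_fun setT (psi j) by exact: (spsi j).1.
have kE : 1 + 4 * n%:R * d = 1 + k by [].
have tf : test_function (omega `&` far C) (psi m * eta).
  have [_ cK Ko] := psim.
  (* A closed set with the fixed margin n d inside [far C]; intersecting it with the support of
     [psi m] leaves a compact set in the open target. *)
  pose F := [set x | forall p, C p -> 1 + N_ * d <= euclidean_norm (x - p)].
  have cF : closed F.
    rewrite -[F]setCK; apply: open_closedC; apply: open_enorm_near => x /= /existsNP[p /not_implyP[Cp /negP]].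
    rewrite -ltNge => H; exists (1 + N_ * d - euclidean_norm (x - p)); first by rewrite subr_gt0.
    move=> y xy Fy; have := Fy p Cp; apply/negP; rewrite -ltNge.
    apply: le_lt_trans (enorm_dist _ x _) _.
    by rewrite enorm_subC -ltrBrDr.
  apply: (@test_function_of_support _ _ _ (closure [set x | psi m x != 0] `&` F)).
  - exact: smoothM.
  - apply: (subclosed_compact _ cK); last by move=> x [].
    by apply: closedI => //; exact: closed_closure.
  - by move=> x [xK xF]; split; [exact: Ko|exists (N_ * d); [rewrite mulr_gt0|]].
  - move=> x; rewrite mulf_eq0 negb_or => /andP[px ex]; split; first exact: subset_closure.
    by move=> p; exact: etaC.
exists (psi m * eta); split => //.
(* The term with the derivative of the cutoff lives in [nbh C (1 + k)], where the d^2 in the bound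
   on [R0] cancels (K/d)^2. *)
- have sN i : sqn (psi m * partial i eta) <= K ^+ 2 * (Gam * tau1).
    have mpe : measurable_fun setT (psi m * partial i eta).
      exact: smooth_measurable (smoothM spm (smooth_partial i seta)).
    rewrite -(@ip_supported _ _ _ mu (nbh C (1 + k))); last first.
      move=> x Nx; have [ox|ox] := pselect (omega x).
        by rewrite fctE (eta1 x ox Nx).2 mulr0 mul0r.
      by rewrite fctE supp0// !mul0r.
    apply: (@le_trans _ _ (ip mu (nbh C (1 + k)) ((K / d) *: psi m) ((K / d) *: psi m))).
      apply: sqn_le => //; [exact: measurable_funS mpe|exact: sqintZ|].
      move=> x _; rewrite !fctE !normrM mulrC ler_wpM2r//.
      by apply: le_trans (etaK i x) _; rewrite -normrM ler_norm.
    rewrite sqnZ// -/R0 exprMn exprVn.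
    rewrite -mulrA ler_wpM2l ?sqr_ge0//.
    by rewrite ler_pdivrMl// exprn_gt0.
  apply: (@le_trans _ _ (\sum_i ((1 + s) * sqn (partial i (psi m)) + (1 + s^-1) * (K ^+ 2 * (Gam * tau1))))).
    apply: ler_sum => i _; rewrite partialM// addrC.
    have se : sqint mu setT (eta * partial i (psi m)).
      apply: (@sqint_le _ _ _ mu setT measurableT _ (partial i (psi m))) => //.
        exact: smooth_measurable (smoothM seta (smooth_partial i spm)).
      move=> x _; rewrite fctE normrM ler_piMl//.
      by have /andP[h1 h2] := eta01 x; rewrite ger0_norm.
    have sp : sqint mu setT (psi m * partial i eta).
      exact: test_function_sqint (test_functionM psim (smooth_partial i seta)).
    apply: (le_trans (sqnD_le measurableT s0 se sp)); apply: lerD.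
      rewrite ler_pM2l ?addr_gt0//; apply: sqn_le => //; first by case: se.
      move=> x _; rewrite fctE normrM ler_piMl//.
      by have /andP[h1 h2] := eta01 x; rewrite ger0_norm.
    by rewrite ler_pM2l ?addr_gt0 ?invr_gt0.
  rewrite big_split/= -mulr_sumr -/(energy (psi m)) sumr_const card_ord -[X in _ + X]mulr_natl -/N_.
  apply: lerD.
    rewrite ler_pM2l ?addr_gt0//; apply: (le_trans (psiE m)).
    by rewrite lerD2l.
  rewrite mulrCA ler_pM2l ?addr_gt0 ?invr_gt0//.
  have -> : N_ * (K ^+ 2 * (Gam * tau1)) = N_ * K ^+ 2 * Gam * tau1 by ring.
  rewrite /tau1 mulrA ler_pdivrMr// [leRHS]mulrC ler_pM2r//.
  by rewrite -addrA lerDl addr_ge0// ltW.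
- have sf := test_function_sqint tf.
  (* The part removed by the cutoff; it also lives in [nbh C (1 + k)], so the norm is almost
     preserved. *)
  pose g := psi m * (fun x => 1 - eta x).
  have mg : measurable_fun setT g.
    by apply: (measurable_funM (mpsi m)); apply: measurable_funB.
  have gle x : `|g x| <= `|psi m x|.
    rewrite /g fctE normrM ler_piMr//; have /andP[h1 h2] := eta01 x.
    by rewrite ger0_norm ?subr_ge0// lerBlDr lerDl.
  have sg : sqint mu setT g by apply: (@sqint_le _ _ _ mu setT measurableT _ (psi m)).
  have g0 : sqn g <= tau.
    rewrite -(@ip_supported _ _ _ mu (nbh C (1 + k))); last first.
      move=> x Nx; have [ox|ox] := pselect (omega x).
        by rewrite /g fctE (eta1 x ox Nx).1 subrr mulr0 mul0r.
      by rewrite /g fctE supp0// !mul0r.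
    apply: (@le_trans _ _ R0).
      by apply: sqn_le => //; exact: measurable_funS mg.
    apply: (le_trans R0le); apply: (@le_trans _ _ (Gam * tau1)).
      by apply: ler_piMl; [exact: mulr_ge0 (ltW Gam0) (ltW tau10)|apply: exprn_ile1 dle1; exact: ltW].
    rewrite /tau1 mulrA ler_pdivrMr// [leRHS]mulrC ler_pM2r//.
    rewrite -addrA addrCA lerDl addr_ge0// mulr_ge0 ?(ltW Gam0)//.
    by rewrite mulr_ge0 ?sqr_ge0// ltW.
  apply: (le_trans mone).
  rewrite [X in ip mu setT X X](_ : psi m = psi m * eta + g); last first.
    by apply/funext => x; rewrite /g !fctE; ring.
  apply: (le_trans (sqnD_le measurableT s0 sf sg)).
  by rewrite lerD2l ler_pM2l ?addr_gt0 ?invr_gt0.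
Qed.

(** The localized functions are almost normalized with energy almost at most B; first tau and then s
    tends to 0. *)
Lemma rayleigh_localized omega C M u psi (B : R) : (0 < n)%N -> open omega -> 0 < M ->
  omega `<=` cube n (- M) M -> sqint mu setT u -> sqn u = 1 -> ip mu (nbh C 1) u u = 0 ->
  (forall m, test_function omega (psi m)) -> sqn (psi m - u) @[m --> \oo] --> 0 ->
  (forall m, energy (psi m) <= B + m.+1%:R^-1) ->
  (forall e, 0 < e -> exists N, forall m k, (N <= m)%N -> (N <= k)%N ->
         energy (psi m - psi k) <= e) ->
  0 <= B ->
  (omega `&` far C) !=set0 /\ rayleigh (omega `&` far C) <= B.
Proof.
move=> n0 oo M0 oM su u1 uD tpsi cpsi psiE psiC B0.
have loc := exists_localized_test_function n0 oo M0 oM su u1 uD tpsi cpsi psiE psiC.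
split.
  (* With s = 1 and tau = 1/4 the mass bound reads 3/4 <= 2 [sqn f] + 1/2, so f is nonzero and its
     support supplies a point. *)
  have [|f [tf _ h]] := loc 1 4^-1 ltr01; first by rewrite invr_gt0.
  have [[x fx]|N] := pselect (exists x, f x != 0).
    by exists x; apply: contrapT => ox; move/eqP : fx; apply; exact: test_function_eq0 tf ox.
  have f0 : f = 0.
    by apply/funext => x; apply/eqP; apply: contrapT => /negP fx; apply: N; exists x.
  by move: h; rewrite f0 sqn0// invr1 mulr0; lra.
have r0 := rayleigh_ge0 (omega `&` far C).
set lam := rayleigh _ in r0 *.
have step s : 0 < s -> lam <= (1 + s) ^+ 2 * B.
  move=> s0; apply/ler_addgt0Pr => e e0.
  pose c := 1 + s^-1; have c0 : 0 < c by rewrite addr_gt0 ?invr_gt0.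
  (* The total coefficient of tau in the combined estimates, plus 1 to make it positive. *)
  pose q := lam * (1 + c) + (1 + s) * ((1 + s) + c) + 1.
  have q0 : 0 < q.
    have s1 := addr_gt0 ltr01 s0.
    rewrite ltr_wpDl// addr_ge0//; first by rewrite mulr_ge0// ltW// addr_gt0.
    by rewrite mulr_ge0// ltW// addr_gt0.
  have [|f [tf Ef hf]] := loc s (e / q) s0; first by rewrite divr_gt0.
  have rf := rayleigh_le tf; rewrite -/lam in rf.
  rewrite -/c in Ef hf; set tau := e / q in Ef hf.
  have eE : e = q * tau by rewrite /tau mulrC divfK// gt_eqF.
  have h1 : lam * (1 - tau) <= lam * ((1 + s) * sqn f + c * tau) by rewrite ler_wpM2l.
  have h2 : (1 + s) * (lam * sqn f) <= (1 + s) * ((1 + s) * (B + tau) + c * tau).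
    by rewrite ler_pM2l ?addr_gt0//; exact: le_trans rf Ef.
  have tau0 : 0 < tau by rewrite divr_gt0.
  rewrite eE /q -subr_ge0.
  have -> : (1 + s) ^+ 2 * B + (lam * (1 + c) + (1 + s) * (1 + s + c) + 1) * tau - lam =
    (lam * ((1 + s) * sqn f + c * tau) - lam * (1 - tau)) +
    ((1 + s) * ((1 + s) * (B + tau) + c * tau) - (1 + s) * (lam * sqn f)) + tau by ring.
  by apply: addr_ge0 (ltW tau0); apply: addr_ge0; rewrite subr_ge0.
apply/ler_addgt0Pr => e e0.
(* For s <= 1 one has (1 + s)^2 B <= B + 3sB. *)
pose s := Num.min 1 (e / (3 * B + 1)).
have b0 : 0 < 3 * B + 1 by rewrite ltr_wpDl// mulr_ge0.
have s0 : 0 < s by rewrite lt_min ltr01 divr_gt0.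
apply: (le_trans (step s s0)).
have s1 : s <= 1 by rewrite ge_min lexx.
have se : s * (3 * B + 1) <= e by rewrite -ler_pdivlMr// ge_min lexx orbT.
have ss : s ^+ 2 <= s by rewrite expr2 ger_pMl.
apply: (@le_trans _ _ (B + s * (3 * B + 1))); last by rewrite lerD2l.
rewrite -subr_ge0.
have -> : B + s * (3 * B + 1) - (1 + s) ^+ 2 * B = (s - s ^+ 2) * B + s by ring.
by rewrite addr_ge0 ?mulr_ge0 ?subr_ge0// ltW.
Qed.

End localization.

(** * Separated families *)

Section essential_support.
Context {R : realType} (n : nat).
Implicit Types (x y : 'rV[R]_n) (D E : set 'rV[R]_n).

Local Notation mu := (@lebesgue_rV R n).

(** A Lindelof argument: [E] is covered by the rational boxes on which u has zero norm, and there
    are countably many of them. *)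
Lemma sqn_locally_eq0 E (u : 'rV[R]_n -> R) : open E -> sqint mu setT u ->
  (forall x, E x -> exists2 r, 0 < r & ip mu (ball x r) u u = 0) -> ip mu E u u = 0.
Proof.
move=> oE su H; have mE := open_measurable_rV oE.
have sD D (mD : measurable D) := sqint_subset mD measurableT (@subsetT _ _) su.
apply/(sqn_eq0P mE (sD _ mE)).
pose C k := if unpickle k is Some p then
  if `[< ip mu (rational_box p) u u = 0 >] then rational_box p `&` [set x | u x != 0] else set0
  else set0.
apply: (@negligibleS _ _ _ _ (\bigcup_k C k)).
  move=> x [Ex ux]; have [r r0 hr] := H x Ex.
  have mb : measurable (ball x r) by apply: open_measurable_rV; exact: ball_open.
  have [p xp pr] := @rational_box_basis R n (ball x r) x (ball_open x r) (ballxx x r0).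
  exists (pickle p) => //; rewrite /C pickleK; case: asboolP => // -[].
  apply/eqP; rewrite eq_le sqn_ge0 andbT -hr.
  by apply: sqn_subset => //; [exact: measurable_rational_box|exact: sD].
apply: negligible_bigcup => k; rewrite /C; case: unpickle => [p|]; last exact: negligible_set0.
case: asboolP => [h|_]; last exact: negligible_set0.
by apply/sqn_eq0P => //; [exact: measurable_rational_box|apply: sD; exact: measurable_rational_box].
Qed.

End essential_support.

Section separation.
Context {R : realType} (n : nat).
Implicit Types (x y p : 'rV[R]_n) (D E : set 'rV[R]_n) (u v : 'rV[R]_n -> R).

Local Notation mu := (@lebesgue_rV R n).
Local Notation sqn f := (ip mu setT f f).

Definition apart D E := forall x y, D x -> E y -> 1 <= euclidean_norm (x - y).

Lemma apartC D E : apart D E -> apart E D.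
Proof. by move=> DE x y Ex Dy; rewrite enorm_subC; exact: DE. Qed.

(** With an empty set the infimum defining [set_dist] is 0 while [apart] holds vacuously; hence the
    two nonemptiness conditions. *)
Lemma set_dist_apart D E : D !=set0 -> E !=set0 -> 1 <= set_dist D E <-> apart D E.
Proof.
move=> [x0 Dx0] [y0 Ey0]; split=> [H x y Dx Ey|H].
  apply: (le_trans H); apply: ge_inf; last by exists x => //; exists y.
  by exists 0 => _ [a _ [b _ <-]]; exact: enorm_ge0.
apply: lb_le_inf; first by exists (euclidean_norm (x0 - y0)), x0 => //; exists y0.
by move=> _ [a Da [b Eb <-]]; exact: H.
Qed.

(** No Zorn: each set is replaced in turn by everything at distance at least 1 from the others.
    Later enlargements only strengthen the condition imposed on a point, so the maximality of the
    sets already treated persists. *)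
Lemma separated_maximal (I : finType) (A : I -> set 'rV[R]_n) :
  (forall i j, i != j -> apart (A i) (A j)) ->
  exists B : I -> set 'rV[R]_n, [/\ forall i, A i `<=` B i,
    forall i j, i != j -> apart (B i) (B j) &
    forall i x, (forall j y, j != i -> B j y -> 1 <= euclidean_norm (x - y)) -> B i x].
Proof.
move=> sA.
suff H (s : seq I) : exists B : I -> set 'rV[R]_n, [/\ forall i, A i `<=` B i,
    forall i j, i != j -> apart (B i) (B j) &
    forall i x, i \in s -> (forall j y, j != i -> B j y -> 1 <= euclidean_norm (x - y)) -> B i x].
  have [B [AB sB mB]] := H (enum I); exists B; split=> // i x.
  by apply: mB; rewrite mem_enum.
elim: s => [|a s [B [AB sB mB]]]; first by exists A; split=> [i x Ax//|//|//].
pose E := [set x | forall j y, j != a -> B j y -> 1 <= euclidean_norm (x - y)].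
have BE : B a `<=` E by move=> x Bx j y ja Bjy; apply: (sB a j) => //; rewrite eq_sym.
pose B' i := if i == a then E else B i.
have BB' i : B i `<=` B' i.
  by rewrite /B'; case: eqP => [->|_]; [exact: BE|exact: subset_refl].
exists B'; split.
- by move=> i; apply: subset_trans (BB' i).
- move=> i j; rewrite /B'; case: (eqVneq i a) => [->|ia]; case: (eqVneq j a) => [_|ja].
  + by [].
  + by move=> _ x y Ex Bjy; exact: (Ex _ _ ja Bjy).
  + by move=> _; apply: apartC => x y Ex Biy; exact: (Ex _ _ ia Biy).
  + exact: sB.
- move=> i x; case: (eqVneq i a) => [-> _|ia].
    move=> H; rewrite /B' eqxx => j y ja Bjy; apply: (H j y ja).
    by rewrite /B' (negbTE ja).
  rewrite inE (negbTE ia)/= => si H; rewrite /B' (negbTE ia); apply: mB => // j y ji Bjy.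
  exact: (H _ _ ji (BB' _ _ Bjy)).
Qed.

Lemma sqn_vanish D u : measurable D -> (forall x, D x -> u x = 0) -> ip mu D u u = 0.
Proof.
move=> mD H; rewrite -(sqn0 mu mD); apply: eq_Rintegral => x; rewrite inE => Dx.
by rewrite H// mulr0.
Qed.

(** The support of u as an L^2 class, insensitive to negligible sets. Balls for the sup norm define
    the same set as Euclidean ones. *)
Definition essential_support u : set 'rV[R]_n :=
  [set x | forall r, 0 < r -> 0 < ip mu (ball x r) u u].

Lemma sqn_off_essential_support E u : open E -> sqint mu setT u ->
  (forall x, E x -> ~ essential_support u x) -> ip mu E u u = 0.
Proof.
move=> oE su H; apply: sqn_locally_eq0 => // x /H /existsNP[r /not_implyP[r0 /negP]].
rewrite -leNgt => h; exists r => //; apply/eqP.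
by rewrite eq_le h sqn_ge0.
Qed.

(** If two points of the supports were closer than 1, then for each m one of [f m], [g m] would
    vanish near its point. The product of the local norms is thus 0 for every m, hence in the limit,
    where both factors are positive. *)
Lemma essential_support_apart (D E : nat -> set 'rV[R]_n) (f g : nat -> 'rV[R]_n -> R) u v :
  (forall m, apart (D m) (E m)) ->
  (forall m, test_function (D m) (f m)) -> (forall m, test_function (E m) (g m)) ->
  sqint mu setT u -> sqint mu setT v ->
  sqn (f m - u) @[m --> \oo] --> 0 -> sqn (g m - v) @[m --> \oo] --> 0 ->
  apart (essential_support u) (essential_support v).
Proof.
move=> DE tf tg su sv cf cg x y ux vy; rewrite leNgt; apply/negP => xy.
(* Chosen so that |x - y| + 2nr < 1: moving both points within balls of sup-radius r keeps them
   closer than 1. *)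
pose r := (1 - euclidean_norm (x - y)) / (2 * n%:R + 1).
have q0 : 0 < 2 * n%:R + 1 :> R by rewrite ltr_wpDl// mulr_ge0.
have r0 : 0 < r by rewrite divr_gt0// subr_gt0.
have rE : r * (2 * n%:R + 1) = 1 - euclidean_norm (x - y) by rewrite /r divfK// gt_eqF.
have mb z : measurable (ball z r : set 'rV[R]_n) by apply: open_measurable_rV; exact: ball_open.
have sf m := test_function_sqint (tf m).
have sg m := test_function_sqint (tg m).
have cF := @cvg_sqn_restrict R n (ball x r) f u (mb x) sf su cf.
have cG := @cvg_sqn_restrict R n (ball y r) g v (mb y) sg sv cg.
(* [f m] and [g m] cannot both be nonzero near [x] and [y], respectively. *)
have fg0 : (fun m => ip mu (ball x r) (f m) (f m)) \*
    (fun m => ip mu (ball y r) (g m) (g m)) = cst 0.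
  apply/funext => m /=.
  have [fx|fx] := pselect (forall z, ball x r z -> f m z = 0).
    by rewrite (sqn_vanish (mb x) fx) mul0r.
  have [gx|gx] := pselect (forall z, ball y r z -> g m z = 0).
    by rewrite (sqn_vanish (mb y) gx) mulr0.
  move/existsNP : fx => [a /not_implyP[xa fa]].
  move/existsNP : gx => [b /not_implyP[yb gb]].
  exfalso; have : 1 <= euclidean_norm (a - b).
    apply: (DE m); apply: contrapT => h; [apply: fa|apply: gb].
      exact: test_function_eq0 (tf m) h.
    exact: test_function_eq0 (tg m) h.
  have := enorm_dist a x b; have := enorm_dist x y b.
  have := ball_enorm r0 (ball_sym xa); have := ball_enorm r0 yb; move: rE r0.
  rewrite mulrDr mulr1 mulrCA [r * _]mulrC.
  move: (euclidean_norm _) (euclidean_norm _) (euclidean_norm _) (euclidean_norm _) (euclidean_norm _) (n%:R * r) (r).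
  by move=> a1 a2 a3 a4 a5 nr r'; clear; lra.
have : ip mu (ball x r) u u * ip mu (ball y r) v v = 0.
  have c : ((fun m => ip mu (ball x r) (f m) (f m)) \*
    (fun m => ip mu (ball y r) (g m) (g m))) m @[m --> \oo] -->
    ip mu (ball x r) u u * ip mu (ball y r) v v by exact: cvgM.
  rewrite fg0 in c.
  have c0 : (cst 0 : nat -> R) m @[m --> \oo] --> (0 : R) by exact: cvg_cst.
  by exact: (cvg_unique _ c c0).
by apply/eqP; rewrite gt_eqF// mulr_gt0//; [exact: ux|exact: vy].
Qed.

End separation.

(** * The cost function *)

Section orthant_functions.
Context {R : realType} (k : nat) (F : 'rV[R]_k -> R).
Implicit Types (x y : 'rV[R]_k) (i : 'I_k).

Local Notation e_ i := (delta_mx ord0 i : 'rV[R]_k).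
Local Notation "x <=_v y" := (forall i, x ord0 i <= y ord0 i) (at level 70).

Lemma set_coordE x i (t : R) : set_coord x i t = set_coord x i 0 + t *: e_ i.
Proof.
apply/rowP => j; rewrite !mxE eqxx/=; case: eqVneq => _; last by rewrite mulr0 addr0.
by rewrite mulr1 add0r.
Qed.

Lemma set_coord_id x i : set_coord x i (x ord0 i) = x.
Proof. by apply/rowP => j; rewrite !mxE; case: eqP => [->|]. Qed.

Lemma set_coord_orthant x i (t : R) : positive_orthant k x -> 0 < t ->
  positive_orthant k (set_coord x i t).
Proof. by move=> x0 t0 j; rewrite mxE; case: ifP. Qed.

Hypothesis F_C1 : C1_on (positive_orthant k) F.
Hypothesis F_incr : forall i x, positive_orthant k x -> 0 < partial i F x.

Let derF x i (t : R) : positive_orthant k x -> 0 < t ->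
  is_derive t (1 : R) (fun s => F (set_coord x i s)) (partial i F (set_coord x i t)).
Proof.
move=> x0 t0; have [df _] := F_C1 i (set_coord_orthant i x0 t0).
rewrite (_ : (fun s => _) = (fun s => F (set_coord x i 0 + s *: e_ i))).
  by rewrite [set_coord x i t]set_coordE in df *; exact: line_derive.
by apply/funext => s; rewrite -set_coordE.
Qed.

Lemma set_coord_continuous x i (t : R) : positive_orthant k x -> 0 < t ->
  {for t, continuous (fun s => F (set_coord x i s))}.
Proof.
move=> x0 t0; apply: differentiable_continuous.
by apply/derivable1_diffP; have [] := derF i x0 t0.
Qed.

Lemma orthant_coord_nondecreasing x i (s t : R) : positive_orthant k x -> 0 < s -> s <= t ->
  F (set_coord x i s) <= F (set_coord x i t).
Proof.
move=> x0 s0 st.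
have pos a : a \in `[s, t] -> 0 < a by rewrite in_itv => /andP[/(lt_le_trans s0)].
have cl : {within `[s, t], continuous (fun a => F (set_coord x i a))}.
  by apply: continuous_in_subspaceT => a /set_mem /= ast; apply: set_coord_continuous => //; exact: pos.
have D a : a \in `]s, t[ -> is_derive a (1 : R) (fun a => F (set_coord x i a)) (partial i F (set_coord x i a)).
  by move=> ast; apply: derF => //; apply: pos; exact: subset_itv_oo_cc.
have [a ast] := MVT_segment st D cl.
rewrite -subr_ge0 => ->; rewrite mulr_ge0 ?subr_ge0// ltW//.
by apply: F_incr; apply: set_coord_orthant => //; exact: pos.
Qed.

(** Coordinates are raised one at a time, with the mean value theorem on each segment. *)
Lemma orthant_nondecreasing x y : positive_orthant k x -> x <=_v y -> F x <= F y.
Proof.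
move=> x0 xy.
have y0 : positive_orthant k y by move=> i; exact: lt_le_trans (x0 i) (xy i).
pose z (s : seq 'I_k) := \row_i (if i \in s then y ord0 i else x ord0 i).
have zE s a : z (a :: s) = set_coord (z s) a (y ord0 a).
  by apply/rowP => j; rewrite !mxE inE; case: eqP => [->|].
have z0 s : positive_orthant k (z s) by move=> j; rewrite mxE; case: ifP.
have xz s : F x <= F (z s).
  elim: s => [|a s IH].
    by rewrite (_ : z [::] = x)//; apply/rowP => j; rewrite mxE.
  apply: (le_trans IH); rewrite zE -[X in F X <= _](set_coord_id _ a).
  by apply: orthant_coord_nondecreasing => //; rewrite mxE; case: ifP.
apply: (le_trans (xz (enum 'I_k))); rewrite (_ : z _ = y)//.
by apply/rowP => j; rewrite mxE mem_enum.
Qed.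

(** Each coordinate is lowered in turn at cost at most e/(k + 1), using continuity along one line
    only. With monotonicity this replaces joint lower semicontinuity of F at the limit. *)
Lemma orthant_approx_below x (e : R) : positive_orthant k x -> 0 < e ->
  exists y, [/\ positive_orthant k y, forall i, y ord0 i < x ord0 i & F x - e <= F y].
Proof.
move=> x0 e0.
suff H (d : R) (s : seq 'I_k) : 0 < d -> exists y, [/\ positive_orthant k y, y <=_v x,
    forall i, i \in s -> y ord0 i < x ord0 i & F x - (size s)%:R * d <= F y].
  have d0 : 0 < e / (k%:R + 1) by rewrite divr_gt0// ltr_wpDl.
  have [y [y0 _ yx Fy]] := H _ (enum 'I_k) d0; exists y; split=> //.
    by move=> i; apply: yx; rewrite mem_enum.
  apply: le_trans Fy; rewrite lerD2l lerN2 size_enum_ord mulrCA ger_pMr//.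
  by rewrite ler_pdivrMr ?ltr_wpDl// mul1r lerDl.
move=> d0; elim: s => [|a s [y [y0 yx ys Fy]]].
  by exists x; split=> //; rewrite mul0r subr0.
have /cvgrPdist_le/(_ _ d0) := @set_coord_continuous y a _ y0 (y0 a).
move=> /nbhs_ballP[r /= r0 Hr].
have m0 : 0 < Num.min (r / 2) (y ord0 a / 2) by rewrite lt_min !divr_gt0//.
pose t := y ord0 a - Num.min (r / 2) (y ord0 a / 2).
have ty : t < y ord0 a by rewrite /t ltrBlDr ltrDl.
have t0 : 0 < t.
  rewrite subr_gt0 gt_min; apply/orP; right.
  by rewrite ltr_pdivrMr// ltr_pMr// ltr1n.
exists (set_coord y a t); split.
- exact: set_coord_orthant.
- move=> j; rewrite mxE; case: eqP => [->|_]; last exact: yx.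
  exact: ltW (lt_le_trans ty (yx a)).
- move=> j; rewrite inE mxE; case: eqP => [-> _|_ /= js]; last exact: ys.
  exact: lt_le_trans ty (yx a).
- have /Hr : ball (y ord0 a) r t.
    rewrite /ball/= /t opprB addrC subrK ger0_norm ?ltW// gt_min.
    by rewrite ltr_pdivrMr// ltr_pMr// ltr1n.
  rewrite /= set_coord_id => /(le_trans (ler_norm _)).
  move: Fy; rewrite -natr1 mulrDl mul1r.
  by move: (F _) (F _) (F _) (_ * d) => a1 a2 a3 a4; clear; lra.
Qed.

Hypothesis F_coercive : forall i x, positive_orthant k x ->
  F (set_coord x i t) @[t --> +oo] --> +oo.

(** Coercivity is assumed for one frozen point at a time. Monotonicity lets all other coordinates be
    frozen at the common lower bound c, which makes the bound uniform. *)
Lemma orthant_coercive (c K : R) : 0 < c ->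
  exists B, forall x, (forall i, c <= x ord0 i) -> F x <= K -> forall i, x ord0 i <= B.
Proof.
move=> c0; pose z : 'rV[R]_k := const_mx c.
have z0 : positive_orthant k z by move=> i; rewrite mxE.
have /choice[B_ HB] : forall i, exists b, forall t, b < t -> K < F (set_coord z i t).
  move=> i; have /cvgryPgt/(_ K)[b [_ Hb]] := F_coercive i z0.
  by exists b.
exists (\sum_i `|B_ i|) => x cx Fx i; rewrite leNgt; apply/negP => xi.
have : K < F (set_coord z i (x ord0 i)).
  apply: HB; apply: le_lt_trans xi; apply: (le_trans (ler_norm _)).
  by rewrite (bigD1 i)//= lerDl sumr_ge0.
apply/negP; rewrite -leNgt; apply: le_trans Fx.
apply: orthant_nondecreasing.
  by apply: set_coord_orthant => //; exact: lt_le_trans (cx i).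
by move=> j; rewrite !mxE; case: eqP => [->|].
Qed.

End orthant_functions.

(** * Passage to the limit in a sequence of partitions *)

Section limit_partition.
Context {R : realType} (n : nat).
Implicit Types (x y : 'rV[R]_n) (omega : set 'rV[R]_n).

Local Notation mu := (@lebesgue_rV R n).
Local Notation sqn f := (ip mu setT f f).

Lemma exists_limit_partition (I : finType) Omega (M B : R) (w : nat -> I -> set 'rV[R]_n) :
  (0 < n)%N -> open Omega -> 0 < M -> Omega `<=` cube n (- M) M ->
  (forall m i, [/\ w m i `<=` Omega, open (w m i) & w m i !=set0]) ->
  (forall m i j, i != j -> apart (w m i) (w m j)) ->
  (forall m i, rayleigh (w m i) <= B) ->
  exists (s : nat -> nat) (c : I -> R) (v : I -> set 'rV[R]_n),
    [/\ forall m, (m <= s m)%N,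
        forall i, rayleigh (w (s m) i) @[m --> \oo] --> c i,
        forall i, [/\ v i `<=` Omega, open (v i) & v i !=set0],
        forall i j, i != j -> apart (v i) (v j) &
        forall i, rayleigh (v i) <= c i].
Proof.
move=> n0 oO M0 OM wO sw wB.
have /choice[f_ Hf] : forall e : I * nat, exists f, [/\ test_function (w e.2 e.1) f,
    sqn f = 1 & energy f <= rayleigh (w e.2 e.1) + e.2.+1%:R^-1].
  move=> [i m]; have [_ ow w0] := wO m i.
  by apply: rayleigh_approx => //; rewrite invr_gt0.
pose f i m := f_ (i, m).
have tf i m : test_function (w m i) (f i m) by have [] := Hf (i, m).
have f1 i m : sqn (f i m) = 1 by have [] := Hf (i, m).
have Ef i m : energy (f i m) <= rayleigh (w m i) + m.+1%:R^-1 by have [] := Hf (i, m).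
have tO i m : test_function Omega (f i m).
  by have [wo _ _] := wO m i; exact: test_function_subset wo (tf i m).
have sf i m := test_function_sqint (tf i m).
have inv1 m : m.+1%:R^-1 <= 1 :> R by rewrite invf_le1// ler1n.
have [||||s [u [c [ks su fu lc]]]] := @compact_subsequence R n I f
    (fun i m => rayleigh (w m i)) M (Num.max 1 (B + 1)) M0.
- by move=> i m; exact: test_function_subset OM (tO i m).
- by move=> i m; rewrite f1 le_max lexx.
- move=> i m; apply: (le_trans (Ef i m)); rewrite le_max; apply/orP; right.
  exact: lerD.
- move=> i m; rewrite ger0_norm ?rayleigh_ge0// le_max; apply/orP; right.
  by apply: (le_trans (wB m i)); rewrite lerDl.
have u1 i : sqn (u i) = 1.
  have h : sqn (f i (s m)) @[m --> \oo] --> sqn (u i) by exact: cvg_sqn.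
  have h1 : sqn (f i (s m)) @[m --> \oo] --> (1 : R).
    by rewrite (_ : (fun m => _) = cst 1); [exact: cvg_cst|apply/funext => m; rewrite f1].
  by exact: (cvg_unique _ h h1).
have c0 i : 0 <= c i.
  rewrite -(cvg_lim _ (lc i))//; apply: limr_ge; first by apply/cvg_ex; exists (c i); exact: lc.
  by apply: nearW => m; exact: rayleigh_ge0.
have [|A [EA sA mA]] := @separated_maximal R n I (fun i => essential_support (u i)).
  move=> i j ij; apply: (@essential_support_apart _ _ (fun m => w (s m) i) (fun m => w (s m) j)
    (fun m => f i (s m)) (fun m => f j (s m))) => // m.
  exact: sw.
pose C i := [set y | exists2 j, j != i & A j y].
pose v i := Omega `&` far (C i).
(* By maximality, a point at distance at least 1 from all other sets already belongs to [A i]. *)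
have vA i : v i `<=` A i.
  move=> x [_ [d d0 Hd]]; apply: mA => j y ji Ajy.
  by apply: le_trans (Hd y _); [rewrite lerDl ltW|exists j].
(* The essential support of [u i] lies in [A i], at distance at least 1 from [C i], hence misses the
   open 1-neighbourhood. *)
have Cu i : ip mu (nbh (C i) 1) (u i) (u i) = 0.
  apply: sqn_off_essential_support => //; first exact: open_nbh.
  move=> x [y [j ji Ajy] xy] /EA Aix.
  have : 1 <= euclidean_norm (x - y) by apply: (sA i j) => //; rewrite eq_sym.
  by apply/negP; rewrite -ltNge.
have loc i : v i !=set0 /\ rayleigh (v i) <= c i.
  (* [mazur] allows an excess 1/(m + 1), shared equally between the convergence of the Rayleigh
     quotients and the defect of the almost minimizers. *)
  have /choice[k Hk] : forall m, exists k, [/\ (m <= k)%N,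
      rayleigh (w (s k) i) <= c i + (2 * m.+1%:R)^-1 & (s k).+1%:R^-1 <= (2 * m.+1%:R)^-1 :> R].
    move=> m; have e0 : 0 < (2 * m.+1%:R)^-1 :> R by rewrite invr_gt0 mulr_gt0.
    have /cvgrPdist_le/(_ _ e0)[a _ Ha] := lc i.
    exists (m + a + (2 * m.+1))%N; split.
    - by rewrite -addnA leq_addr.
    - rewrite addrC -lerBlDr; apply: (le_trans (ler_norm _)); rewrite distrC; apply: Ha => /=.
      exact: (leq_trans (leq_addl m a) (leq_addr _ _)).
    - rewrite lef_pV2 ?posrE ?mulr_gt0// -natrM ler_nat.
      exact: (leq_trans (leq_addl _ _) (leq_trans (ks _) (leqnSn _))).
  have [|||psi [tpsi cpsi Epsi dpsi]] := @mazur R n Omega (u i) (fun m => f i (s (k m))) (c i) (su i).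
  - by move=> m; exact: tO.
  - have /cvgrPdist_le H := fu i; apply/cvgrPdist_le => e e0.
    have [a _ Ha] := H e e0; exists a => // m /= am.
    by apply: Ha => /=; apply: (leq_trans am); have [] := Hk m.
  - move=> m; have [_ h1 h2] := Hk m; apply: (le_trans (Ef i (s (k m)))).
    have -> : m.+1%:R^-1 = (2 * m.+1%:R)^-1 + (2 * m.+1%:R)^-1 :> R.
      by rewrite -mulr2n -[RHS]mulr_natl invfM mulrA divff ?mul1r// pnatr_eq0.
    by rewrite addrA; exact: lerD.
  exact: (@rayleigh_localized R n Omega (C i) M (u i) psi (c i)).
exists s, c, v; split=> //.
- move=> i; split; [exact: subIsetl|by apply: openI => //; exact: open_far|by have [] := loc i].
(* A point of [v i] is in [A i], which is part of [C j], and [v j] keeps its distance from [C j]. *)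
- move=> i j ij x y /vA Aix [_ [d d0 Hd]]; rewrite enorm_subC.
  by apply: le_trans (Hd x _); [rewrite lerDl ltW|exists i].
- by move=> i; have [] := loc i.
Qed.

End limit_partition.

Theorem theorem1p2 (R : realType) (N k : nat) (Omega : set 'rV[R]_N)
    (F : 'rV[R]_k -> R)
    (hN : (2 <= N)%N) (hk : (2 <= k)%N)
    (Omega_open : open Omega) (Omega_connected : connected Omega)
    (Omega_bounded : bounded_set Omega)
    (Pk_neq0 : separated_partitions k Omega !=set0)
    (F_C1 : C1_on (positive_orthant k) F)
    (F_incr : forall (i : 'I_k) (x : 'rV[R]_k),
      positive_orthant k x -> 0 < partial i F x)
    (F_coercive : forall (i : 'I_k) (x : 'rV[R]_k), positive_orthant k x ->
      F (set_coord x i t) @[t --> +oo] --> +oo) :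
  exists2 w : 'I_k -> set 'rV[R]_N, separated_partitions k Omega w &
    (cost F w)%:E =
    ereal_inf [set (cost F v)%:E | v in separated_partitions k Omega].
Proof.
have [M M0 OM] := bounded_subset_cube Omega_bounded.
have N0 : (0 < N)%N by exact: leq_trans hN.
(* The Poincare lower bound for every admissible set; it confines the eigenvalue vectors to a
   translate of the orthant. *)
pose c0 : R := 2 / (2 * M + 1) ^+ 2.
have c00 : 0 < c0 by rewrite divr_gt0// exprn_gt0// addr_gt0// mulr_gt0.
pose adm (v : set 'rV[R]_N) := [/\ v `<=` Omega, open v & v !=set0].
have lamE v : adm v -> lambda1 v = rayleigh v.
  by move=> [vO ov v0]; apply: (lambda1_rayleigh ov v0 M0); exact: subset_trans OM.
have lam_ge v : adm v -> c0 <= rayleigh v.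
  move=> [vO ov v0]; apply: (rayleigh_ge (Ordinal N0) ov v0 M0); exact: subset_trans OM.
pose lam (w : 'I_k -> set 'rV[R]_N) : 'rV[R]_k := \row_i rayleigh (w i).
have costE w : separated_partitions k Omega w -> cost F w = F (lam w).
  by move=> [aw _]; rewrite /cost; congr F; apply/rowP => i; rewrite !mxE lamE.
have lam0 w : separated_partitions k Omega w -> positive_orthant k (lam w).
  by move=> [aw _] i; rewrite mxE; apply: lt_le_trans (lam_ge _ (aw i)).
pose S := [set cost F w | w in separated_partitions k Omega].
have S0 : S !=set0 by have [w Pw] := Pk_neq0; exists (cost F w), w.
(* By monotonicity the cost is at least F at the constant vector [c0], so the extended infimum is a
   real number. *)
have lS : has_lbound S.
  exists (F (const_mx c0)) => _ [w Pw <-]; rewrite (costE _ Pw).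
  apply: (orthant_nondecreasing F_C1 F_incr); first by move=> i; rewrite mxE.
  by move=> i; rewrite !mxE; have [aw _] := Pw; exact: lam_ge.
have -> : [set (cost F v)%:E | v in separated_partitions k Omega] = EFin @` S.
  by rewrite -image_comp.
rewrite ereal_inf_EFin//.
have /choice[w Hw] : forall m : nat, exists w, separated_partitions k Omega w /\
    cost F w < inf S + m.+1%:R^-1.
  move=> m; have e0 : 0 < m.+1%:R^-1 :> R by rewrite invr_gt0.
  by have [_ [w Pw <-] h] := inf_adherent e0 (conj S0 lS); exists w.
have Pw m : separated_partitions k Omega (w m) by have [] := Hw m.
have aw m i : adm (w m i) by have [+ _] := Pw m; exact.
have Fw m : F (lam (w m)) <= inf S + m.+1%:R^-1.
  by rewrite -costE//; have [_ /ltW] := Hw m.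
have [B HB] := orthant_coercive F_C1 F_incr F_coercive (inf S + 1) c00.
have wB m i : rayleigh (w m i) <= B.
  have := HB (lam (w m)); rewrite -[X in _ -> _ -> X]/(forall i, _) => H.
  have := H _ _ i; rewrite mxE; apply.
    by move=> j; rewrite mxE; exact: lam_ge.
  by apply: (le_trans (Fw m)); rewrite lerD2l invf_le1// ler1n.
have sep m i j : i != j -> apart (w m i) (w m j).
  move=> ij; have [_ _ wi0] := aw m i; have [_ _ wj0] := aw m j.
  by apply/(set_dist_apart wi0 wj0); have [_] := Pw m; exact.
have [s [c [v [ks lc av sv vc]]]] := exists_limit_partition N0 Omega_open M0 OM aw sep wB.
have Pv : separated_partitions k Omega v.
  split=> // i j ij; have [_ _ vi0] := av i; have [_ _ vj0] := av j.
  by apply/(set_dist_apart vi0 vj0); exact: sv.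
exists v => //; congr EFin; apply/eqP; rewrite eq_le; apply/andP; split; last first.
  by apply: ge_inf => //; exists v.
pose cv : 'rV[R]_k := \row_i c i.
have vcv i : lam v ord0 i <= cv ord0 i by rewrite !mxE.
(* The limit eigenvalues are positive because they dominate those of the admissible family [v]. *)
have cv0 : positive_orthant k cv by move=> i; exact: lt_le_trans (lam0 _ Pv i) (vcv i).
rewrite (costE _ Pv); apply: (le_trans (orthant_nondecreasing F_C1 F_incr (lam0 _ Pv) vcv)).
apply/ler_addgt0Pr => e e0; have e20 : 0 < e / 2 by rewrite divr_gt0.
(* As [y] is strictly below the limit in each coordinate, it is eventually below the eigenvalues of
   the minimizing sequence, and monotonicity compares the costs. *)
have [y [y0 yc Fy]] := orthant_approx_below F_C1 cv0 e20.
have /choice[a Ha] : forall i, exists a, forall m, (a <= m)%N -> y ord0 i <= rayleigh (w (s m) i).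
  move=> i; have d0 : 0 < cv ord0 i - y ord0 i by rewrite subr_gt0.
  have /cvgrPdist_le/(_ _ d0)[a _ H] := lc i; exists a => m am.
  have := le_trans (ler_norm _) (H m am); rewrite mxE.
  by rewrite lerD2l lerN2.
have [b _ Hb] := near_infty_natSinv_lt (PosNum e20).
pose m := (\sum_i a i + b)%N.
have := Fw (s m).
have : F y <= F (lam (w (s m))).
  apply: (orthant_nondecreasing F_C1 F_incr) => // i; rewrite mxE; apply: Ha.
  by rewrite /m (bigD1 i)//= -addnA leq_addr.
have : (s m).+1%:R^-1 < e / 2 by apply: Hb; exact: leq_trans (leq_addl _ _) (ks m).
move: Fy; rewrite [e in X in _ -> _ -> _ -> _ -> X]splitr.
move: (F _) (F _) (F _) (inf S) (e / 2) ((s m).+1%:R^-1) => a1 a2 a3 a4 a5 a6; clear; lra.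
Qed.
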